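(* Let $h\geq 1$, let $c_0,c_1,\ldots,c_h>0$ and $\nu_0,\nu_1,\ldots,\nu_h\in(0,1)$. Let $\{S_1(t)\}_{t\ge 0},\ldots,\{S_h(t)\}_{t\ge 0}$ be real-valued Lévy processes such that each $\kappa_{S_i}(\theta):=\log\mathbb{E}[e^{\theta S_i(1)}]$ is finite in a neighborhood of $\theta=0$, put $m=(m_1,\ldots,m_h):=(\kappa_{S_1}'(0),\ldots,\kappa_{S_h}'(0))$, and let $\{L_i^{\nu_i}(t)\}_{t\ge 0}$, $i=0,1,\ldots,h$, be inverse stable subordinators of parameters $\nu_i$; all these $2h+1$ processes are independent. For $\nu\in(0,1)$ set $\alpha_m(\nu):=1-\nu/2$ if $m=0$ and $\alpha_m(\nu):=1-\nu$ if $m\neq 0$, where $0\in\mathbb{R}^h$ is the null vector. Then, as $t\to\infty$: - If $m=0$, then $\left(t^{\alpha_m(\nu_0\vee\nu_i)}\frac{S_i(c_iL_i^{\nu_i}(t)+c_0L_0^{\nu_0}(t))}{t}\right)_{i\in\{1,\ldots,h\}}$ converges weakly to $$\left(\sqrt{c_iL_i^{\nu_i}(1)\kappa_{S_i}''(0)1_{\{\nu_0\leq\nu_i\}}}\,Z_i+\sqrt{c_0L_0^{\nu_0}(1)\kappa_{S_i}''(0)1_{\{\nu_i\leq\nu_0\}}}\,\widehat{Z}_i\right)_{i\in\{1,\ldots,h\}},$$ where $Z_1,\ldots,Z_h,\widehat{Z}_1,\ldots,\widehat{Z}_h$ are independent standard Normal random variables, independent of all the other random variables. - If $m\neq 0$,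 then $\left(t^{\alpha_m(\nu_0\vee\nu_i)}\frac{S_i(c_iL_i^{\nu_i}(t)+c_0L_0^{\nu_0}(t))}{t}\right)_{i\in\{1,\ldots,h\}}$ converges weakly to $$\left(c_im_i1_{\{\nu_0\leq\nu_i\}}L_i^{\nu_i}(1)+c_0m_i1_{\{\nu_i\leq\nu_0\}}L_0^{\nu_0}(1)\right)_{i\in\{1,\ldots,h\}}.$$
   Context: Inverse stable subordinator: for $\nu\in(0,1)$, the stable subordinator of order $\nu$ is the nondecreasing Lévy process $\{S_\nu(t)\}_{t\ge0}$ with $\mathbb{E}[e^{-\lambda S_\nu(t)}]=e^{-t\lambda^\nu}$ for $\lambda\ge 0$; its inverse is $L^\nu(t):=\inf\{s\geq 0:S_\nu(s)>t\}$. Notation: $x\vee y$ is the maximum of $x,y\in\mathbb{R}$. *)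

(* Defs.v *)
From HB Require Import structures.
From mathcomp Require Import all_boot all_order all_algebra.
From mathcomp Require Import all_classical all_reals all_analysis.

Set Implicit Arguments.
Unset Strict Implicit.
Unset Printing Implicit Defensive.
Import Order.TTheory GRing.Theory Num.Theory.
Import numFieldNormedType.Exports.
Local Open Scope classical_set_scope.
Local Open Scope ring_scope.

Section processes.
Context (d : measure_display) (T : measurableType d) (R : realType)
  (P : probability T R).

(* A process is indexed by all of R, but only the indices t >= 0 are ever
   constrained or used. *)
Implicit Type X : R -> {RV P >-> R}.

Definition mutual_independence (I : finType) (F : I -> set (set T)) :=
  forall (J : {set I}) (A : I -> set T),
    (forall i, i \in J -> F i (A i)) ->
    P (\bigcap_(i in [set` J]) A i) = (\prod_(i in J) P (A i))%E.

Definition process_sigma_algebra X : set (set T) :=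
  <<s \bigcup_(t in [set t : R | 0 <= t]) g_sigma_algebra_preimage (X t) >>.

Definition independent_increments X :=
  forall (n : nat) (t : nat -> R), 0 <= t 0%N ->
    {homo t : i j / (i <= j)%N >-> i <= j} ->
    mutual_independence
      (fun i : 'I_n => g_sigma_algebra_preimage (X (t i.+1) \- X (t i))).

(* The equality of laws is only required on measurable sets: the value of a
   measure on other sets carries no information. *)
Definition stationary_increments X :=
  forall s t : R, 0 <= s -> s <= t ->
    forall B : set R, measurable B ->
      P ((X t \- X s) @^-1` B) = P (X (t - s) @^-1` B).

Definition cadlag (x : R -> R) :=
  forall t : R, 0 <= t ->
    x u @[u --> t^'+] --> x t /\ (0 < t -> cvg (x u @[u --> t^'-])).

Definition levy_process X :=
  [/\ {ae P, forall w, X 0 w = 0},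
      independent_increments X,
      stationary_increments X
    & {ae P, forall w, cadlag (X ^~ w)}].

Definition stable_subordinator (nu : R) X :=
  [/\ 0 < nu < 1,
      levy_process X,
      {ae P, forall w, forall s t : R, 0 <= s -> s <= t -> X s w <= X t w}
    & forall t l : R, 0 <= t -> 0 <= l ->
        'M_P (X t) (- l) = (expR (- (t * l `^ nu)))%:E].

(* Where the set below is empty, its infimum is +oo mathematically and 0 for
   [inf]; this only happens on a negligible set. *)
Definition inverse_stable_subordinator (nu : R) (L : R -> {RV P >-> R}) :=
  exists2 X, stable_subordinator nu X &
    {ae P, forall w, forall t : R, 0 <= t ->
      L t w = inf [set s : R | 0 <= s /\ t < X s w]}.

Definition cumulant_gen_fun (X : T -> R) (theta : R) : \bar R :=
  lne ('M_P X theta).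

Definition standard_normal (Z : {RV P >-> R}) :=
  forall B : set R, measurable B -> distribution P Z B = normal_prob 0 1 B.

(* [X t] need only be measurable up to a negligible set, as is a process with
   almost surely cadlag paths evaluated at a random time; the integral of a
   bounded such function does not depend on its values on negligible sets. *)
Definition weakly_cvg (h : nat) (X : R -> T -> 'rV[R]_h) (Y : T -> 'rV[R]_h) :=
  forall f : 'rV[R]_h -> R, continuous f ->
    (exists M : R, forall x, `|f x| <= M) ->
    ('E_P[f \o X t] @[t --> +oo%R] --> 'E_P[f \o Y])%E.

End processes.

Definition alpha (R : realType) (h : nat) (m : 'rV[R]_h) (nu : R) : R :=
  if m == 0 then 1 - nu / 2 else 1 - nu.

(* Main.v *)
(** The inverse stable subordinators are self-similar: a random variable is
    determined in law by its Laplace transform, whence S(a^nu s) ~ a S(s) and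
    L(t) ~ t^nu L(1).  Freezing the random times, which are independent of the
    Levy processes, the expectation of a product of cosines
    cos (th_i V_i(t) + b_i) becomes the expectation of a product of the cosine
    transforms of the S_i at the times
    c_i t^nu_i L_i(1) + c_0 t^nu_0 L_0(1) ~ t^(max nu_0 nu_i) T_i, to which the
    law of large numbers (m <> 0) or the central limit theorem (m = 0) for Levy
    processes applies pointwise in the frozen times.  Products of cosines
    determine weak convergence: tightness follows by integrating the cosine
    transforms against a Gaussian, and on a box a continuous function is
    approximated by trigonometric polynomials.  The coordinates V_i(t) are only
    almost everywhere equal to measurable functions, so that expectations are
    handled through [aemeas] and [integ] below. *)
Require Import Defs.
From HB Require Import structures.
From mathcomp Require Import all_boot all_order all_algebra.
From mathcomp Require Import all_classical all_reals all_analysis.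
From mathcomp Require Import measurable_realfun ring lra.

Set Implicit Arguments.
Unset Strict Implicit.
Unset Printing Implicit Defensive.
Import Order.TTheory GRing.Theory Num.Theory.
Import numFieldNormedType.Exports.
Local Open Scope classical_set_scope.
Local Open Scope ring_scope.

(** * Expectations of almost everywhere measurable functions *)

(** Real cosines [cos (th * x + b)] with a free phase stand in for characteristic functions: the
    phase carries the real and the imaginary part at once, and a product of two such cosines in one
    variable is an average of two others, so that no complex integral occurs. The main obstacle is
    that paths are regular only almost surely, and only from the right. Random times are therefore
    rounded to grid points strictly on their right, and measurability up to a negligible set comes
    out of the same limit as the value of the expectation. Self-similarity is used one variable at a
    time, through the law of each single L_j(t); this suffices because the weak limit concerns one
    time at once and the L_j are independent. With M the larger of two exponents, a frozen time
    consists of about t^M unit steps. If m is nonzero the scaling is t^-M and a second-moment Taylor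
    bound costs t^-2M per step; if m = 0 it is t^(-M/2) and a third-moment bound costs t^(-3M/2).
    Both totals vanish, which is why moments up to order three are extracted from the cumulant
    generating functions. *)

Section ae_integral.
Context d (T : measurableType d) (R : realType) (mu : {measure set T -> \bar R}).
Import HBNNSimple.
Local Open Scope ereal_scope.

(** For arbitrary nonnegative functions the integral is a supremum over the simple functions below
    them. A simple function below [f], set to 0 on the exceptional null set, lies below [g] and
    keeps its integral. *)
Lemma ge0_ae_le_integral_nomeas (f g : T -> \bar R) :
  (forall x, 0 <= f x) -> (forall x, 0 <= g x) ->
  {ae mu, forall x, f x = g x} -> \int[mu]_x f x <= \int[mu]_x g x.
Proof.
move=> f0 g0 [N [mN N0 fgN]].
rewrite !ge0_integralTE//; apply: ge_ereal_sup => _ [h /= hf <-].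
pose h' := mul_nnsfun h (indic_nnsfun R (measurableC mN)).
apply: ereal_sup_ubound; exists h' => /=.
  move=> x; rewrite /= mindicE; case: (boolP (x \in ~` N)) => [|xN].
    rewrite inE => xN; rewrite mulr1; have <- : f x = g x.
      by apply: contrapT => fg; apply: xN; apply: fgN.
    exact: hf.
  by rewrite mulr0 g0.
rewrite -!integralT_nnsfun; apply: ae_eq_integral => //.
- by apply/measurable_EFinP; exact: measurable_funPT.
- by apply/measurable_EFinP; exact: measurable_funPT.
exists N; split => // x /=; apply: contra_notP => xN _.
by rewrite mindicE mem_set ?mulr1.
Qed.

Lemma ae_eq_integral_nomeas (f g : T -> \bar R) :
  {ae mu, forall x, f x = g x} -> \int[mu]_x f x = \int[mu]_x g x.
Proof.
move=> fg; have gf : {ae mu, forall x, g x = f x}.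
  by apply: filterS fg => x ->.
rewrite integralE [RHS]integralE; congr (_ - _); apply/eqP; rewrite eq_le;
  apply/andP; split; apply: ge0_ae_le_integral_nomeas => //.
- by apply: filterS fg => x; rewrite !funeposE => ->.
- by apply: filterS gf => x; rewrite !funeposE => ->.
- by apply: filterS fg => x; rewrite !funenegE => ->.
- by apply: filterS gf => x; rewrite !funenegE => ->.
Qed.

End ae_integral.

Section mean.
Context d (T : measurableType d) (R : realType) (P : probability T R).
Implicit Types f g : T -> R.

(** Real-valued and free of measurability conditions, so that it applies directly to processes at
    random times; under [integ] it is the true expectation. *)
Definition mean f : R := fine (\int[P]_w (f w)%:E)%E.

Definition aemeas f :=
  exists2 g, measurable_fun setT g & {ae P, forall w, f w = g w}.

Definition integ f :=
  exists2 g, P.-integrable setT (EFin \o g) & {ae P, forall w, f w = g w}.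

Lemma eq_mean_ae f g : {ae P, forall w, f w = g w} -> mean f = mean g.
Proof.
move=> fg; congr fine; apply: ae_eq_integral_nomeas.
by apply: filterS fg => w ->.
Qed.

Lemma eq_mean f g : f =1 g -> mean f = mean g.
Proof. by move=> /funext ->. Qed.

Lemma integ_fin f : integ f -> (\int[P]_w (f w)%:E)%E \is a fin_num.
Proof.
move=> [g ig fg]; rewrite (@ae_eq_integral_nomeas _ _ _ _ _ (EFin \o g)).
  exact: integrable_fin_num.
by apply: filterS fg => w ->.
Qed.

Lemma expectation_mean f : integ f -> ('E_P[f] = (mean f)%:E)%E.
Proof. by move=> /integ_fin ?; rewrite unlock /mean fineK. Qed.

Lemma integ_aemeas f : integ f -> aemeas f.
Proof.
by move=> [g ig fg]; exists g => //; apply/measurable_EFinP/(measurable_int P).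
Qed.

Lemma measurable_aemeas f : measurable_fun setT f -> aemeas f.
Proof. by move=> mf; exists f => //; exact: aeW. Qed.

Lemma integrable_integ f : P.-integrable setT (EFin \o f) -> integ f.
Proof. by move=> mf; exists f => //; exact: aeW. Qed.

Lemma eq_aemeas f g : {ae P, forall w, f w = g w} -> aemeas g -> aemeas f.
Proof.
by move=> fg [h mh gh]; exists h => //; apply: filterS2 fg gh => w -> ->.
Qed.

Lemma eq_integ f g : {ae P, forall w, f w = g w} -> integ g -> integ f.
Proof.
by move=> fg [h mh gh]; exists h => //; apply: filterS2 fg gh => w -> ->.
Qed.

Lemma aemeas_comp (phi : R -> R) f :
  measurable_fun setT phi -> aemeas f -> aemeas (phi \o f).
Proof.
move=> mphi [g mg fg]; exists (phi \o g); first exact: measurableT_comp.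
by apply: filterS fg => w /= ->.
Qed.

Lemma aemeasD f g : aemeas f -> aemeas g -> aemeas (f \+ g).
Proof.
move=> [f' mf ff] [g' mg gg]; exists (f' \+ g'); first exact: measurable_funD.
by apply: filterS2 ff gg => w /= -> ->.
Qed.

Lemma aemeasM f g : aemeas f -> aemeas g -> aemeas (f \* g).
Proof.
move=> [f' mf ff] [g' mg gg]; exists (f' \* g'); first exact: measurable_funM.
by apply: filterS2 ff gg => w /= -> ->.
Qed.

Lemma aemeas_cst (r : R) : aemeas (fun _ => r).
Proof. exact/measurable_aemeas/measurable_cst. Qed.

Lemma aemeas_sum (I : Type) (s : seq I) (A : pred I) (F : I -> T -> R) :
  (forall i, aemeas (F i)) -> aemeas (fun w => \sum_(i <- s | A i) F i w).
Proof.
move=> mF; elim: s => [|i s IH].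
  by under eq_fun do rewrite big_nil; exact: aemeas_cst.
under eq_fun do rewrite big_cons; case: (A i) => //; exact: aemeasD.
Qed.

Lemma aemeas_prod (I : Type) (s : seq I) (A : pred I) (F : I -> T -> R) :
  (forall i, aemeas (F i)) -> aemeas (fun w => \prod_(i <- s | A i) F i w).
Proof.
move=> mF; elim: s => [|i s IH].
  by under eq_fun do rewrite big_nil; exact: aemeas_cst.
under eq_fun do rewrite big_cons; case: (A i) => //; exact: aemeasM.
Qed.

Lemma bounded_integrable (C : R) f : measurable_fun setT f ->
  (forall w, `|f w| <= C) -> P.-integrable setT (EFin \o f).
Proof.
move=> mf fC; apply: measurable_bounded_integrable => //.
  by rewrite (le_lt_trans (probability_le1 P _))// ltry.
by exists C; split => [|M /ltW CM w _ /=]; [exact: num_real|exact: le_trans CM].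
Qed.

Lemma bounded_integ (C : R) f : aemeas f -> (forall w, `|f w| <= C) -> integ f.
Proof.
move=> [g mg fg] fC.
(* The measurable version may be unbounded where it differs from [f]; clamping it to [-C, C] changes
   it only on a negligible set. *)
exists (fun w => Num.max (- C) (Num.min C (g w))); last first.
  apply: filterS fg => w <-; move: (fC w); rewrite ler_norml => /andP[? ?].
  by rewrite min_r ?max_r.
apply: (@bounded_integrable `|C|) => [|w].
  by apply: measurable_maxr => //; exact: measurable_minr.
have := ler_norm C; have := ler_norm (- C); rewrite normrN => C1 C2.
by rewrite ler_norml ge_max le_max le_min ge_min; apply/andP; split;
  [apply/orP; left|apply/andP; split => //; apply/orP; left]; lra.
Qed.

Lemma integ_cst (r : R) : integ (fun _ => r).
Proof. by apply: (@bounded_integ `|r|); [exact: aemeas_cst|]. Qed.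

Lemma integD f g : integ f -> integ g -> integ (fun w => f w + g w).
Proof.
move=> [f' mf ff] [g' mg gg]; exists (f' \+ g').
  rewrite (_ : _ \o _ = (EFin \o f') \+ (EFin \o g'))%E//.
  exact: integrableD.
by apply: filterS2 ff gg => w /= -> ->.
Qed.

Lemma integZ (r : R) f : integ f -> integ (fun w => r * f w).
Proof.
move=> [f' mf ff]; exists (fun w => r * f' w).
  rewrite (_ : _ \o _ = (fun w => r%:E * (EFin \o f') w)%E); last first.
    by apply/funext => w /=; rewrite EFinM.
  exact: integrableZl.
by apply: filterS ff => w /= ->.
Qed.

Lemma integN f : integ f -> integ (fun w => - f w).
Proof.
by move=> /(integZ (-1)); apply: eq_integ; apply: aeW => w; rewrite mulN1r.
Qed.

Lemma integB f g : integ f -> integ g -> integ (fun w => f w - g w).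
Proof. by move=> fi gi; apply: integD => //; exact: integN. Qed.

Lemma integ_norm f : integ f -> integ (fun w => `|f w|).
Proof.
move=> [f' mf ff]; exists (fun w => `|f' w|).
  exact: (integrable_norm mf).
by apply: filterS ff => w /= ->.
Qed.

Lemma integ_sum (I : Type) (s : seq I) (A : pred I) (F : I -> T -> R) :
  (forall i, integ (F i)) -> integ (fun w => \sum_(i <- s | A i) F i w).
Proof.
move=> mF; elim: s => [|i s IH].
  by under eq_fun do rewrite big_nil; exact: integ_cst.
under eq_fun do rewrite big_cons; case: (A i) => //; exact: integD.
Qed.

Lemma mean_cst (r : R) : mean (fun _ => r) = r.
Proof.
by rewrite /mean integral_cst//= probability_setT mule1. Qed.

Lemma meanD f g : integ f -> integ g ->
  mean (fun w => f w + g w) = mean f + mean g.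
Proof.
move=> [f' mf ff] [g' mg gg].
rewrite (eq_mean_ae ff) (eq_mean_ae gg) -(RintegralD measurableT mf mg).
by apply: eq_mean_ae; apply: filterS2 ff gg => w /= -> ->.
Qed.

Lemma meanZ (r : R) f : integ f -> mean (fun w => r * f w) = r * mean f.
Proof.
move=> [f' mf ff]; rewrite (eq_mean_ae ff) -(RintegralZl _ measurableT mf).
by apply: eq_mean_ae; apply: filterS ff => w /= ->.
Qed.

Lemma meanN f : integ f -> mean (fun w => - f w) = - mean f.
Proof.
by move=> fi; rewrite -mulN1r -meanZ//; apply: eq_mean => w; rewrite mulN1r.
Qed.

Lemma meanB f g : integ f -> integ g ->
  mean (fun w => f w - g w) = mean f - mean g.
Proof. by move=> fi gi; rewrite meanD ?meanN//; exact: integN. Qed.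

Lemma mean_sum (I : Type) (s : seq I) (A : pred I) (F : I -> T -> R) :
  (forall i, integ (F i)) ->
  mean (fun w => \sum_(i <- s | A i) F i w) = \sum_(i <- s | A i) mean (F i).
Proof.
move=> mF; elim: s => [|i s IH].
  by under eq_fun do rewrite big_nil; rewrite big_nil mean_cst.
rewrite big_cons; under eq_fun do rewrite big_cons.
by case: (A i) => //; rewrite meanD ?IH//; exact: integ_sum.
Qed.

Lemma mean_ge0 f : {ae P, forall w, 0 <= f w} -> 0 <= mean f.
Proof.
move=> f0; rewrite (@eq_mean_ae _ (fun w => Num.max 0 (f w))).
  by rewrite fine_ge0// integral_ge0// => w _; rewrite lee_fin le_max lexx.
by apply: filterS f0 => w ?; rewrite max_r.
Qed.

Lemma le_mean_ae f g : integ f -> integ g ->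
  {ae P, forall w, f w <= g w} -> mean f <= mean g.
Proof.
move=> fi gi fg; rewrite -subr_ge0 -meanB//; apply: mean_ge0.
by apply: filterS fg => w; rewrite subr_ge0.
Qed.

Lemma le_mean f g : integ f -> integ g -> (forall w, f w <= g w) ->
  mean f <= mean g.
Proof. by move=> ? ? ?; apply: le_mean_ae => //; exact: aeW. Qed.

Lemma ler_norm_mean f : integ f -> `|mean f| <= mean (fun w => `|f w|).
Proof.
move=> fi; have nfi := integ_norm fi; rewrite ler_norml; apply/andP; split.
  rewrite -meanN//; apply: le_mean => //; first exact: integN.
  by move=> w; rewrite lerNl -normrN ler_norm.
by apply: le_mean => // w; rewrite ler_norm.
Qed.

Lemma mean_le_bound (C : R) f : aemeas f -> (forall w, `|f w| <= C) ->
  `|mean f| <= C.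
Proof.
move=> mf fC; have fi := bounded_integ mf fC.
rewrite (le_trans (ler_norm_mean fi))// -[leRHS]mean_cst.
by apply: le_mean => //; [exact: integ_norm|exact: integ_cst].
Qed.

Lemma mean_dist_le f g h : integ f -> integ g -> integ h ->
  {ae P, forall w, `|f w - g w| <= h w} -> `|mean f - mean g| <= mean h.
Proof.
move=> fi gi hi fgh; rewrite -meanB//.
apply: (le_trans (ler_norm_mean _)); first exact: integB.
by apply: le_mean_ae => //; exact/integ_norm/integB.
Qed.

Lemma aemeas_lim (F : nat -> T -> R) f : (forall n, aemeas (F n)) ->
  {ae P, forall w, F n w @[n --> \oo] --> f w} -> aemeas f.
Proof.
move=> mF Ff.
have /choice[G /all_and2[mG FG]] : forall n, exists G,
    measurable_fun setT G /\ {ae P, forall w, F n w = G w}.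
  by move=> n; have [G] := mF n; exists G.
(* A limit superior of measurable functions is always measurable, and it agrees with [f] wherever
   the sequence converges. *)
exists (fun w => fine (limn_esup (fun n => (G n w)%:E))).
  apply: (measurableT_comp (fine_measurable _)) => //.
  by apply: measurable_fun_limn_esup => n; exact/measurable_EFinP.
apply: filterS2 Ff (ae_foralln FG) => w Fw FGw.
have Gw : ((G n w)%:E @[n --> \oo] --> (f w)%:E)%E.
  by apply: cvg_EFin; [exact: nearW|under eq_cvg do rewrite /= -FGw].
rewrite is_cvg_limn_esupE; last by apply/cvg_ex; exists (f w)%:E.
by move/cvg_lim : Gw => ->.
Qed.

(** Dominated convergence with a constant bound; the measurability of the limit is supplied by
    [aemeas_lim]. *)
Lemma mean_cvg (C : R) (F : nat -> T -> R) f : (forall n, aemeas (F n)) ->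
  (forall n w, `|F n w| <= C) ->
  {ae P, forall w, F n w @[n --> \oo] --> f w} ->
  mean (F n) @[n --> \oo] --> mean f.
Proof.
move=> mF FC Ff; have [g mg fg] := aemeas_lim mF Ff.
have iF n : integ (F n) by exact: bounded_integ (mF n) (FC n).
have /choice[G /all_and2[mG FG]] : forall n, exists G,
    measurable_fun setT G /\ {ae P, forall w, F n w = G w}.
  by move=> n; have [G] := mF n; exists G.
rewrite (eq_mean_ae fg); under eq_cvg do rewrite (eq_mean_ae (FG _)).
have C0 : P.-integrable setT (EFin \o (fun _ : T => C)).
  exact: (@bounded_integrable `|C|).
have [gi _ cG] := @dominated_convergence _ _ _ P setT measurableT
  (fun n w => (G n w)%:E) (EFin \o g) (EFin \o (fun _ => C))
  (fun n => (measurable_EFinP _ _).2 (mG n)) ((measurable_EFinP _ _).2 mg)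
  ltac:(by apply: filterS3 Ff (ae_foralln FG) fg => w Fw FGw fgw _;
   rewrite /= -fgw; apply: cvg_EFin; [exact: nearW|under eq_cvg do rewrite /= -FGw])
  C0 ltac:(by apply: filterS (ae_foralln FG) => w FGw n _;
   rewrite /= -FGw lee_fin).
rewrite /mean; apply: fine_cvg; rewrite fineK//.
exact: integrable_fin_num.
Qed.

Lemma ae_forall_fin (J : finType) (Q : J -> T -> Prop) :
  (forall j, {ae P, forall w, Q j w}) -> {ae P, forall w, forall j, Q j w}.
Proof.
move=> aQ; have : {ae P, forall w, forall j, j \in enum J -> Q j w}.
  elim: (enum J) => [|j s IH]; first by apply: aeW.
  apply: filterS2 (aQ j) IH => w Qj Qs i; rewrite inE => /predU1P[->//|].
  exact: Qs.
by apply: filterS => w + j => /(_ j); rewrite mem_enum; apply.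
Qed.

End mean.

(** * Discretization and independence *)

Lemma eq_cvg_to (U : Type) (V : topologicalType) (F : set_system U)
    (f g : U -> V) (l : V) :
  f =1 g -> g x @[x --> F] --> l -> f x @[x --> F] --> l.
Proof. by move=> /funext ->. Qed.

Lemma norm_prod_le1 (R : realDomainType) (I : Type) (s : seq I) (A : pred I)
    (F : I -> R) :
  (forall i, `|F i| <= 1) -> `|\prod_(i <- s | A i) F i| <= 1.
Proof. by move=> F1; rewrite normr_prod prodr_ile1// => i _; rewrite normr_ge0/=. Qed.

Section big_cvg.
Context (R : realType) (U : Type) (F : set_system U) {FF : Filter F}.

Lemma cvg_prodr (I : Type) (s : seq I) (A : pred I) (f : I -> U -> R) (l : I -> R) :
  (forall i, f i x @[x --> F] --> l i) ->
  \prod_(i <- s | A i) f i x @[x --> F] --> \prod_(i <- s | A i) l i.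
Proof.
move=> fl; elim: s => [|i s IH].
  by rewrite big_nil; under eq_cvg do rewrite big_nil; exact: cvg_cst.
rewrite big_cons; under eq_cvg do rewrite big_cons.
by case: (A i) => //; exact: cvgM.
Qed.

Lemma cvg_sumr (I : Type) (s : seq I) (A : pred I) (f : I -> U -> R) (l : I -> R) :
  (forall i, f i x @[x --> F] --> l i) ->
  \sum_(i <- s | A i) f i x @[x --> F] --> \sum_(i <- s | A i) l i.
Proof.
move=> fl; elim: s => [|i s IH].
  by rewrite big_nil; under eq_cvg do rewrite big_nil; exact: cvg_cst.
rewrite big_cons; under eq_cvg do rewrite big_cons.
by case: (A i) => //; exact: cvgD.
Qed.

End big_cvg.

Section grid.
Context (R : realType).

(** As [k] is a natural number, the cells of one mesh tile the half-line from 0 only; a negative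
    point lies in none of them. *)
Definition cell (n k : nat) : set R := `[k%:R / n.+1%:R, k.+1%:R / n.+1%:R[.

Lemma measurable_cell n k : measurable (cell n k).
Proof. exact: measurable_itv. Qed.

Lemma measurable_indic_cell n k : measurable_fun setT (\1_(cell n k) : R -> R).
Proof. by apply: measurable_indic; exact: measurable_cell. Qed.

Lemma norm_cell_le1 n k (x : R) : `|\1_(cell n k) x : R| <= 1.
Proof. by rewrite indicE; case: (_ \in _); rewrite ?normr1 ?normr0. Qed.

Lemma cellE n k (x : R) : 0 <= x ->
  \1_(cell n k) x = (k == Num.truncn (x * n.+1%:R))%:R :> R.
Proof.
move=> x0; rewrite indicE; congr (nat_of_bool _)%:R.
have x0' : 0 <= x * n.+1%:R by rewrite mulr_ge0.
apply/idP/eqP => [|->]; rewrite inE /cell /= in_itv /= ler_pdivrMr// ltr_pdivlMr//.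
  by move=> h; apply/esym/eqP; rewrite truncn_eq.
by rewrite truncn_itv.
Qed.

Lemma sum_cell n N (g : nat -> R) (x : R) : 0 <= x ->
  \sum_(k < N) g k * \1_(cell n k) x =
  if (Num.truncn (x * n.+1%:R) < N)%N then g (Num.truncn (x * n.+1%:R)) else 0.
Proof.
move=> x0; under eq_bigr do rewrite cellE//.
case: ltnP => [kN|Nk].
  rewrite (bigD1 (Ordinal kN))//= eqxx mulr1 big1 ?addr0// => i.
  by move=> /negP ik; case: eqP; rewrite ?mulr0// => ik'; exfalso; apply/ik/eqP/val_inj.
rewrite big1// => i _; case: eqP; rewrite ?mulr0// => ik.
by have := ltn_ord i; rewrite ik ltnNge Nk.
Qed.

Lemma truncn_div_cvg (x : R) : 0 <= x ->
  (Num.truncn (x * n.+1%:R))%:R / n.+1%:R @[n --> \oo] --> x.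
Proof.
move=> x0; apply: (@squeeze_cvgr _ _ _ _ (fun n => x - n.+1%:R^-1) (fun=> x)).
- apply: nearW => n; have n0 : 0 <= x * n.+1%:R by rewrite mulr_ge0.
  have /andP[k1 k2] := truncn_itv n0.
  rewrite ler_pdivrMr// k1 andbT ler_pdivlMr// mulrBl mulVf ?pnatr_eq0//.
  by rewrite lerBlDr natr1 ltW.
- rewrite -[X in _ --> X]subr0; apply: cvgB; first exact: cvg_cst.
  exact: cvg_harmonic.
- exact: cvg_cst.
Qed.

End grid.

(** * Independence: from events to bounded functions *)

Section independence.
Context d (T : measurableType d) (R : realType) (P : probability T R).

Lemma mean_indic (A : set T) : measurable A -> mean P \1_A = fine (P A).
Proof. by move=> mA; rewrite /mean integral_indic// setIT. Qed.

Lemma mutual_indep_indic (I : finType) (F : I -> set (set T)) (A : I -> set T) :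
  mutual_independence P F -> (forall i, measurable (A i)) ->
  (forall i, F i (A i)) ->
  mean P (fun w => \prod_i \1_(A i) w) = \prod_i mean P \1_(A i).
Proof.
move=> indF mA FA.
have -> : (fun w => \prod_i \1_(A i) w) =
    \1_(\bigcap_(i in [set` [set: I]%SET]) A i) :> (T -> R).
  apply/funext => w; rewrite indicE; case: (boolP (w \in _)).
    rewrite inE => Aw; rewrite big1// => i _; rewrite indicE mem_set//.
    by apply: Aw => /=; rewrite inE.
  rewrite notin_setE => /existsNP[i] /not_implyP[_ Aiw].
  by rewrite (bigD1 i)//= indicE memNset// mul0r.
rewrite mean_indic; last by apply: fin_bigcap_measurable.
rewrite indF//; rewrite (eq_bigr (fun i => (fine (P (A i)))%:E)); last first.
  by move=> i _; rewrite fineK ?fin_num_measure.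
rewrite prodEFin/=; apply: eq_big => [i|i _]; first by rewrite inE.
by rewrite mean_indic.
Qed.

(** Each [Y i] is shifted by a bound [K], rounded down to a grid and shifted back. The rounded
    variables are finite combinations of indicators of preimages under [Y i], for which the claim is
    the independence of events; bounded convergence removes the rounding. *)
Lemma mutual_indep_mean (I : finType) (F : I -> set (set T)) (Y : I -> T -> R)
    (C : R) :
  mutual_independence P F -> (forall i, measurable_fun setT (Y i)) ->
  (forall i w, `|Y i w| <= C) ->
  (forall i B, measurable B -> F i (Y i @^-1` B)) ->
  mean P (fun w => \prod_i Y i w) = \prod_i mean P (Y i).
Proof.
move=> indF mY YC FY; have [K CK] : exists K : nat, C <= K%:R.
  by exists (Num.truncn C).+1; exact/ltW/truncnS_gt.
have {YC} YK i w : `|Y i w| <= K%:R by exact: le_trans CK.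
have YK0 i w : 0 <= Y i w + K%:R.
  by have := YK i w; rewrite ler_norml => /andP[]; lra.
(* The shifted variable lies in [0, 2K], so its cell index is at most 2K(n+1); the successor makes
   the strict bound of [sum_cell] hold. *)
pose N n := (2 * K * n.+1).+1.
pose E i n k : set T := Y i @^-1` [set y | cell n k (y + K%:R)].
have mcell n k : measurable [set y : R | cell n k (y + K%:R)].
  rewrite -[X in measurable X]setTI.
  have m1 : measurable_fun setT (fun y : R => y + K%:R) by exact: measurable_funD.
  by apply: m1 => //; exact: measurable_cell.
have mE i n k : measurable (E i n k).
  by rewrite -[X in measurable X]setTI; apply: mY.
have iE i n k w : \1_(E i n k) w = \1_(cell n k) (Y i w + K%:R) :> R by [].
pose a n k : R := k%:R / n.+1%:R - K%:R.
pose phi i n w := \sum_(k < N n) a n k * \1_(E i n k) w.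
have phiE i n w : phi i n w = a n (Num.truncn ((Y i w + K%:R) * n.+1%:R)).
  rewrite /phi; under eq_bigr do rewrite iE.
  have n0 : 0 <= (Y i w + K%:R) * n.+1%:R by rewrite mulr_ge0.
  have /andP[k1 _] := truncn_itv n0.
  rewrite sum_cell// ifT// /N ltnS -(ler_nat R) (le_trans k1)//.
  rewrite !natrM ler_wpM2r//.
  by have := YK i w; rewrite ler_norml => /andP[]; lra.
have phiY i w : phi i n w @[n --> \oo] --> Y i w.
  apply: (eq_cvg_to (phiE i ^~ w)).
  rewrite -[X in _ --> X](addrK K%:R); apply: cvgB; last exact: cvg_cst.
  exact: truncn_div_cvg.
have phiC i n w : `|phi i n w| <= 3 * K%:R.
  rewrite phiE /a; have n0 : 0 <= (Y i w + K%:R) * n.+1%:R by rewrite mulr_ge0.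
  have : (Num.truncn ((Y i w + K%:R) * n.+1%:R))%:R / n.+1%:R <= Y i w + K%:R.
    by rewrite ler_pdivrMr// truncn_le.
  set q : R := _ / _ => qY; have q0 : 0 <= q by rewrite divr_ge0.
  have K0 : 0 <= K%:R :> R by [].
  by have := YK i w; rewrite !ler_norml => /andP[? ?]; apply/andP; split; lra.
have mphi i n : measurable_fun setT (phi i n).
  apply: measurable_sum => k; exact: measurable_funM.
have amphi i n : aemeas P (phi i n) by exact: measurable_aemeas.
have key n : mean P (fun w => \prod_i phi i n w) = \prod_i mean P (phi i n).
  have iEi i k : integ P \1_(E i n k).
    apply: (@bounded_integ _ _ _ _ 1) => [|w]; first exact/measurable_aemeas/measurable_indic.
    by rewrite indicE; case: (_ \in _); rewrite ?normr0 ?normr1.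
  (* The product of sums becomes a sum over all choices of one cell per index; it is folded back
     after independence has been applied to each term. *)
  under eq_mean do rewrite /phi bigA_distr_bigA/=.
  have iprod (f : {ffun I -> 'I_(N n)}) : integ P (fun w => \prod_i \1_(E i n (f i)) w).
    apply: (@bounded_integ _ _ _ _ 1) => [|w].
      by apply: aemeas_prod => i; exact/measurable_aemeas/measurable_indic.
    apply: norm_prod_le1 => i.
    by rewrite indicE; case: (_ \in _); rewrite ?normr0 ?normr1.
  rewrite mean_sum; last first.
    move=> f; under eq_fun do rewrite big_split/=; exact: integZ.
  transitivity (\sum_(f : {ffun I -> 'I_(N n)})
      \prod_i (a n (f i) * mean P \1_(E i n (f i)))).
    apply: eq_bigr => f _; under eq_mean do rewrite big_split/=.
    rewrite meanZ// big_split/= (@mutual_indep_indic _ F)// => i; exact: FY.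
  rewrite -(bigA_distr_bigA (fun i (k : 'I_(N n)) => a n k * mean P \1_(E i n k))).
  apply: eq_bigr => i _.
  rewrite mean_sum; last by move=> k; exact: integZ.
  by apply: eq_bigr => k _; rewrite meanZ.
have cl : mean P (fun w => \prod_i phi i n w) @[n --> \oo] -->
    mean P (fun w => \prod_i Y i w).
  apply: (@mean_cvg _ _ _ _ (\prod_(i : I) (3 * K%:R))).
  - by move=> n; exact: aemeas_prod.
  - by move=> n w; rewrite normr_prod; apply: ler_prod => i _; rewrite normr_ge0/=.
  - by apply: aeW => w; apply: cvg_prodr => i; exact: phiY.
have cr : \prod_i mean P (phi i n) @[n --> \oo] --> \prod_i mean P (Y i).
  apply: cvg_prodr => i; apply: (@mean_cvg _ _ _ _ (3 * K%:R)) => //.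
  by apply: aeW => w; exact: phiY.
exact: (cvg_unique _ cl (eq_cvg_to key cr)).
Qed.

End independence.

(** * Freezing an independent random time *)

Section freezing.
Context d (T : measurableType d) (R : realType) (P : probability T R).
Context (J : finType).
Implicit Types (L : J -> T -> R) (H : (J -> R) -> T -> R).

(** The right end of the cell of [x]: the sampled paths are continuous from the right only. *)
Definition grid_succ n (x : R) : R := (Num.truncn (x * n.+1%:R)).+1%:R / n.+1%:R.

Lemma grid_succ_gt n (x : R) : 0 <= x -> x < grid_succ n x.
Proof.
move=> x0; rewrite ltr_pdivlMr//.
have n0 : 0 <= x * n.+1%:R by rewrite mulr_ge0.
by have /andP[] := truncn_itv n0.
Qed.

Lemma grid_succ_cvg (x : R) : 0 <= x -> grid_succ n x @[n --> \oo] --> x.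
Proof.
move=> x0; rewrite -[X in _ --> X]addr0.
apply: (@eq_cvg_to _ R _ _
  (fun n => (Num.truncn (x * n.+1%:R))%:R / n.+1%:R + n.+1%:R^-1)).
  by move=> n; rewrite /grid_succ -natr1 mulrDl mul1r.
by apply: cvgD; [exact: truncn_div_cvg|exact: cvg_harmonic].
Qed.

(** The approach is strict in every coordinate, which is what [grid_succ] delivers and what keeps a
    positive combination of the coordinates strictly to the right of its limit. *)
Definition right_continuous_path (h : (J -> R) -> R) :=
  forall l, (forall j, 0 <= l j) -> forall u : nat -> J -> R,
    (forall n j, l j < u n j) -> (forall j, u n j @[n --> \oo] --> l j) ->
    h (u n) @[n --> \oo] --> h l.

Let N n := (n.+1 ^ 2)%N.

(** With (n+1)^2 cells of length 1/(n+1) per coordinate the grid covers [0, n+1): the mesh shrinks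
    while the grid exhausts the half-line. *)
Definition grid_pt n (k : {ffun J -> 'I_(n.+1 ^ 2)}) (j : J) : R :=
  (k j).+1%:R / n.+1%:R.

Definition grid_fun L H n w :=
  \sum_(k : {ffun J -> 'I_(n.+1 ^ 2)})
    (\prod_j \1_(cell n (k j)) (L j w)) * H (grid_pt k) w.

Lemma grid_fun_lt0 L H n w j : L j w < 0 -> grid_fun L H n w = 0.
Proof.
move=> L0; rewrite /grid_fun big1// => k _; rewrite (bigD1 j)//= indicE memNset.
  by rewrite !mul0r.
rewrite /cell /= in_itv /= => /andP[]; rewrite leNgt => /negP + _; apply.
by rewrite (lt_le_trans L0).
Qed.

Lemma grid_fun_ge0 L H n w : (forall j, 0 <= L j w) ->
  grid_fun L H n w =
  if [forall j, (Num.truncn (L j w * n.+1%:R) < n.+1 ^ 2)%N]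
  then H (fun j => grid_succ n (L j w)) w else 0.
Proof.
move=> L0; rewrite /grid_fun; case: ifPn => [/forallP LN|].
  pose k0 := [ffun j => Ordinal (LN j)] : {ffun J -> 'I_(n.+1 ^ 2)}.
  rewrite (bigD1 k0)//= big1 => [|j _]; last first.
    by rewrite ffunE cellE//= eqxx.
  rewrite mul1r big1 ?addr0 => [|k kk0].
    by congr (H _ w); apply/funext => j; rewrite /grid_pt ffunE.
  have [j kj] : exists j, k j != k0 j.
    apply/existsP; rewrite -negb_forall; apply: contra kk0 => /forallP kk0.
    by apply/eqP/ffunP => j; apply/eqP.
  rewrite (bigD1 j)//= cellE//; case: eqP => [kj'|]; last by rewrite !mul0r.
  by move: kj; rewrite ffunE => /eqP; case; apply/val_inj.
rewrite negb_forall => /existsP[j jN]; rewrite big1// => k _.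
rewrite (bigD1 j)//= cellE//; case: eqP => [kj|]; last by rewrite !mul0r.
by move: jN; rewrite -kj ltn_ord.
Qed.

Lemma grid_fun_bound L H n w (C : R) : (forall l w, `|H l w| <= C) ->
  `|grid_fun L H n w| <= C.
Proof.
move=> HC; have C0 : 0 <= C by exact: le_trans (HC (fun=> 0) w).
have [/existsP[j Lj]|] := boolP [exists j, L j w < 0].
  by rewrite (@grid_fun_lt0 _ _ _ _ j)// normr0.
rewrite negb_exists => /forallP L0; rewrite grid_fun_ge0.
  by case: ifP => // _; rewrite normr0.
by move=> j; rewrite leNgt.
Qed.

Lemma grid_fun_cvg L H w : (forall j, 0 <= L j w) ->
  right_continuous_path (H ^~ w) ->
  grid_fun L H n w @[n --> \oo] --> H (L ^~ w) w.
Proof.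
move=> L0 rcH.
have cvH : H (fun j => grid_succ n (L j w)) w @[n --> \oo] --> H (L ^~ w) w.
  apply: (rcH (L ^~ w)) => // [n j|j]; first exact: grid_succ_gt.
  exact: grid_succ_cvg.
apply: cvg_trans cvH; apply: near_eq_cvg.
have [K KL] : exists K : nat, forall j, L j w <= K%:R.
  exists (\max_j (Num.truncn (L j w)).+1)%N => j.
  rewrite (le_trans (ltW (truncnS_gt _)))// ler_nat.
  exact: (leq_bigmax_cond (F := fun j => (Num.truncn (L j w)).+1)).
near=> n; rewrite grid_fun_ge0// ifT//; apply/forallP => j.
have n0 : 0 <= L j w * n.+1%:R by rewrite mulr_ge0.
have /andP[k1 _] := truncn_itv n0.
rewrite -(ltr_nat R) (le_lt_trans k1)// expnS expn1 natrM ltr_pM2r//.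
rewrite (le_lt_trans (KL j))// ltr_nat ltnS.
by near: n; exact: nbhs_infty_ge.
Unshelve. all: by end_near. Qed.

Section mean_grid.
Variables (L : J -> T -> R) (H : (J -> R) -> T -> R) (C : R).
Hypothesis mL : forall j, measurable_fun setT (L j).
Hypothesis L0 : forall j, {ae P, forall w, 0 <= L j w}.
Hypothesis HC : forall l w, `|H l w| <= C.
Hypothesis mH : forall l, (forall j, 0 <= l j) -> aemeas P (H l).
Hypothesis rcH : {ae P, forall w, right_continuous_path (H ^~ w)}.
Hypothesis indepLH : forall n (k : J -> nat) (l : J -> R), (forall j, 0 <= l j) ->
  mean P (fun w => (\prod_j \1_(cell n (k j)) (L j w)) * H l w) =
  (\prod_j mean P (fun w => \1_(cell n (k j)) (L j w))) * mean P (H l).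

Lemma measurable_cell_comp n k j :
  measurable_fun setT (fun w => \1_(cell n k) (L j w) : R).
Proof. exact: measurableT_comp (@measurable_indic_cell R n k) (mL j). Qed.

Lemma grid_pt_ge0 n (k : {ffun J -> 'I_(n.+1 ^ 2)}) j : 0 <= grid_pt k j.
Proof. by rewrite divr_ge0. Qed.

Let mterm n (k : {ffun J -> 'I_(n.+1 ^ 2)}) :
  aemeas P (fun w => (\prod_j \1_(cell n (k j)) (L j w)) * H (grid_pt k) w).
Proof.
apply: aemeasM; last by apply: mH => j; exact: grid_pt_ge0.
by apply: aemeas_prod => j; exact/measurable_aemeas/measurable_cell_comp.
Qed.

Lemma aemeas_grid_fun n : aemeas P (grid_fun L H n).
Proof. by apply: aemeas_sum => k; exact: mterm. Qed.

Lemma grid_fun_ae_cvg :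
  {ae P, forall w, grid_fun L H n w @[n --> \oo] --> H (L ^~ w) w}.
Proof. by apply: filterS2 (ae_forall_fin L0) rcH => w; exact: grid_fun_cvg. Qed.

Lemma aemeas_freeze : aemeas P (fun w => H (L ^~ w) w).
Proof. exact: aemeas_lim aemeas_grid_fun grid_fun_ae_cvg. Qed.

Lemma mean_freeze_cvg :
  \sum_(k : {ffun J -> 'I_(n.+1 ^ 2)})
    (\prod_j mean P (fun w => \1_(cell n (k j)) (L j w))) *
      mean P (H (grid_pt k)) @[n --> \oo] --> mean P (fun w => H (L ^~ w) w).
Proof.
apply: (@eq_cvg_to _ R _ _ (fun n => mean P (grid_fun L H n))); last first.
  apply: (@mean_cvg _ _ _ _ C); [exact: aemeas_grid_fun| |exact: grid_fun_ae_cvg].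
  by move=> n w; exact: grid_fun_bound.
move=> n; rewrite mean_sum => [|k].
  apply: eq_bigr => k _; rewrite -indepLH// => j; exact: grid_pt_ge0.
apply: (@bounded_integ _ _ _ _ C); first exact: mterm.
move=> w; rewrite normrM -[leRHS]mul1r ler_pM//.
by apply: norm_prod_le1 => j; rewrite indicE; case: (_ \in _); rewrite ?normr0 ?normr1.
Qed.

End mean_grid.

(* Fubini for a random field [H] evaluated at an independent random point [L].
   Discretizing [L] from the right turns both sides into the same finite sum,
   so that neither joint measurability of [H] nor a product space is needed,
   and the law of [L] only enters through the laws of its coordinates. *)
Lemma mean_freeze L L' H (C : R) :
  (forall j, measurable_fun setT (L j)) ->
  (forall j, measurable_fun setT (L' j)) ->
  (forall j, {ae P, forall w, 0 <= L j w}) ->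
  (forall j, {ae P, forall w, 0 <= L' j w}) ->
  (forall l w, `|H l w| <= C) ->
  (forall l, (forall j, 0 <= l j) -> aemeas P (H l)) ->
  {ae P, forall w, right_continuous_path (H ^~ w)} ->
  (forall n (k : J -> nat) (l : J -> R), (forall j, 0 <= l j) ->
    mean P (fun w => (\prod_j \1_(cell n (k j)) (L j w)) * H l w) =
    (\prod_j mean P (fun w => \1_(cell n (k j)) (L j w))) * mean P (H l)) ->
  (forall n (k : J -> nat),
    mean P (fun w => \prod_j \1_(cell n (k j)) (L' j w)) =
    \prod_j mean P (fun w => \1_(cell n (k j)) (L' j w))) ->
  (forall n k j, mean P (fun w => \1_(cell n k) (L j w)) =
    mean P (fun w => \1_(cell n k) (L' j w))) ->
  [/\ aemeas P (fun w => H (L ^~ w) w),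
      aemeas P (fun w => mean P (H (L' ^~ w))) &
      mean P (fun w => H (L ^~ w) w) = mean P (fun w => mean P (H (L' ^~ w)))].
Proof.
move=> mL mL' L0 L'0 HC mH rcH indL indL' LL'.
(* The averaged field is constant in the sample point, so the same discretization applies to [L']
   and [G]. Where some coordinate is negative [H l] may fail to be measurable; the default 0 keeps
   the bound [C], and [L'] almost surely avoids that region. *)
pose G l (_ : T) := if pselect (forall j, 0 <= l j) then mean P (H l) else 0.
have GE l w : (forall j, 0 <= l j) -> G l w = mean P (H l).
  by move=> l0; rewrite /G; case: pselect.
have GC l w : `|G l w| <= C.
  rewrite /G; case: pselect => l0; last by rewrite normr0 (le_trans _ (HC l w)).
  by apply: mean_le_bound => //; exact: mH.
have mG l : (forall j, 0 <= l j) -> aemeas P (G l) by move=> _; exact: aemeas_cst.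
have rcG : {ae P, forall w, right_continuous_path (G ^~ w)}.
  apply: aeW => w l l0 u lu ul.
  have u0 n j : 0 <= u n j by rewrite (le_trans (l0 j))// ltW.
  rewrite GE//; apply: (@eq_cvg_to _ R _ _ (fun n => mean P (H (u n)))).
    by move=> n; rewrite GE.
  apply: (@mean_cvg _ _ _ _ C) => // [n|]; first exact: mH.
  by apply: filterS rcH => v; apply.
have indG n (k : J -> nat) l : (forall j, 0 <= l j) ->
    mean P (fun w => (\prod_j \1_(cell n (k j)) (L' j w)) * G l w) =
    (\prod_j mean P (fun w => \1_(cell n (k j)) (L' j w))) * mean P (G l).
  move=> l0; rewrite -indL' [in RHS](_ : G l = fun=> mean P (H l)); last first.
    by apply/funext => w; rewrite GE.
  rewrite mean_cst mulrC -meanZ; last first.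
    apply: (@bounded_integ _ _ _ _ 1) => [|w].
      by apply: aemeas_prod => j; exact/measurable_aemeas/measurable_cell_comp.
    by apply: norm_prod_le1 => j; rewrite indicE; case: (_ \in _);
      rewrite ?normr0 ?normr1.
  by apply: eq_mean => w; rewrite GE// mulrC.
have aeG : {ae P, forall w, mean P (H (L' ^~ w)) = G (L' ^~ w) w}.
  have : {ae P, forall w, forall j, j \in enum J -> 0 <= L' j w}.
    elim: (enum J) => [|j s IH]; first by apply: aeW.
    apply: filterS2 (L'0 j) IH => w Lj Ls i; rewrite inE => /predU1P[->//|].
    exact: Ls.
  by apply: filterS => w L'w; rewrite GE// => j; apply: L'w; rewrite mem_enum.
split.
- exact: (@aemeas_freeze L H).
- by apply: (eq_aemeas aeG); exact: (@aemeas_freeze L' G).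
rewrite (eq_mean_ae aeG).
have c1 := @mean_freeze_cvg L H C mL L0 HC mH rcH indL.
have c2 := @mean_freeze_cvg L' G C mL' L'0 GC mG rcG indG.
(* The two approximating sums agree term by term: the cell probabilities by equality of laws, the
   other factors because [G] at a grid point is the mean of [H] there. *)
apply: (cvg_unique _ c1) => //; apply: eq_cvg_to c2 => n; apply: eq_bigr => k _.
congr (_ * _); first by apply: eq_bigr => j _; rewrite LL'.
by rewrite [in RHS](_ : G _ = fun=> mean P (H (grid_pt k))) ?mean_cst//;
  apply/funext => w; rewrite GE// => j; exact: grid_pt_ge0.
Qed.

End freezing.

(** * Taylor bounds and product formulas for sine and cosine *)

Section trig_bounds.
Context (R : realType).

Lemma measurable_cosD (s b : R) : measurable_fun setT (fun x : R => cos (s * x + b)).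
Proof.
apply: measurableT_comp; first exact: continuous_measurable_fun (@continuous_cos R).
by apply: measurable_funD => //; exact: measurable_funM.
Qed.

(** The engine of the Taylor bounds below: each is the integrated form of an earlier one, the two
    chains starting from [cos x <= 1] and [sin x <= 1]. *)
Lemma ge0_of_derive_ge0 (f f' : R -> R) : (forall x : R, is_derive x 1 f (f' x)) ->
  f 0 = 0 -> (forall x, 0 <= x -> 0 <= f' x) -> forall x, 0 <= x -> 0 <= f x.
Proof.
move=> df f0 f'0 x; rewrite le_eqVlt => /predU1P[<-|x0]; first by rewrite f0.
have D y : y \in `]0, x[ -> is_derive y 1 f (f' y) by move=> _; exact: df.
have Cf : {within `[0, x], continuous f}.
  apply: continuous_subspaceT => y; apply: differentiable_continuous.
  by apply/derivable1_diffP; have [] := df y.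
have [c] := MVT x0 D Cf.
rewrite in_itv /= => /andP[c0 _]; rewrite f0 !subr0 => ->.
by rewrite mulr_ge0 ?(ltW x0)// f'0// ltW.
Qed.

Let sin_le (x : R) : 0 <= x -> sin x <= x.
Proof.
move=> x0; rewrite -subr_ge0.
have D (y : R) : is_derive y 1 (fun y : R => y - sin y) (1 - cos y).
  by apply: is_derive_eq.
apply: (ge0_of_derive_ge0 D) x0.
- by rewrite sin0 subr0.
- by move=> y _; rewrite subr_ge0 cos_le1.
Qed.

Let cos_ge2 (x : R) : 0 <= x -> 1 - x ^+ 2 / 2 <= cos x.
Proof.
move=> x0; rewrite -subr_ge0.
have D (y : R) : is_derive y 1 (fun y : R => cos y - (1 - y ^+ 2 / 2)) (y - sin y).
  by apply: is_derive_eq; rewrite /GRing.scale/=; lra.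
apply: (ge0_of_derive_ge0 D) x0.
- by rewrite cos0; lra.
- by move=> y y0; rewrite subr_ge0 sin_le.
Qed.

Let sin_ge3 (x : R) : 0 <= x -> x - x ^+ 3 / 6 <= sin x.
Proof.
move=> x0; rewrite -subr_ge0.
have D (y : R) : is_derive y 1 (fun y : R => sin y - (y - y ^+ 3 / 6)) (cos y - (1 - y ^+ 2 / 2)).
  by apply: is_derive_eq; rewrite /GRing.scale/=; lra.
apply: (ge0_of_derive_ge0 D) x0.
- by rewrite sin0; lra.
- by move=> y y0; rewrite subr_ge0 cos_ge2.
Qed.

Let cos_ge1 (x : R) : 0 <= x -> 1 - x <= cos x.
Proof.
move=> x0; rewrite -subr_ge0.
have D (y : R) : is_derive y 1 (fun y : R => cos y - (1 - y)) (1 - sin y).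
  by apply: is_derive_eq; rewrite /GRing.scale/=; lra.
apply: (ge0_of_derive_ge0 D) x0.
- by rewrite cos0; lra.
- by move=> y y0; rewrite subr_ge0 sin_le1.
Qed.

Let sin_ge2 (x : R) : 0 <= x -> x - x ^+ 2 / 2 <= sin x.
Proof.
move=> x0; rewrite -subr_ge0.
have D (y : R) : is_derive y 1 (fun y : R => sin y - (y - y ^+ 2 / 2)) (cos y - (1 - y)).
  by apply: is_derive_eq; rewrite /GRing.scale/=; lra.
apply: (ge0_of_derive_ge0 D) x0.
- by rewrite sin0; lra.
- by move=> y y0; rewrite subr_ge0 cos_ge1.
Qed.

Let cos_le3 (x : R) : 0 <= x -> cos x <= 1 - x ^+ 2 / 2 + x ^+ 3 / 6.
Proof.
move=> x0; rewrite -subr_ge0.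
have D (y : R) : is_derive y 1 (fun y : R => 1 - y ^+ 2 / 2 + y ^+ 3 / 6 - cos y)
    (sin y - (y - y ^+ 2 / 2)).
  by apply: is_derive_eq; rewrite /GRing.scale/=; lra.
apply: (ge0_of_derive_ge0 D) x0.
- by rewrite cos0; lra.
- by move=> y y0; rewrite subr_ge0 sin_ge2.
Qed.

Let even_case (Q : R -> Prop) : (forall x, Q x -> Q (- x)) ->
  (forall x, 0 <= x -> Q x) -> forall x, Q x.
Proof.
move=> QN Q0 x; have [/Q0//|/ltW x0] := leP 0 x.
by rewrite -[x]opprK; apply/QN/Q0; rewrite oppr_ge0.
Qed.

Lemma norm_cosB1_le (x : R) : `|cos x - 1| <= x ^+ 2.
Proof.
elim/even_case: x => x; first by rewrite cosN sqrrN.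
move=> x0; rewrite ler_norml; have := cos_ge2 x0; have := cos_le1 x.
have : 0 <= x ^+ 2 by exact: sqr_ge0.
by move: (x ^+ 2) => y *; apply/andP; split; lra.
Qed.

Lemma norm_sinB_le2 (x : R) : `|sin x - x| <= x ^+ 2.
Proof.
elim/even_case: x => x; first by rewrite sinN -opprD normrN sqrrN.
move=> x0; rewrite ler_norml; have := sin_ge2 x0; have := sin_le x0.
have : 0 <= x ^+ 2 by exact: sqr_ge0.
by move: (x ^+ 2) => y *; apply/andP; split; lra.
Qed.

Lemma norm_sinB_le3 (x : R) : `|sin x - x| <= `|x| ^+ 3.
Proof.
elim/even_case: x => x; first by rewrite sinN -opprD !normrN.
move=> x0; rewrite (ger0_norm x0) ler_norml; have := sin_ge3 x0; have := sin_le x0.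
have : 0 <= x ^+ 3 by exact: exprn_ge0.
by move: (x ^+ 3) => y *; apply/andP; split; lra.
Qed.

Lemma norm_cosB_le3 (x : R) : `|cos x - (1 - x ^+ 2 / 2)| <= `|x| ^+ 3.
Proof.
elim/even_case: x => x; first by rewrite cosN normrN sqrrN.
move=> x0; rewrite (ger0_norm x0) ler_norml; have := cos_ge2 x0; have := cos_le3 x0.
have : 0 <= x ^+ 3 by exact: exprn_ge0.
by move: (x ^+ 3) (x ^+ 2) => y z *; apply/andP; split; lra.
Qed.

Lemma cos_mul_cos (x y : R) : cos x * cos y = (cos (x + y) + cos (x - y)) / 2.
Proof. by rewrite cosD cosB; lra. Qed.

(** The addition formula with each sine written as a cosine shifted by pi/2, so that only cosines
    with a phase occur. *)
Lemma cos_add_split (x y : R) :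
  cos (x + y) = \sum_(s : bool) (-1) ^+ s * (cos (x - s%:R * (pi / 2)) *
    cos (y - s%:R * (pi / 2))).
Proof.
rewrite big_bool /= expr1 expr0 !mul0r !subr0 !mul1r cosD.
by rewrite !cosB !cos_pihalf !sin_pihalf; lra.
Qed.

Lemma dist_cos_le (x y : R) : `|cos x - cos y| <= `|x - y|.
Proof.
have H (a b : R) : a <= b -> `|cos b - cos a| <= b - a.
  rewrite le_eqVlt => /predU1P[->|ab]; first by rewrite !subrr normr0.
  have D z : z \in `]a, b[ -> is_derive z 1 cos (- sin z) by move=> _; exact: is_derive_cos.
  have Cf : {within `[a, b], continuous (@cos R)}.
    by apply: continuous_subspaceT => z; exact: continuous_cos.
  have [c _ ->] := MVT ab D Cf.
  have ba0 : 0 <= b - a by rewrite subr_ge0 ltW.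
  by rewrite normrM normrN (ger0_norm ba0) ler_piMl// ler_norml sin_geN1 sin_le1.
have [xy|/ltW yx] := leP x y.
  have yx0 : 0 <= y - x by rewrite subr_ge0.
  by rewrite distrC (distrC x) (ger0_norm yx0) H.
have xy0 : 0 <= x - y by rewrite subr_ge0.
by rewrite (ger0_norm xy0) H.
Qed.

End trig_bounds.

(** * Trigonometric approximation *)

Section bernstein.
Context (R : realType).

(** The binomial weight C(n,k) y^k (1-y)^(n-k), defined by conditioning on one trial; total mass and
    variance then follow by plain induction through [bern_sumS]. *)
Fixpoint bern_weight (y : R) (n k : nat) : R :=
  match n, k with
  | 0%N, 0%N => 1
  | 0%N, _.+1 => 0
  | n'.+1, 0%N => (1 - y) * bern_weight y n' 0
  | n'.+1, k'.+1 => y * bern_weight y n' k' + (1 - y) * bern_weight y n' k'.+1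
  end.

Lemma bern_weight_gt y n k : (n < k)%N -> bern_weight y n k = 0.
Proof.
elim: n k => [|n IH] [|k]//= nk.
by rewrite !IH ?mulr0 ?addr0// ltnW.
Qed.

Lemma bern_weight_ge0 y n k : 0 <= y <= 1 -> 0 <= bern_weight y n k.
Proof.
move=> /andP[y0 y1]; have y1' : 0 <= 1 - y by rewrite subr_ge0.
elim: n k => [|n IH] [|k]//=; first by rewrite mulr_ge0.
by rewrite addr_ge0// mulr_ge0.
Qed.

Lemma bern_sumS y n (g : nat -> R) :
  \sum_(k < n.+2) bern_weight y n.+1 k * g k =
  y * \sum_(k < n.+1) bern_weight y n k * g k.+1 +
  (1 - y) * \sum_(k < n.+1) bern_weight y n k * g k.
Proof.
have -> : (1 - y) * \sum_(k < n.+1) bern_weight y n k * g k =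
    (1 - y) * \sum_(k < n.+2) bern_weight y n k * g k.
  by rewrite [in RHS]big_ord_recr/= bern_weight_gt// mul0r addr0.
rewrite !big_distrr/= big_ord_recl/= [X in _ = _ + X]big_ord_recl/=.
rewrite addrCA -big_split/= mulrA; congr (_ + _).
by apply: eq_bigr => k _; rewrite /bump/= add1n; ring.
Qed.

Lemma bern_sum1 y n : \sum_(k < n.+1) bern_weight y n k = 1.
Proof.
have : \sum_(k < n.+1) bern_weight y n k * 1 = 1.
  elim: n => [|n IH]; first by rewrite big_ord1 mulr1.
  by rewrite (bern_sumS y n (fun=> 1)) IH; ring.
by under eq_bigr do rewrite mulr1.
Qed.

(** The centre [a] is arbitrary because the success branch of the recursion moves it to [a - 1]. *)
Lemma bern_variance y n a : \sum_(k < n.+1) bern_weight y n k * (k%:R - a) ^+ 2 =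
  n%:R * (y * (1 - y)) + (n%:R * y - a) ^+ 2.
Proof.
elim: n a => [|n IH] a; first by rewrite big_ord1/=; ring.
rewrite (bern_sumS y n (fun k => (k%:R - a) ^+ 2)) IH.
under eq_bigr do rewrite -natr1 -addrA -[1 - a]opprB.
by rewrite IH -natr1; ring.
Qed.

Lemma bern_variance_le y n : 0 <= y <= 1 ->
  \sum_(k < n.+2) bern_weight y n.+1 k * (k%:R / n.+1%:R - y) ^+ 2 <= n.+1%:R^-1.
Proof.
move=> /andP[y0 y1].
have n0 : n.+1%:R != 0 :> R by rewrite pnatr_eq0.
rewrite (_ : \sum_(k < n.+2) _ = (\sum_(k < n.+2) bern_weight y n.+1 k *
    (k%:R - n.+1%:R * y) ^+ 2) / n.+1%:R ^+ 2); last first.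
  by rewrite mulr_suml; apply: eq_bigr => k _; field.
rewrite bern_variance subrr expr0n/= addr0 ler_pdivrMr ?exprn_gt0//.
rewrite (_ : _^-1 * _ = n.+1%:R); last by field.
rewrite ler_piMr//.
by rewrite mulr_ile1// ?subr_ge0//; lra.
Qed.

End bernstein.
Arguments bern_weight : simpl never.

Section trigonometric_polynomial.
Context (R : realType) (h : nat).
Implicit Types (F : 'rV[R]_h -> R).

Inductive trigpoly : ('rV[R]_h -> R) -> Prop :=
| trigpoly_cst c : trigpoly (fun _ => c)
| trigpoly_cos i th b : trigpoly (fun x => cos (th * x 0 i + b))
| trigpolyD F G : trigpoly F -> trigpoly G -> trigpoly (fun x => F x + G x)
| trigpolyM F G : trigpoly F -> trigpoly G -> trigpoly (fun x => F x * G x).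

Lemma trigpoly_sum (I : Type) (s : seq I) (F : I -> 'rV[R]_h -> R) :
  (forall i, trigpoly (F i)) -> trigpoly (fun x => \sum_(i <- s) F i x).
Proof.
move=> tF; elim: s => [|i s IH].
  by under eq_fun do rewrite big_nil; exact: trigpoly_cst.
by under eq_fun do rewrite big_cons; exact: trigpolyD.
Qed.

Lemma trigpoly_prod (I : Type) (s : seq I) (F : I -> 'rV[R]_h -> R) :
  (forall i, trigpoly (F i)) -> trigpoly (fun x => \prod_(i <- s) F i x).
Proof.
move=> tF; elim: s => [|i s IH].
  by under eq_fun do rewrite big_nil; exact: trigpoly_cst.
by under eq_fun do rewrite big_cons; exact: trigpolyM.
Qed.

Lemma trigpoly_bern F n k : trigpoly F -> trigpoly (fun x => bern_weight (F x) n k).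
Proof.
move=> tF; have tF1 : trigpoly (fun x => 1 - F x).
  rewrite (_ : (fun x => 1 - F x) = (fun x => 1 + (-1) * F x)); last first.
    by apply/funext => x; rewrite mulN1r.
  by apply: trigpolyD; [|apply: trigpolyM => //]; exact: trigpoly_cst.
elim: n k => [|n IH] [|k]/=; try exact: trigpoly_cst.
  exact: trigpolyM.
by apply: trigpolyD; exact: trigpolyM.
Qed.

(** Uniform continuity near a box, from compactness; only [x] is confined to the box, so the nearby
    point [y] requires no membership proof. *)
Lemma continuous_row_unif (f : 'rV[R]_h -> R) (K e : R) : continuous f -> 0 < e ->
  exists2 dl : R, 0 < dl & forall x y : 'rV[R]_h, (forall i, `|x 0 i| <= K) ->
    (forall i, `|x 0 i - y 0 i| < dl) -> `|f x - f y| < e.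
Proof.
move=> cf e0.
have cQ : compact [set v : 'rV[R]_h | forall i, `[- K, K]%classic (v ord0 i)].
  apply: (@rV_compact _ _ (fun=> `[- K, K]%classic)) => i.
  exact: segment_compact.
move/compact_near_coveringP/near_covering_withinP : cQ => cQ.
have := @cQ R (0%R)^'+ (fun dl x => forall y : 'rV[R]_h,
  (forall i, `|x 0 i - y 0 i| < dl) -> `|f x - f y| < e) _.
case.
  move=> x _; have e20 : 0 < e / 2 by rewrite divr_gt0.
  have /cvgrPdist_lt/(_ _ e20)/nbhs_ballP[r /= r0 rf] := cf x.
  exists (ball x (r / 2), [set dl | 0 < dl < r / 2]) => /=.
    split; first by apply: nbhsx_ballx; rewrite divr_gt0.
    have r20 : 0 < r / 2 by rewrite divr_gt0.
    have p1 : \forall dl \near (0 : R)^'+, 0 < dl by exact: nbhs_right_gt.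
    have p2 : \forall dl \near (0 : R)^'+, dl < r / 2 by exact: nbhs_right_lt.
    by apply: filterS2 p1 p2 => dl ? ?; apply/andP.
  move=> [x' dl] /= [[_ xx'] /andP[dl0 dlr]] _ y x'y.
  have f1 : `|f x - f x'| < e / 2.
    apply: rf; split => // i j; apply: le_ball (xx' i j).
    by rewrite ler_pdivrMr// ler_peMr// ?ler1n// ltW.
  have f2 : `|f x - f y| < e / 2.
    apply: rf; split => // i j; rewrite (splitr r).
    apply: ball_triangle (xx' i j) _; rewrite /ball/= (ord1 i).
    by rewrite (lt_trans (x'y j)).
  rewrite (splitr e) (_ : f x' - f y = (f x - f y) - (f x - f x')); last by ring.
  by rewrite (le_lt_trans (ler_normB _ _))// ltrD.
move=> /= dl dl0 dlQ.
exists (dl / 2); first by rewrite divr_gt0.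
move=> x y xK xy; apply: (dlQ (dl / 2)) => //=.
- rewrite sub0r normrN ger0_norm ?divr_ge0 ?(ltW dl0)//.
  by rewrite ltr_pdivrMr// ltr_pMr// ltr1n.
- by rewrite divr_gt0.
- by move=> i; rewrite /= in_itv /= -ler_norml.
Qed.

(* The polynomials in [sin (om * x)] of Bernstein are applied to
   [f (sin (om * x) / om)], which is everywhere bounded like [f], and is close
   to [f] on a given box when [om] is small. *)
Lemma trigpoly_approx (f : 'rV[R]_h -> R) (M K e : R) :
  continuous f -> (forall x, `|f x| <= M) -> 0 < K -> 0 < e ->
  exists F, [/\ trigpoly F, forall x, `|F x| <= M &
    forall x : 'rV[R]_h, (forall i, `|x 0 i| <= K) -> `|F x - f x| <= e].
Proof.
move=> cf fM K0 e0; have M0 : 0 <= M by exact: le_trans (fM 0).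
have e20 : 0 < e / 2 by rewrite divr_gt0.
have e40 : 0 < e / 4 by rewrite divr_gt0.
have [d1 d10 fd1] := continuous_row_unif K cf e20.
(* Since |sin u - u| <= u^2, on the box sin (om x)/om differs from x by at most om K^2, which is
   d1/2 for this choice. *)
pose om := d1 / (2 * K ^+ 2).
have K20 : 0 < K ^+ 2 by rewrite exprn_gt0.
have om0 : 0 < om by rewrite divr_gt0// mulr_gt0.
have omK : om * K ^+ 2 < d1.
  rewrite (_ : om * _ = d1 / 2); first lra.
  by rewrite /om; field; rewrite gt_eqF.
have [d2 d20 fd2] := continuous_row_unif om^-1 cf e40.
(* A grid ratio [q] corresponds to the node (2q - 1)/om, so a ratio within [eta] of [yy] gives a
   node within [d2] of the coordinate of [z x]. *)
pose eta := d2 * om / 2.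
have eta0 : 0 < eta by rewrite divr_gt0// mulr_gt0.
pose yy (x : R) := (1 + sin (om * x)) / 2.
have yy01 x : 0 <= yy x <= 1.
  by have := sin_geN1 (om * x); have := sin_le1 (om * x); rewrite /yy => *; apply/andP; split; lra.
pose z (x : 'rV[R]_h) : 'rV[R]_h := \row_i (sin (om * x 0 i) / om).
(* Chebyshev: each of the [h] coordinates deviates by [eta] with weight at most 1/((n+1) eta^2), at
   a cost of at most 2M; the total is to stay below e/4. *)
have [n nP] : exists n : nat, 2 * M * h%:R / eta ^+ 2 / (e / 4) <= n.+1%:R.
  by eexists; exact/ltW/truncnS_gt.
pose pt (k : {ffun 'I_h -> 'I_n.+2}) : 'rV[R]_h :=
  \row_i ((2 * ((k i)%:R / n.+1%:R) - 1) / om).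
pose W (k : {ffun 'I_h -> 'I_n.+2}) (x : 'rV[R]_h) :=
  \prod_i bern_weight (yy (x 0 i)) n.+1 (k i).
have W0 k x : 0 <= W k x by apply: prodr_ge0 => i _; exact: bern_weight_ge0.
have W1 x : \sum_k W k x = 1.
  rewrite -(bigA_distr_bigA (fun i (k : 'I_n.+2) => bern_weight (yy (x 0 i)) n.+1 k)).
  by rewrite big1// => i _; exact: bern_sum1.
have Wvar x i : \sum_k W k x * ((k i)%:R / n.+1%:R - yy (x 0 i)) ^+ 2 <= n.+1%:R^-1.
  (* The squared deviation is inserted in coordinate [i] only, so the sum factors over the
     coordinates and all factors but one equal 1. *)
  pose q j (k : 'I_n.+2) : R :=
    if j == i then (k%:R / n.+1%:R - yy (x 0 j)) ^+ 2 else 1.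
  have -> : \sum_k W k x * ((k i)%:R / n.+1%:R - yy (x 0 i)) ^+ 2 =
      \prod_j \sum_(k < n.+2) bern_weight (yy (x 0 j)) n.+1 k * q j k.
    rewrite bigA_distr_bigA; apply: eq_bigr => k _.
    rewrite big_split/=; congr (_ * _); rewrite (bigD1 i)//= {1}/q eqxx.
    by rewrite big1 ?mulr1// => j ji; rewrite /q (negbTE ji).
  rewrite (bigD1 i)//= [X in _ * X]big1 ?mulr1 => [|j ji].
    by rewrite /q eqxx; exact: bern_variance_le.
  by rewrite /q (negbTE ji); under eq_bigr do rewrite mulr1; exact: bern_sum1.
exists (fun x => \sum_k f (pt k) * W k x); split.
- apply: trigpoly_sum => k; apply: trigpolyM; first exact: trigpoly_cst.
  apply: trigpoly_prod => i; apply: trigpoly_bern.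
  rewrite (_ : (fun x : 'rV[R]_h => yy (x 0 i)) =
    (fun x => 2^-1 + 2^-1 * cos (om * x 0 i + - (pi / 2)))); last first.
    apply/funext => x; rewrite /yy cosB cos_pihalf sin_pihalf; lra.
  apply: trigpolyD; first exact: trigpoly_cst.
  by apply: trigpolyM; [exact: trigpoly_cst|exact: trigpoly_cos].
- move=> x; rewrite (le_trans (ler_norm_sum _ _ _))// -[leRHS]mulr1 -(W1 x) mulr_sumr.
  by apply: ler_sum => k _; rewrite normrM (ger0_norm (W0 k x)) ler_wpM2r.
move=> x xK.
have omV0 : 0 <= om^-1 by rewrite invr_ge0 ltW.
have zK i : `|z x 0 i| <= om^-1.
  rewrite mxE normrM (ger0_norm omV0).
  by rewrite ler_piMl// ler_norml sin_geN1 sin_le1.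
have fz : `|f (z x) - f x| <= e / 2.
  rewrite distrC ltW//; apply: fd1 => // i; rewrite mxE distrC.
  rewrite (_ : _ - _ = (sin (om * x 0 i) - om * x 0 i) / om); last first.
    by rewrite mulrBl (mulrC om) mulfK ?gt_eqF.
  rewrite normrM (ger0_norm omV0).
  rewrite ltr_pdivrMr// (le_lt_trans (norm_sinB_le2 _))//.
  rewrite exprMn expr2 -mulrA mulrC ltr_pM2r//.
  apply: le_lt_trans omK; rewrite ler_wpM2l ?(ltW om0)//.
  by rewrite -(real_normK (num_real (x 0 i))) lerXn2r// ?nnegrE ?(ltW K0)//.
have Ff : `|\sum_k f (pt k) * W k x - f (z x)| <= e / 2.
  have -> : f (z x) = \sum_k f (z x) * W k x by rewrite -mulr_sumr W1 mulr1.
  rewrite -sumrB (le_trans (ler_norm_sum _ _ _))//.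
  pose c := 2 * M / eta ^+ 2.
  have c0 : 0 <= c by apply: divr_ge0; [exact: mulr_ge0|exact/exprn_ge0/ltW].
  pose v (k : {ffun 'I_h -> 'I_n.+2}) i := ((k i)%:R / n.+1%:R - yy (x 0 i)) ^+ 2.
  have vs : \sum_k W k x * (\sum_i c * v k i) <= e / 4.
    under eq_bigr do rewrite mulr_sumr.
    rewrite exchange_big/=.
    apply: (@le_trans _ _ (\sum_(i < h) c * n.+1%:R^-1)).
      apply: ler_sum => i _; under eq_bigr do rewrite mulrCA.
      by rewrite -mulr_sumr ler_wpM2l//; exact: (Wvar x i).
    rewrite sumr_const card_ord -[X in X <= _]mulr_natr mulrAC.
    have nP' : 2 * M * h%:R / eta ^+ 2 <= n.+1%:R * (e / 4) by rewrite -ler_pdivrMr.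
    by rewrite ler_pdivrMr// [leRHS]mulrC (le_trans _ nP')// /c mulrAC.
  have : \sum_k W k x * (e / 4 + \sum_i c * v k i) <= e / 2.
    under eq_bigr do rewrite mulrDr.
    rewrite big_split/= -big_distrl/= W1 mul1r; lra.
  apply: le_trans; apply: ler_sum => k _.
  rewrite -mulrBl normrM (ger0_norm (W0 k x)) mulrC ler_wpM2l//.
  have term0 i : 0 <= c * v k i by apply: mulr_ge0 => //; exact: sqr_ge0.
  (* If some coordinate is far, its term [c * v k i] already exceeds 2M; if none is, the node is
     close to [z x] and continuity gives e/4. *)
  have [/existsP[i ki]|] := boolP [exists i, eta <= `|(k i)%:R / n.+1%:R - yy (x 0 i)|].
    apply: (@le_trans _ _ (2 * M)).
      by rewrite (le_trans (ler_normB _ _))// mulrDl mul1r lerD.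
    rewrite (bigD1 i)//= -[leLHS]add0r; apply: lerD; first exact: ltW.
    rewrite -[leLHS]addr0; apply: lerD; last exact: sumr_ge0.
    rewrite /c -mulrA -[leLHS]mulr1 ler_wpM2l ?mulr_ge0//.
    rewrite mulrC ler_pdivlMr ?exprn_gt0// mul1r /v -(real_normK (num_real (_ - _))).
    by rewrite lerXn2r// ?nnegrE ?(ltW eta0).
  rewrite negb_exists => /forallP ki.
  rewrite -[leLHS]addr0; apply: lerD; last exact: sumr_ge0.
  rewrite distrC ltW//; apply: fd2 => // i; have := ki i; rewrite -ltNge => kie.
  rewrite !mxE distrC (_ : _ - _ = ((k i)%:R / n.+1%:R - yy (x 0 i)) * (2 / om)).
    have t0 : 0 < 2 / om by rewrite divr_gt0.
    rewrite normrM (ger0_norm (ltW t0)) -ltr_pdivlMr// invf_div.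
    by rewrite mulrA.
  rewrite /yy; field.
  by rewrite gt_eqF//= addrC natr1 pnatr_eq0.
rewrite (_ : _ - f x = (\sum_k f (pt k) * W k x - f (z x)) + (f (z x) - f x)); last by ring.
by rewrite (le_trans (ler_normD _ _))//; lra.
Qed.

End trigonometric_polynomial.

(** * The Gaussian cosine transform *)

Section integrable_EFin.
Context d (T : measurableType d) (R : realType) (mu : {measure set T -> \bar R}).
Context (D : set T) (mD : measurable D).
Implicit Types f g : T -> R.

Lemma integrable_EFinZ (r : R) f : mu.-integrable D (EFin \o f) ->
  mu.-integrable D (EFin \o (fun x => r * f x)).
Proof.
move=> fi; rewrite [X in _.-integrable D X](_ : _ =
  (fun x => r%:E * (EFin \o f) x)%E); first exact: integrableZl.
by apply/funext => x /=; rewrite EFinM.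
Qed.

Lemma integrable_EFinB f g : mu.-integrable D (EFin \o f) ->
  mu.-integrable D (EFin \o g) -> mu.-integrable D (EFin \o (fun x => f x - g x)).
Proof.
move=> fi gi; rewrite [X in _.-integrable D X](_ : _ =
  (EFin \o f) \- (EFin \o g))%E//; exact: integrableB.
Qed.

End integrable_EFin.

Section gaussian_cos.
Context (R : realType).
Local Notation mu := (@lebesgue_measure R).
Local Notation phi := (normal_pdf (0 : R) 1).

Lemma integral_normal_prob (m s : R) (f : R -> R) :
  (normal_prob m s).-integrable setT (EFin \o f) ->
  (\int[normal_prob m s]_x (f x)%:E =
   \int[mu]_x (f x * normal_pdf m s x)%:E)%E.
Proof.
move=> fi; have dom := normal_prob_dominates m s.
have mf := measurable_int _ fi.
rewrite -(Radon_Nikodym_change_of_variables dom)//=.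
under [RHS]eq_integral do rewrite EFinM.
have mpdf : measurable_fun setT (EFin \o normal_pdf m s).
  by apply/measurable_EFinP; exact: measurable_normal_pdf.
apply: ae_eq_integral => //; [exact: emeasurable_funM|exact: emeasurable_funM|].
(* The Radon-Nikodym derivative is given abstractly; it is identified with the normal density
   because both have the same integral over every measurable set. *)
apply: ae_eqe_mul2l; rewrite Radon_NikodymE//=.
case: cid => g /= [_ gi gE].
apply: integral_ae_eq => // E _ mE.
by rewrite -gE.
Qed.

Let phiE (x : R) : phi x = normal_peak 1 * expR (- x ^+ 2 / 2).
Proof. by rewrite normal_pdfE ?oner_eq0// /normal_fun subr0 expr1n. Qed.

Let phi0 (x : R) : 0 <= phi x. Proof. exact: normal_pdf_ge0. Qed.

Let dphi (x : R) : is_derive x 1 phi (- x * phi x).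
Proof.
rewrite (_ : phi = fun x => normal_peak 1 * expR (- x ^+ 2 / 2)); last exact/funext.
have D : is_derive x 1 (fun x : R => - x ^+ 2 / 2) (- x).
  by apply: is_derive_eq; rewrite /GRing.scale/=; lra.
apply: is_derive_eq; rewrite /GRing.scale/=; lra.
Qed.

Let mphi : measurable_fun setT phi.
Proof. exact: measurable_normal_pdf. Qed.

(** Since |x| <= exp (x^2/4), a multiple of the normal density of variance 2 dominates. *)
Let integrable_norm_phi : mu.-integrable setT (EFin \o (fun x => `|x| * phi x)).
Proof.
have i2 := integrable_normal_pdf (0 : R) (Num.sqrt 2).
have s2 : Num.sqrt 2 != 0 :> R by rewrite sqrtr_eq0 -ltNge.
have p2 : 0 < normal_peak (Num.sqrt 2 : R) by exact: normal_peak_gt0.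
pose c : R := normal_peak 1 / normal_peak (Num.sqrt 2).
have ic : mu.-integrable setT
    (EFin \o (fun x => c * normal_pdf 0 (Num.sqrt 2) x)).
  exact: integrable_EFinZ.
apply: le_integrable ic => //.
  by apply/measurable_EFinP; exact: measurable_funM.
move=> x _ /=; rewrite lee_fin normrM normr_id (ger0_norm (phi0 x)).
rewrite [leRHS]ger0_norm; last by rewrite mulr_ge0 ?normal_pdf_ge0 ?divr_ge0 ?normal_peak_ge0.
have xe : `|x| <= expR (x ^+ 2 / 4).
  apply: le_trans (expR_ge1Dx _); rewrite -(real_normK (num_real x)).
  by have := sqr_ge0 (`|x| / 2 - 1); move: `|x| => z; rewrite sqrrB expr_div_n; lra.
have -> : c * normal_pdf 0 (Num.sqrt 2) x = normal_peak 1 * expR (- x ^+ 2 / 4).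
  rewrite normal_pdfE// /normal_fun subr0 sqr_sqrtr// /c mulrA divfK ?gt_eqF//.
  by congr (_ * expR (_ / _)); lra.
rewrite phiE mulrCA ler_wpM2l ?normal_peak_ge0//.
rewrite (_ : - x ^+ 2 / 4 = x ^+ 2 / 4 + - x ^+ 2 / 2); last lra.
by rewrite expRD ler_wpM2r ?expR_ge0.
Qed.

Let phi_cvg0 : phi n%:R @[n --> \oo] --> (0 : R).
Proof.
apply: (@squeeze_cvgr _ _ _ _ (fun=> 0) (fun n => normal_peak 1 * 2 * n.+1%:R^-1)).
- apply: nearW => n; rewrite phi0 /= ler_pdivlMr// phiE -!mulrA.
  rewrite ler_wpM2l ?normal_peak_ge0// mulNr expRN mulrC ler_pdivrMr ?expR_gt0//.
  apply: le_trans (_ : 2 * (1 + n%:R ^+ 2 / 2) <= _); last first.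
    by rewrite ler_wpM2l// expR_ge1Dx.
  have := sqr_ge0 (n%:R - 1 : R); have : 0 <= n%:R :> R by [].
  by rewrite -natr1; move: (n%:R : R) => z; rewrite sqrrB1; lra.
- exact: cvg_cst.
- rewrite -[X in _ --> X](mulr0 (normal_peak 1 * 2)).
  by apply: cvgM; [exact: cvg_cst|exact: cvg_harmonic].
Qed.

Let dg (s b x : R) : is_derive x 1 (fun x => sin (s * x + b) * phi x)
  (s * (cos (s * x + b) * phi x) - x * sin (s * x + b) * phi x).
Proof.
have D1 : is_derive x 1 (fun x => sin (s * x + b)) (s * cos (s * x + b)).
  by apply: is_derive_eq; rewrite /GRing.scale/=; lra.
apply: (is_derive_eq (is_deriveM D1 (dphi x))).
by rewrite /GRing.scale/=; ring.
Qed.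

Let measurable_sinD (s b : R) : measurable_fun setT (fun x : R => sin (s * x + b)).
Proof.
apply: measurableT_comp => //; first exact: continuous_measurable_fun (@continuous_sin R).
by apply: measurable_funD => //; exact: measurable_funM.
Qed.

Let integrable_cos_phi s b :
  mu.-integrable setT (EFin \o (fun x => cos (s * x + b) * phi x)).
Proof.
apply: le_integrable (integrable_normal_pdf 0 1) => //.
  apply/measurable_EFinP; apply: measurable_funM; last exact: mphi.
  exact: measurable_cosD.
move=> x _ /=; rewrite lee_fin normrM ler_piMl// ler_norml.
by rewrite cos_geN1 cos_le1.
Qed.

Let integrable_xsin_phi s b :
  mu.-integrable setT (EFin \o (fun x => x * sin (s * x + b) * phi x)).
Proof.
apply: le_integrable integrable_norm_phi => //.
  apply/measurable_EFinP; apply: measurable_funM; last exact: mphi.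
  by apply: measurable_funM => //; exact: measurable_sinD.
move=> x _ /=; rewrite lee_fin !normrM normr_id ler_wpM2r// ler_piMr// ler_norml.
by rewrite sin_geN1 sin_le1.
Qed.

(** Stein's identity: the derivative of sin (s x + b) phi(x) integrates to 0, by the fundamental
    theorem of calculus on [-(n+1), n+1], the decay of phi and dominated convergence. *)
Let stein s b : \int[mu]_x (x * sin (s * x + b) * phi x) =
  s * \int[mu]_x (cos (s * x + b) * phi x).
Proof.
have i1 : mu.-integrable setT (EFin \o (fun x => s * (cos (s * x + b) * phi x))).
  exact/integrable_EFinZ/integrable_cos_phi.
have i2 := integrable_xsin_phi s b.
apply/esym/eqP; rewrite -subr_eq0 -RintegralZl// -RintegralB//.
pose g x := sin (s * x + b) * phi x.
pose g' x := s * (cos (s * x + b) * phi x) - x * sin (s * x + b) * phi x.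
rewrite -/g'; have ig' : mu.-integrable setT (EFin \o g').
  exact: integrable_EFinB.
have cg' : continuous g'.
  move=> x; apply: cvgB.
    apply: cvgM; first exact: cvg_cst.
    apply: cvgM; last exact: continuous_normal_pdf.
    apply: (cvg_comp _ cos); last exact: continuous_cos.
    by apply: cvgD; [apply: cvgM; [exact: cvg_cst|exact: cvg_id]|exact: cvg_cst].
  apply: cvgM; last exact: continuous_normal_pdf.
  apply: cvgM; first exact: cvg_id.
  apply: (cvg_comp _ sin); last exact: continuous_sin.
  by apply: cvgD; [apply: cvgM; [exact: cvg_cst|exact: cvg_id]|exact: cvg_cst].
have cg : continuous g.
  move=> x; apply: differentiable_continuous; apply/derivable1_diffP.
  by have [] := dg s b x.
pose I n : set R := `[- n.+1%:R, n.+1%:R]%classic.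
pose dgn n : R := g n.+1%:R - g (- n.+1%:R).
have FTC n : (\int[mu]_(x in I n) (g' x)%:E = (dgn n)%:E)%E.
  rewrite /dgn EFinB; apply: continuous_FTC2.
  - by rewrite gtrN.
  - exact: continuous_subspaceT.
  - split.
    + by move=> x _; have [] := dg s b x.
    + exact/cvg_at_right_filter/cg.
    + exact/cvg_at_left_filter/cg.
  - by move=> x _; rewrite derive1E; have [_ ->] := dg s b x.
pose fn n (x : R) : \bar R := ((g' \_ (I n)) x)%:E.
pose ng x : R := `|g' x|.
have mfn n : measurable_fun setT (fn n).
  have mI : measurable (I n) by exact: measurable_itv.
  apply/measurable_EFinP; apply/(measurable_restrictT _ mI).
  by apply: measurable_funTS; exact: continuous_measurable_fun.
have mg' : measurable_fun setT (EFin \o g').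
  by apply/measurable_EFinP; exact: continuous_measurable_fun.
have fng : {ae mu, forall x, setT x -> (fn ^~ x @ \oo --> (EFin \o g') x)%E}.
  apply: aeW => x _; apply: cvg_near_cst.
  exists (Num.truncn `|x|) => // n /= xn.
  rewrite /fn patchE mem_set// /I /= in_itv/= -ler_norml.
  by rewrite (le_trans (ltW (truncnS_gt _)))// ler_nat ltnS.
have fnb : {ae mu, forall x n, setT x -> (`|fn n x| <= (EFin \o ng) x)%E}.
  by apply: aeW => x n _; rewrite /fn /ng lee_fin patchE; case: ifP => // _; rewrite normr0.
have [_ _ cv] :=
  @dominated_convergence _ _ R mu setT measurableT fn (EFin \o g') (EFin \o ng)
    mfn mg' fng (integrable_norm ig') fnb.
have cv1 : ((dgn n)%:E @[n --> \oo] --> \int[mu]_x (g' x)%:E)%E.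
  apply: eq_cvg_to cv => n; rewrite -FTC [LHS]integral_mkcond.
  by apply: eq_integral => x _; rewrite /fn restrict_EFin.
have cvg0 (u : nat -> R) : (forall n, `|u n| = n.+1%:R) -> g (u n) @[n --> \oo] --> (0 : R).
  move=> un; apply: norm_cvg0.
  apply: (@squeeze_cvgr _ _ _ _ (fun=> 0) (fun n => phi n.+1%:R)).
  - apply: nearW => n; rewrite normr_ge0 /= /g normrM (ger0_norm (phi0 _)).
    have <- : phi (u n) = phi n.+1%:R by rewrite !phiE -(un n) real_normK// num_real.
    by rewrite ler_piMl// ler_norml sin_geN1 sin_le1.
  - exact: cvg_cst.
  - by have := phi_cvg0; rewrite -(cvg_shiftS (fun n => phi n%:R)).
have cv2 : ((dgn n)%:E @[n --> \oo] --> 0%:E)%E.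
  apply: cvg_EFin; first exact: nearW.
  rewrite -[X in _ --> X]subr0; apply: cvgB; apply: cvg0 => n; rewrite ?normrN ger0_norm//.
by rewrite /Rintegral (cvg_unique _ cv1 cv2).
Qed.

(** Differentiation under the integral and [stein] give F'(s) = - s F(s) for the integral F(s).
    Hence exp (s^2/2) F(s) is constant, equal to its value cos b at 0. *)
Lemma normal_prob_cos (s b : R) :
  mean (normal_prob 0 1) (fun x => cos (s * x + b)) = expR (- s ^+ 2 / 2) * cos b.
Proof.
have meanE t : mean (normal_prob 0 1) (fun x => cos (t * x + b)) =
    \int[mu]_x (cos (t * x + b) * phi x).
  rewrite /mean integral_normal_prob//.
  apply: (@bounded_integrable _ _ _ (normal_prob 0 1) 1 (fun x : R => cos (t * x + b))).
    exact: measurable_cosD.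
  by move=> x; rewrite ler_norml cos_geN1 cos_le1.
rewrite meanE.
pose F t := \int[mu]_x (cos (t * x + b) * phi x).
have dF (t : R) : is_derive t 1 F (- t * F t).
  pose f (t x : R) := cos (t * x + b) * phi x.
  have df (x u : R) : is_derive u 1 (f ^~ x) (- (x * sin (u * x + b) * phi x)).
    have D1 : is_derive u 1 (fun u : R => u * x + b) x.
      by apply: is_derive_eq; rewrite /GRing.scale/=; lra.
    apply: is_derive_eq; rewrite /GRing.scale/=; ring.
  have d1 x u : partial1of2 f u x = - (x * sin (u * x + b) * phi x).
    by rewrite /partial1of2 derive1E; have [_ ->] := df x u.
  have It : `]t - 1, t + 1[%classic t by rewrite /= in_itv /=; apply/andP; split; lra.
  have if_ u : `]t - 1, t + 1[%classic u -> mu.-integrable setT (EFin \o f u).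
    by move=> _; exact: integrable_cos_phi.
  have dff u x : `]t - 1, t + 1[%classic u -> setT x -> derivable (f ^~ x) u 1.
    by move=> _ _; have [] := df x u.
  have G0 (x : R) : 0 <= `|x| * phi x by rewrite mulr_ge0.
  have Gub u x : `]t - 1, t + 1[%classic u -> setT x -> `|partial1of2 f u x| <= `|x| * phi x.
    move=> _ _; rewrite d1 normrN !normrM (ger0_norm (phi0 x)) ler_wpM2r//.
    by rewrite ler_piMr// ler_norml sin_geN1 sin_le1.
  have E := differentiation_under_integral measurableT It if_ dff G0 integrable_norm_phi Gub.
  have D := derivable_under_integral measurableT It if_ dff G0 integrable_norm_phi Gub.
  apply: DeriveDef => //.
  rewrite -derive1E E; under eq_Rintegral do rewrite d1 -mulN1r.
  by rewrite RintegralZl// stein mulN1r mulNr.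
have dG (t : R) : is_derive t 1 (fun t : R => expR (t ^+ 2 / 2) * F t) 0.
  have D1 : is_derive t 1 (fun t : R => expR (t ^+ 2 / 2)) (t * expR (t ^+ 2 / 2)).
    have D2 : is_derive t 1 (fun t : R => t ^+ 2 / 2) t.
      by apply: is_derive_eq; rewrite /GRing.scale/=; lra.
    apply: is_derive_eq; rewrite /GRing.scale/=; ring.
  apply: (is_derive_eq (is_deriveM D1 (dF t))).
  by rewrite /GRing.scale/=; ring.
have := is_derive_0_is_cst s 0 dG.
rewrite expr0n/= mul0r expR0 mul1r => Fs.
have F0 : F 0 = cos b.
  rewrite -[F 0]meanE; under eq_mean do rewrite mul0r add0r.
  exact: mean_cst.
rewrite -/(F s) mulNr expRN -F0 -Fs mulrA mulVf ?mul1r//.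
by rewrite gt_eqF// expR_gt0.
Qed.

End gaussian_cos.

(** * Fubini for bounded functions *)

Section fubini.
Context d1 d2 (T1 : measurableType d1) (T2 : measurableType d2) (R : realType).
Context (P : probability T1 R) (N : probability T2 R).

Lemma mean_fubini (f : T1 * T2 -> R) (C : R) : measurable_fun setT f ->
  (forall x, `|f x| <= C) ->
  measurable_fun setT (fun z => mean P (fun w => f (w, z))) /\
  mean P (fun w => mean N (fun z => f (w, z))) =
  mean N (fun z => mean P (fun w => f (w, z))).
Proof.
move=> mf fC.
(* Adding the bound makes the function nonnegative, so that Tonelli's theorem applies; the constant
   is subtracted at the end. *)
pose F (x : T1 * T2) : \bar R := (f x + C)%:E.
have F0 x : (0 <= F x)%E.
  by rewrite lee_fin; have := fC x; rewrite ler_norml => /andP[]; lra.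
have mF : measurable_fun setT F.
  by apply/measurable_EFinP; exact: measurable_funD.
have i2 w : integ N (fun z => f (w, z)).
  apply: (@bounded_integ _ _ _ _ C) => //; apply: measurable_aemeas.
  exact: measurableT_comp mf (pair1_measurable w).
have i1 z : integ P (fun w => f (w, z)).
  apply: (@bounded_integ _ _ _ _ C) => //; apply: measurable_aemeas.
  exact: measurableT_comp mf (pair2_measurable z).
have E2 w : (\int[N]_z F (w, z) = (mean N (fun z => f (w, z)) + C)%:E)%E.
  rewrite -[X in _ + X](mean_cst N C) -meanD//; last exact: integ_cst.
  by rewrite /mean fineK//; apply: integ_fin; apply: integD => //; exact: integ_cst.
have E1 z : (\int[P]_w F (w, z) = (mean P (fun w => f (w, z)) + C)%:E)%E.
  rewrite -[X in _ + X](mean_cst P C) -meanD//; last exact: integ_cst.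
  by rewrite /mean fineK//; apply: integ_fin; apply: integD => //; exact: integ_cst.
have mG : measurable_fun setT (fun z => mean P (fun w => f (w, z))).
  have : measurable_fun setT (fubini_G P F) by exact: measurable_fun_fubini_tonelli_G.
  rewrite /fubini_G (_ : (fun z => _) = fun z => (mean P (fun w => f (w, z)) + C)%:E).
    move/measurable_EFinP => m1.
    rewrite (_ : (fun z => _) = fun z => (mean P (fun w => f (w, z)) + C) - C).
      exact: measurable_funB.
    by apply/funext => z; rewrite addrK.
  exact/funext.
have mG1 : measurable_fun setT (fun w => mean N (fun z => f (w, z))).
  have : measurable_fun setT (fubini_F N F) by exact: measurable_fun_fubini_tonelli_F.
  rewrite /fubini_F (_ : (fun z => _) = fun w => (mean N (fun z => f (w, z)) + C)%:E).
    move/measurable_EFinP => m1.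
    rewrite (_ : (fun z => _) = fun w => (mean N (fun z => f (w, z)) + C) - C).
      exact: measurable_funB.
    by apply/funext => z; rewrite addrK.
  exact/funext.
split=> //; apply: (addIr C).
have iG : integ N (fun z => mean P (fun w => f (w, z))).
  apply: (@bounded_integ _ _ _ _ C); first exact: measurable_aemeas.
  by move=> z; apply: mean_le_bound => //; exact: integ_aemeas.
have iF : integ P (fun w => mean N (fun z => f (w, z))).
  apply: (@bounded_integ _ _ _ _ C); first exact: measurable_aemeas.
  by move=> z; apply: mean_le_bound => //; exact: integ_aemeas.
rewrite -{1}(mean_cst P C) -{2}(mean_cst N C) -!meanD//; try exact: integ_cst.
have FG : (\int[P]_x \int[N]_y F (x, y) = \int[N]_y \int[P]_x F (x, y))%E.
  exact: fubini_tonelli.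
rewrite /mean; congr fine.
rewrite (eq_integral (fun w => \int[N]_z F (w, z))%E) => [|w _]; last by rewrite E2.
rewrite FG; apply: eq_integral => z _; exact: E1.
Qed.

End fubini.

(** * Weak convergence from cosine transforms *)

Section levy_continuity.
Context d (T : measurableType d) (R : realType) (P : probability T R) (h : nat).
Implicit Types (X : nat -> T -> 'rV[R]_h) (Y Z : T -> 'rV[R]_h).

Definition aemeas_row Z := forall i, aemeas P (fun w => Z w 0 i).

Definition cos_prod (th b : 'I_h -> R) (x : 'rV[R]_h) : R :=
  \prod_i cos (th i * x 0 i + b i).

Lemma aemeas_cos (Z : T -> R) (th b : R) : aemeas P Z ->
  aemeas P (fun w => cos (th * Z w + b)).
Proof. exact: (@aemeas_comp _ _ _ _ (fun x => cos (th * x + b))) (measurable_cosD th b). Qed.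

Lemma aemeas_cos_prod Z th b : aemeas_row Z -> aemeas P (cos_prod th b \o Z).
Proof. by move=> mZ; apply: aemeas_prod => i; exact: aemeas_cos. Qed.

Lemma norm_cos_le1 (x : R) : `|cos x| <= 1.
Proof. by rewrite ler_norml cos_geN1 cos_le1. Qed.

Lemma norm_cos_prod_le1 th b x : `|cos_prod th b x| <= 1.
Proof. by apply: norm_prod_le1 => i; exact: norm_cos_le1. Qed.

Lemma trigpoly_aemeas (F : 'rV[R]_h -> R) Z : trigpoly F -> aemeas_row Z ->
  aemeas P (F \o Z).
Proof.
move=> + mZ; elim=> [c|i th b|G H _ mG _ mH|G H _ mG _ mH].
- exact: aemeas_cst.
- exact: aemeas_cos.
- exact: aemeasD.
- exact: aemeasM.
Qed.

(** [f \o Z] is the limit of trigonometric polynomials of [Z] that are within 1/(n+1) of [f] on the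
    box of half-side n+1, so measurability of the coordinates is enough. *)
Lemma continuous_aemeas (f : 'rV[R]_h -> R) (M : R) Z : continuous f ->
  (forall x, `|f x| <= M) -> aemeas_row Z -> aemeas P (f \o Z).
Proof.
move=> cf fM mZ.
have /choice[F /all_and3[tF _ Ff]] : forall n, exists F, [/\ trigpoly F,
    forall x, `|F x| <= M & forall x : 'rV[R]_h,
      (forall i, `|x 0 i| <= n.+1%:R) -> `|F x - f x| <= n.+1%:R^-1].
  by move=> n; apply: trigpoly_approx => //; rewrite invr_gt0.
apply: (@aemeas_lim _ _ _ _ (fun n => F n \o Z)).
  by move=> n; exact: trigpoly_aemeas.
apply: aeW => w /=; apply/cvgrPdist_le => e e0.
have [K KZ] : exists K : nat, forall i, `|Z w 0 i| <= K%:R.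
  pose k i := (Num.truncn `|Z w 0 i|).+1.
  exists (\max_i k i)%N => i.
  rewrite (le_trans (ltW (truncnS_gt _)))// ler_nat.
  exact: (leq_bigmax_cond (F := k)).
near=> n; rewrite distrC (le_trans (Ff n _ _))//.
  move=> i; rewrite (le_trans (KZ i))// ler_nat ltnW// ltnS.
  by near: n; exact: nbhs_infty_ge.
by apply/ltW; near: n; exact: (near_infty_natSinv_lt (PosNum e0)).
Unshelve. all: by end_near. Qed.

Section convergence.
Variables (X : nat -> T -> 'rV[R]_h) (Y : T -> 'rV[R]_h).
Hypothesis mX : forall n, aemeas_row (X n).
Hypothesis mY : aemeas_row Y.
Hypothesis XY : forall th b, mean P (cos_prod th b \o X n) @[n --> \oo] -->
  mean P (cos_prod th b \o Y).

(** The invariant for the induction over [trigpoly]: with a factor [cos_prod th b] of free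
    parameters always present, a further cosine is absorbed into those parameters. *)
Let good (G : 'rV[R]_h -> R) :=
  [/\ exists C, forall x, `|G x| <= C,
      forall Z, aemeas_row Z -> aemeas P (G \o Z) &
      forall th b, mean P (fun w => G (X n w) * cos_prod th b (X n w))
        @[n --> \oo] --> mean P (fun w => G (Y w) * cos_prod th b (Y w))].

Let good_integ G th b Z : good G -> aemeas_row Z ->
  integ P (fun w => G (Z w) * cos_prod th b (Z w)).
Proof.
move=> [[C GC] mG _] mZ; apply: (@bounded_integ _ _ _ _ C).
  by apply: aemeasM; [exact: mG|exact: aemeas_cos_prod].
by move=> w; rewrite normrM -[leRHS]mulr1 ler_pM// norm_cos_prod_le1.
Qed.

Let goodZ c G : good G -> good (fun x => c * G x).
Proof.
move=> gG; have [[C GC] mG cG] := gG; split.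
- by exists (`|c| * C) => x; rewrite normrM ler_wpM2l.
- by move=> Z mZ; apply: aemeasM; [exact: aemeas_cst|exact: mG].
move=> th b; under eq_mean do rewrite -mulrA; rewrite meanZ; last exact: good_integ.
apply: (@eq_cvg_to _ R _ _ (fun n => c * mean P (fun w => G (X n w) * cos_prod th b (X n w)))).
  by move=> n; under eq_mean do rewrite -mulrA; rewrite meanZ//; exact: good_integ.
by apply: cvgM; [exact: cvg_cst|exact: cG].
Qed.

Let goodD G H : good G -> good H -> good (fun x => G x + H x).
Proof.
move=> gG gH; have [[C GC] mG cG] := gG; have [[D HD] mH cH] := gH; split.
- by exists (C + D) => x; rewrite (le_trans (ler_normD _ _))// lerD.
- by move=> Z mZ; apply: aemeasD; [exact: mG|exact: mH].
move=> th b; under eq_mean do rewrite mulrDl; rewrite meanD; [|exact: good_integ..].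
apply: (@eq_cvg_to _ R _ _ (fun n => mean P (fun w => G (X n w) * cos_prod th b (X n w)) +
  mean P (fun w => H (X n w) * cos_prod th b (X n w)))).
  by move=> n; under eq_mean do rewrite mulrDl; rewrite meanD//; exact: good_integ.
by apply: cvgD; [exact: cG|exact: cH].
Qed.

(** The product-to-sum formula in coordinate [i]; the Kronecker factors leave the other coordinates
    unchanged. *)
Let cos_prod_mul i (th0 b0 : R) th b (x : 'rV[R]_h) : cos (th0 * x 0 i + b0) * cos_prod th b x =
  2^-1 * (cos_prod (fun j => th j + (j == i)%:R * th0) (fun j => b j + (j == i)%:R * b0) x +
  cos_prod (fun j => th j - (j == i)%:R * th0) (fun j => b j - (j == i)%:R * b0) x).
Proof.
have D t c : cos_prod t c x = cos (t i * x 0 i + c i) *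
    \prod_(j < h | j != i) cos (t j * x 0 j + c j) by rewrite /cos_prod (bigD1 i).
rewrite !D eqxx !mul1r.
pose p := \prod_(j < h | j != i) cos (th j * x 0 j + b j).
have E (s : R) : \prod_(j < h | j != i) cos ((th j + s * ((j == i)%:R * th0)) * x 0 j +
    (b j + s * ((j == i)%:R * b0))) = p.
  by apply: eq_bigr => j /negbTE ->; rewrite !mul0r !mulr0 !addr0.
have E1 : \prod_(j < h | j != i) cos ((th j + (j == i)%:R * th0) * x 0 j +
    (b j + (j == i)%:R * b0)) = p.
  by rewrite -(E 1); apply: eq_bigr => j _; rewrite !mul1r.
have E2 : \prod_(j < h | j != i) cos ((th j - (j == i)%:R * th0) * x 0 j +
    (b j - (j == i)%:R * b0)) = p.
  by rewrite -(E (-1)); apply: eq_bigr => j _; rewrite !mulN1r.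
rewrite E1 E2 -/p mulrA cos_mul_cos -mulrDl mulrA; congr (_ * _).
rewrite mulrC; congr (_ * _); rewrite addrC -[X in X + _ = _]cosN.
rewrite addrC; congr (cos _ + cos _); ring.
Qed.

Let good_cos i (th0 b0 : R) G : good G -> good (fun x => cos (th0 * x 0 i + b0) * G x).
Proof.
move=> gG; have [[C GC] mG cG] := gG; split.
- by exists C => x; rewrite normrM -[leRHS]mul1r ler_pM// norm_cos_le1.
- by move=> Z mZ; apply: aemeasM; [exact: aemeas_cos|exact: mG].
move=> th b.
pose th1 j := th j + (j == i)%:R * th0; pose b1 j := b j + (j == i)%:R * b0.
pose th2 j := th j - (j == i)%:R * th0; pose b2 j := b j - (j == i)%:R * b0.
have E Z : aemeas_row Z ->
    mean P (fun w => cos (th0 * Z w 0 i + b0) * G (Z w) * cos_prod th b (Z w)) =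
    2^-1 * (mean P (fun w => G (Z w) * cos_prod th1 b1 (Z w)) +
      mean P (fun w => G (Z w) * cos_prod th2 b2 (Z w))).
  move=> mZ; rewrite -meanD; [|exact: good_integ..].
  rewrite -meanZ; last by apply: integD; exact: good_integ.
  by apply: eq_mean => w; rewrite mulrAC cos_prod_mul -mulrDr -[LHS]mulrA [_ * G _]mulrC.
rewrite E//; apply: (@eq_cvg_to _ R _ _ _ _ (fun n => E (X n) (mX n))).
by apply: cvgM; [exact: cvg_cst|apply: cvgD; exact: cG].
Qed.

Let good_trigpoly F : trigpoly F -> forall G, good G -> good (fun x => F x * G x).
Proof.
elim=> [c|i th b|F1 F2 _ IH1 _ IH2|F1 F2 _ IH1 _ IH2] G gG.
- exact: goodZ.
- exact: good_cos.
- under eq_fun do rewrite mulrDl; apply: goodD; [exact: IH1|exact: IH2].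
- by under eq_fun do rewrite -mulrA; apply: IH1; exact: IH2.
Qed.

Let good1 : good (fun=> 1).
Proof.
split; first by exists 1 => x; rewrite normr1.
- by move=> Z _; exact: aemeas_cst.
move=> th b; have E Z : mean P (fun w => 1 * cos_prod th b (Z w)) =
    mean P (cos_prod th b \o Z) by apply: eq_mean => w; rewrite mul1r.
by rewrite E; apply: (@eq_cvg_to _ R _ _ _ _ (fun n => E (X n))); exact: XY.
Qed.

Lemma trigpoly_mean_cvg F : trigpoly F ->
  mean P (F \o X n) @[n --> \oo] --> mean P (F \o Y).
Proof.
move=> tF; have [_ _ /(_ (fun=> 0) (fun=> 0))] := good_trigpoly tF good1.
have E x : F x * 1 * cos_prod (fun=> 0) (fun=> 0) x = F x.
  rewrite /cos_prod big1 ?mulr1// => i _; by rewrite mul0r addr0 cos0.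
have EZ Z : mean P (F \o Z) =
    mean P (fun w => F (Z w) * 1 * cos_prod (fun=> 0) (fun=> 0) (Z w)).
  by apply: eq_mean => w; rewrite /= E.
by rewrite EZ => FXY; apply: (@eq_cvg_to _ R _ _ _ _ (fun n => EZ (X n))).
Qed.

(** exp (- (s x)^2/2) is the average of cos (s z x) over a standard normal z. Exchanging the two
    means leaves, for each fixed z, the hypothesis [XY] with one active coordinate, and bounded
    convergence in z concludes. *)
Lemma mean_gauss_cvg (s : R) i :
  mean P (fun w => expR (- (s * X n w 0 i) ^+ 2 / 2)) @[n --> \oo] -->
  mean P (fun w => expR (- (s * Y w 0 i) ^+ 2 / 2)).
Proof.
have key Z : aemeas_row Z ->
    aemeas (normal_prob 0 1) (fun z => mean P (fun w => cos ((s * z) * Z w 0 i + 0))) /\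
    mean P (fun w => expR (- (s * Z w 0 i) ^+ 2 / 2)) =
    mean (normal_prob 0 1) (fun z => mean P (fun w => cos ((s * z) * Z w 0 i + 0))).
  move=> /(_ i)[g mg Zg].
  pose f (x : T * R) := cos (s * x.2 * g x.1 + 0).
  have mf : measurable_fun setT f.
    apply: measurableT_comp; first exact: continuous_measurable_fun (@continuous_cos R).
    apply: measurable_funD => //; apply: measurable_funM; first exact: measurable_funM.
    exact: measurableT_comp.
  have [m1 E] := mean_fubini P (normal_prob 0 1) mf (fun x => norm_cos_le1 _).
  have EZ z : mean P (fun w => cos (s * z * Z w 0 i + 0)) = mean P (fun w => f (w, z)).
    by apply: eq_mean_ae; apply: filterS Zg => w ->.
  split.
    apply: eq_aemeas (measurable_aemeas _ m1); apply: aeW => z; exact: EZ.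
  transitivity (mean (normal_prob 0 1) (fun z => mean P (fun w => f (w, z)))); last first.
    by apply: eq_mean => z; rewrite EZ.
  rewrite -E; apply: eq_mean_ae; apply: filterS Zg => w ->.
  have := normal_prob_cos (s * g w) 0; rewrite cos0 mulr1 => <-.
  by apply: eq_mean => z; rewrite /f /= mulrAC.
have [m1 ->] := key _ mY.
apply: (@eq_cvg_to _ R _ _ _ _ (fun n => (key _ (mX n)).2)).
apply: (@mean_cvg _ _ _ _ 1) => [n|n z|].
- exact: (key _ (mX n)).1.
- apply: mean_le_bound => [|w]; last exact: norm_cos_le1.
  exact: aemeas_cos (mX n i).
apply: aeW => z; have := @XY (fun j => (j == i)%:R * (s * z)) (fun=> 0).
have E x : cos_prod (fun j => (j == i)%:R * (s * z)) (fun=> 0) x = cos (s * z * x 0 i + 0).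
  rewrite /cos_prod (bigD1 i)//= eqxx mul1r big1 ?mulr1// => j /negbTE ->.
  by rewrite !mul0r addr0 cos0.
have EZ Z : mean P (fun w => cos (s * z * Z w 0 i + 0)) =
    mean P (cos_prod (fun j => (j == i)%:R * (s * z)) (fun=> 0) \o Z).
  by apply: eq_mean => w; rewrite /= E.
by rewrite EZ => XYz; apply: (@eq_cvg_to _ R _ _ _ _ (fun n => EZ (X n))).
Qed.

(** A substitute for the indicator that some coordinate exceeds 1/s in absolute value, with a mean
    that [mean_gauss_cvg] controls. *)
Let gdef (s : R) (x : 'rV[R]_h) : R := \sum_i (1 - expR (- (s * x 0 i) ^+ 2 / 2)).

Let gauss01 (x : R) : 0 <= expR (- x ^+ 2 / 2) <= 1.
Proof.
rewrite expR_ge0 /= -expR0 ler_expR mulNr oppr_le0.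
by rewrite divr_ge0 ?sqr_ge0.
Qed.

Let integ_gauss s Z i : aemeas_row Z ->
  integ P (fun w => expR (- (s * Z w 0 i) ^+ 2 / 2)).
Proof.
move=> mZ; apply: (@bounded_integ _ _ _ _ 1) => [|w].
  apply: (@aemeas_comp _ _ _ _ (fun x : R => expR (- (s * x) ^+ 2 / 2))); last exact: mZ.
  apply: measurableT_comp => //; apply: measurable_funM => //.
  apply: measurableT_comp => //; apply: measurable_funX; exact: measurable_funM.
by have /andP[? ?] := gauss01 (s * Z w 0 i); rewrite ger0_norm.
Qed.

Let integ_gdef s Z : aemeas_row Z -> integ P (gdef s \o Z).
Proof.
by move=> mZ; apply: integ_sum => i; apply: integB; [exact: integ_cst|exact: integ_gauss].
Qed.

Let mean_gdef s Z : aemeas_row Z -> mean P (gdef s \o Z) =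
  \sum_i (1 - mean P (fun w => expR (- (s * Z w 0 i) ^+ 2 / 2))).
Proof.
move=> mZ; rewrite /gdef /comp mean_sum => [|i].
  by apply: eq_bigr => i _; rewrite meanB ?mean_cst//; [exact: integ_cst|exact: integ_gauss].
by apply: integB; [exact: integ_cst|exact: integ_gauss].
Qed.

(** Beyond 1/s the exponential is at most exp (-1/2) <= 1/(1 + 1/2) = 2/3, whence the factor 3. *)
Let gdef_tail s (x : 'rV[R]_h) i : 0 < s -> s^-1 < `|x 0 i| -> 1 <= 3 * gdef s x.
Proof.
move=> s0 sx; rewrite /gdef (bigD1 i)//=.
have r0 : 0 <= \sum_(j < h | j != i) (1 - expR (- (s * x 0 j) ^+ 2 / 2)).
  by apply: sumr_ge0 => j _; rewrite subr_ge0; have /andP[] := gauss01 (s * x 0 j).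
have : expR (- (s * x 0 i) ^+ 2 / 2) <= 2 / 3.
  have s1 : 1 <= (s * x 0 i) ^+ 2.
    rewrite -real_normK ?num_real// normrM (gtr0_norm s0) exprn_ege1//.
    by rewrite mulrC -ler_pdivrMr// mul1r ltW.
  rewrite mulNr expRN -[2 / 3]invf_div lef_pV2 ?posrE ?expR_gt0 ?divr_gt0//.
  by apply: le_trans (expR_ge1Dx _); lra.
move: (expR _) r0 => y; move: (\sum_(_ < _ | _) _) => r; lra.
Qed.

Theorem mean_cvg_of_cos (f : 'rV[R]_h -> R) (M : R) : continuous f ->
  (forall x, `|f x| <= M) -> mean P (f \o X n) @[n --> \oo] --> mean P (f \o Y).
Proof.
move=> cf fM.
have M0 : 0 <= M by exact: le_trans (fM 0).
apply/cvgrPdist_le => e e0.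
(* Chosen so that 6 (M + 1) eta = e/12. The error budget is e/8 + e/12 for each of [X n] and [Y],
   plus e/4 between the trigonometric means, below [e] in total; [M + 1] avoids a division by 0. *)
pose eta := e / (72 * (M + 1)).
have M10 : 0 < M + 1 by rewrite ltr_wpDl.
have eta0 : 0 < eta by rewrite divr_gt0// mulr_gt0.
have gY0 : mean P (gdef k.+1%:R^-1 \o Y) @[k --> \oo] --> 0.
  apply: (@eq_cvg_to _ R _ _ _ _ (fun k => mean_gdef k.+1%:R^-1 mY)).
  rewrite -[X in _ --> X](@big1 R 0 +%R 'I_h (index_enum 'I_h) xpredT (fun=> 1 - 1)); last first.
    by move=> i _; rewrite subrr.
  apply: cvg_sumr => i; apply: cvgB; first exact: cvg_cst.
  rewrite -[X in _ --> X](mean_cst P 1); apply: (@mean_cvg _ _ _ _ 1).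
  - by move=> k; apply: integ_aemeas; exact: integ_gauss.
  - by move=> k w; have /andP[? ?] := gauss01 (k.+1%:R^-1 * Y w 0 i); rewrite ger0_norm.
  apply: aeW => w; rewrite -[X in _ --> X]expR0.
  apply: (cvg_comp _ expR); last exact: continuous_expR.
  rewrite (_ : 0 = - (0 * Y w 0 i) ^+ 2 / 2); last by rewrite mul0r expr0n/= oppr0 mul0r.
  apply: cvgM; last exact: cvg_cst.
  apply: cvgN; rewrite expr2; under eq_fun do rewrite expr2.
  apply: cvgM; apply: cvgM;
    [exact: cvg_harmonic|exact: cvg_cst|exact: cvg_harmonic|exact: cvg_cst].
(* The scale is fixed by the limit variable alone; the convergence [gX] below carries the tail bound
   over to [X n] for large [n]. *)
have [k _ /(_ k (leqnn k)) gk] := (cvgr_lt _ gY0) _ eta0.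
set s : R := k.+1%:R^-1 in gk.
have s0 : 0 < s by rewrite invr_gt0.
have e8 : 0 < e / 8 by rewrite divr_gt0.
have sV0 : 0 < s^-1 by rewrite invr_gt0.
have [F [tF FM Ff]] := trigpoly_approx cf fM sV0 e8.
have fF x : `|f x - F x| <= e / 8 + 6 * (M + 1) * gdef s x.
  have g0 : 0 <= gdef s x.
    by apply: sumr_ge0 => j _; rewrite subr_ge0; have /andP[] := gauss01 (s * x 0 j).
  have [/existsP[i ix]|] := boolP [exists i, s^-1 < `|x 0 i|].
    have := gdef_tail s0 ix => t1.
    apply: le_trans (ler_normB _ _) _; apply: le_trans (lerD (fM x) (FM x)) _.
    have : (M + 1) * 1 <= (M + 1) * (3 * gdef s x) by rewrite ler_wpM2l// ltW.
    rewrite mulr1 mulrCA -mulrA; move: (_ * gdef s x) => u; lra.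
  rewrite negb_exists => /forallP xs; rewrite distrC (le_trans (Ff _ _))//.
    by move=> i; rewrite leNgt.
  by rewrite lerDl mulr_ge0// mulr_ge0// ltW.
have mfF Z : aemeas_row Z ->
    `|mean P (f \o Z) - mean P (F \o Z)| <= e / 8 + 6 * (M + 1) * mean P (gdef s \o Z).
  move=> mZ.
  have i1 : integ P (f \o Z).
    by apply: (@bounded_integ _ _ _ _ M) => [|w]; [exact: (continuous_aemeas cf fM mZ)|exact: fM].
  have i2 : integ P (F \o Z).
    by apply: (@bounded_integ _ _ _ _ M) => [|w]; [exact: trigpoly_aemeas|exact: FM].
  have i3 : integ P (fun w => 6 * (M + 1) * gdef s (Z w)) by apply/integZ/integ_gdef.
  rewrite -(mean_cst P (e / 8)) -(meanZ _ (integ_gdef s mZ)) -meanD//; last exact: integ_cst.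
  apply: mean_dist_le => //; first by apply: integD => //; exact: integ_cst.
  by apply: aeW => w; exact: fF.
have gX : mean P (gdef s \o X n) @[n --> \oo] --> mean P (gdef s \o Y).
  apply: (@eq_cvg_to _ R _ _ _ _ (fun n => mean_gdef s (mX n))); rewrite mean_gdef//.
  by apply: cvg_sumr => i; apply: cvgB; [exact: cvg_cst|exact: mean_gauss_cvg].
have e4 : 0 < e / 4 by rewrite divr_gt0.
have FX := trigpoly_mean_cvg tF.
near=> n.
have h1 := mfF _ mY; have h2 := mfF _ (mX n).
have h3 : `|mean P (F \o Y) - mean P (F \o X n)| <= e / 4.
  by near: n; move/cvgrPdist_le : FX => /(_ _ e4).
have h4 : mean P (gdef s \o X n) <= eta by apply/ltW; near: n; exact: (cvgr_lt _ gX).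
have h5 : 6 * (M + 1) * mean P (gdef s \o X n) <= e / 12.
  rewrite (_ : e / 12 = 6 * (M + 1) * eta); last by rewrite /eta; field; rewrite gt_eqF.
  by rewrite ler_wpM2l// mulr_ge0// ltW.
have h6 : 6 * (M + 1) * mean P (gdef s \o Y) <= e / 12.
  rewrite (_ : e / 12 = 6 * (M + 1) * eta); last by rewrite /eta; field; rewrite gt_eqF.
  by rewrite ler_wpM2l ?ltW// mulr_gt0.
move: h1 h2 h3; rewrite !ler_norml.
move: (6 * _ * _) (6 * _ * _) h5 h6 => u v h5 h6 /andP[? ?] /andP[? ?] /andP[? ?].
by apply/andP; split; lra.
Unshelve. all: by end_near. Qed.

End convergence.
End levy_continuity.

(** * Levy processes: law of large numbers and central limit theorem *)

Section equal_law.
Context d (T : measurableType d) (R : realType) (P : probability T R).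

Lemma eq_law_mean (X Y : T -> R) (g : R -> R) :
  measurable_fun setT X -> measurable_fun setT Y -> measurable_fun setT g ->
  (exists C, forall x, `|g x| <= C) ->
  (forall B, measurable B -> P (X @^-1` B) = P (Y @^-1` B)) ->
  mean P (g \o X) = mean P (g \o Y).
Proof.
move=> mX mY mg [C gC] XY.
pose X' : {RV P >-> R} := mfun_Sub (mem_set mX).
pose Y' : {RV P >-> R} := mfun_Sub (mem_set mY).
have mEg : measurable_fun setT (EFin \o g) by exact/measurable_EFinP.
rewrite /mean; congr fine.
transitivity (\int[distribution P X']_x (EFin \o g) x)%E.
  rewrite integral_distribution//; apply: (@bounded_integrable _ _ _ _ C (g \o X)) => [|w].
    exact: measurableT_comp.
  exact: gC.
transitivity (\int[distribution P Y']_x (EFin \o g) x)%E; last first.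
  rewrite integral_distribution//; apply: (@bounded_integrable _ _ _ _ C (g \o Y)) => [|w].
    exact: measurableT_comp.
  exact: gC.
by apply: eq_measure_integral => B mB _; exact: XY.
Qed.

End equal_law.

Section cadlag.
Context (R : realType).

(** The value and the one-sided limits bound the path near each point, and compactness of [0, 1]
    makes the bound uniform; the bound itself, tending to +oo, is the parameter of the covering
    argument. *)
Lemma cadlag_bounded (x : R -> R) : cadlag x ->
  exists K : R, forall r : R, 0 <= r <= 1 -> `|x r| <= K.
Proof.
move=> cx.
have cI : compact `[0 : R, 1]%classic by exact: segment_compact.
move/compact_near_coveringP/near_covering_withinP : cI => cI.
have := @cI R +oo%R (fun K r => `|x r| <= K) _.
case.
  move=> r; rewrite /= in_itv /= => /andP[r0 r1].
  have [xr xl] := cx r r0.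
  have [K1 rK1] : exists K1, \forall u \near r^'+, `|x u| <= K1.
    exists (`|x r| + 1); have /cvgrPdist_le/(_ _ ltr01) := xr.
    apply: filterS => u; rewrite distrC => xu.
    by rewrite -[x u](subrK (x r)) addrC (le_trans (ler_normD _ _))// lerD2l.
  have [K2 rK2] : exists K2, \forall u \near r^'-, 0 <= u -> `|x u| <= K2.
    have [->|r0'] := eqVneq r 0.
      exists 0; near=> u; rewrite leNgt; suff -> : u < 0 by [].
      by near: u; exact: nbhs_left_lt.
    have rgt0 : 0 < r by rewrite lt_neqAle eq_sym r0'.
    have /cvg_ex[l xl'] := xl rgt0.
    exists (`|l| + 1); have /cvgrPdist_le/(_ _ ltr01) := xl'.
    apply: filterS => u; rewrite distrC => xu _.
    by rewrite -[x u](subrK l) addrC (le_trans (ler_normD _ _))// lerD2l.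
  pose K : R := Num.max `|x r| (Num.max K1 K2).
  have near_r : \forall u \near r, 0 <= u -> `|x u| <= K.
    move: rK2 rK1 => [e1 /= e10 h1] [e2 /= e20 h2].
    exists (Num.min e1 e2) => /=; first by rewrite lt_min e10.
    move=> u /=; rewrite lt_min => /andP[u1 u2] u0.
    rewrite /K !le_max; have [ur|ur|->] := ltgtP u r.
    - by rewrite (h1 u u1 ur u0) !orbT.
    - by rewrite (h2 u u2 ur) orbT.
    - by rewrite lexx.
  exists ([set u | 0 <= u -> `|x u| <= K], [set k | K <= k]) => /=.
    by split => //; apply: nbhs_pinfty_ge; exact: num_real.
  move=> [u k] /= [uK Kk]; rewrite in_itv /= => /andP[u0 _].
  exact: le_trans (uK u0) Kk.
move=> K [_ xK]; exists (K + 1) => r r01.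
by apply: (xK (K + 1)); rewrite ?ltrDl//= in_itv.
Unshelve. all: by end_near. Qed.

End cadlag.

Section levy_process_cos.
Context d (T : measurableType d) (R : realType) (P : probability T R).
Context (S : R -> {RV P >-> R}) (hS : levy_process S).

Let integ_cos (Z : T -> R) (s b : R) : measurable_fun setT Z ->
  integ P (fun w => cos (s * Z w + b)).
Proof.
move=> mZ; apply: (@bounded_integ _ _ _ _ 1) => [|w]; last exact: norm_cos_le1.
exact/aemeas_cos/measurable_aemeas.
Qed.

Lemma levy_increment_law (s u th b : R) : 0 <= s -> 0 <= u ->
  mean P (fun w => cos (th * (S (s + u) w - S s w) + b)) =
  mean P (fun w => cos (th * S u w + b)).
Proof.
move=> s0 u0; have [_ _ stat _] := hS.
apply: (@eq_law_mean _ _ _ P (S (s + u) \- S s) (S u) (fun x => cos (th * x + b))).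
- exact: measurable_funB.
- exact: measurable_funPT.
- exact: measurable_cosD.
- by exists 1 => x; exact: norm_cos_le1.
by move=> B mB; rewrite stat// ?lerDl// addrC addKr.
Qed.

(** The real form of the multiplicativity of characteristic functions over independent stationary
    increments. *)
Lemma levy_cos_add (s u th b : R) : 0 <= s -> 0 <= u ->
  mean P (fun w => cos (th * S (s + u) w + b)) =
  mean P (fun w => cos (th * S s w + b)) * mean P (fun w => cos (th * S u w)) +
  mean P (fun w => cos (th * S s w + (b + pi / 2))) * mean P (fun w => sin (th * S u w)).
Proof.
move=> s0 u0; have [S0 indep _ _] := hS.
(* The two increments are S(s) - S(0), almost surely S(s), and S(s + u) - S(s); later times stay
   constant to keep the sequence monotone. *)
pose t n : R := match n with 0%N => 0 | 1%N => s | _ => s + u end.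
have tm : {homo t : i j / (i <= j)%N >-> i <= j}.
  by move=> [|[|i]] [|[|j]]//= _; rewrite ?lexx ?lerDl ?addr_ge0.
have iid := indep 2%N t (lexx _) tm.
pose inc (i : 'I_2) : T -> R := S (t i.+1) \- S (t i).
have mean2 (g : 'I_2 -> R -> R) : (forall i, measurable_fun setT (g i)) ->
    (forall i x, `|g i x| <= 1) ->
    mean P (fun w => g ord0 (inc ord0 w) * g (lift ord0 ord0) (inc (lift ord0 ord0) w)) =
    mean P (g ord0 \o inc ord0) * mean P (g (lift ord0 ord0) \o inc (lift ord0 ord0)).
  move=> mg g1.
  have minc i : measurable_fun setT (inc i) by exact: measurable_funB.
  have := @mutual_indep_mean _ _ _ P _ _ (fun i => g i \o inc i) 1 iid.
  under eq_mean do rewrite big_ord_recl big_ord1.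
  rewrite big_ord_recl big_ord1; apply.
  - by move=> i; exact: measurableT_comp.
  - by move=> i w; exact: g1.
  - move=> i B mB; exists (g i @^-1` B); rewrite ?setTI//.
    by rewrite -[X in measurable X]setTI; exact: mg.
pose Su w := S (s + u) w - S s w.
have aeS : {ae P, forall w, S s w = inc ord0 w}.
  by apply: filterS S0 => w S0w; rewrite /inc /= S0w subr0.
have msin : measurable_fun setT (@sin R) by exact: continuous_measurable_fun (@continuous_sin R).
have cosE b' c : mean P (fun w => cos (th * S s w + b') * cos (th * Su w + c)) =
    mean P (fun w => cos (th * S s w + b')) * mean P (fun w => cos (th * S u w + c)).
  pose g (i : 'I_2) (x : R) := if i == ord0 then cos (th * x + b') else cos (th * x + c).
  have := mean2 g _ _; rewrite /g /= => E.
  rewrite -(levy_increment_law _ _ s0 u0).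
  rewrite (eq_mean_ae (f := fun w => cos (th * S s w + b'))
     (g := fun w => cos (th * inc ord0 w + b'))); last first.
    by apply: filterS aeS => w ->.
  rewrite -E; last 2 first.
  - by move=> i; case: (i == ord0); exact: measurable_cosD.
  - by move=> i x; case: (i == ord0); exact: norm_cos_le1.
  by apply: eq_mean_ae; apply: filterS aeS => w ->.
have sinE (x : R) : sin x = cos (x + - (pi / 2)).
  by rewrite cosB cos_pihalf sin_pihalf; ring.
transitivity (mean P (fun w => cos (th * S s w + b) * cos (th * Su w + 0) +
    cos (th * S s w + (b + pi / 2)) * cos (th * Su w + - (pi / 2)))).
  apply: eq_mean => w.
  have -> : th * S (s + u) w + b = (th * S s w + b) + th * Su w.
    by rewrite /Su; ring.
  rewrite addr0 -sinE addrA cosD [in RHS]cosDpihalf; ring.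
have icc b1 c1 : integ P (fun w => cos (th * S s w + b1) * cos (th * Su w + c1)).
  apply: (@bounded_integ _ _ _ _ 1) => [|w].
    apply: aemeasM; apply: aemeas_cos; first exact/measurable_aemeas/measurable_funPT.
    by apply: measurable_aemeas; exact: measurable_funB.
  by rewrite normrM -[leRHS]mul1r ler_pM// norm_cos_le1.
rewrite meanD// !cosE; congr (_ * _ + _ * _); apply: eq_mean => w; first by rewrite addr0.
by rewrite sinE.
Qed.

(** The real form of |z^n - w^n| <= n |z - w| for complex numbers of modulus at most 1: z is the
    characteristic function of [S 1] at [eta], and w has polar coordinates [rho], [phi]. The phase
    is free because the induction also uses it shifted by pi/2. *)
Lemma levy_cos_approx (n : nat) (eta b rho phi : R) : `|rho| <= 1 ->
  `|mean P (fun w => cos (eta * S n%:R w + b)) - rho ^+ n * cos (b + n%:R * phi)| <=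
  n%:R * (`|mean P (fun w => cos (eta * S 1 w)) - rho * cos phi| +
          `|mean P (fun w => sin (eta * S 1 w)) - rho * sin phi|).
Proof.
move=> rho1; have [S0 _ _ _] := hS.
set p := mean P (fun w => cos (eta * S 1 w)); set q := mean P (fun w => sin (eta * S 1 w)).
pose err := `|p - rho * cos phi| + `|q - rho * sin phi|.
elim: n b => [|n IH] b.
  rewrite mul0r expr0 mul1r mul0r addr0 (@eq_mean_ae _ _ _ _ _ (fun=> cos b)).
    by rewrite mean_cst subrr normr0.
  by apply: filterS S0 => w ->; rewrite mulr0 add0r.
pose C b := mean P (fun w => cos (eta * S n%:R w + b)).
pose D b := rho ^+ n * cos (b + n%:R * phi).
pose e b := C b - D b.
have IHe c : `|e c| <= n%:R * err by exact: IH.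
have mS u : measurable_fun setT (S u) by exact: measurable_funPT.
have eD c y : e (c + y) = e c * cos y + e (c + pi / 2) * sin y.
  have CD : C (c + y) = C c * cos y + C (c + pi / 2) * sin y.
    rewrite /C ![mean _ _ * _]mulrC -!meanZ; [|exact: integ_cos..].
    rewrite -meanD; [|apply: integZ; exact: integ_cos..].
    by apply: eq_mean => w; rewrite addrA cosD [eta * _ + (_ + _)]addrA cosDpihalf; ring.
  have DD : D (c + y) = D c * cos y + D (c + pi / 2) * sin y.
    rewrite /D [c + y + _]addrAC cosD [c + _ + _]addrAC cosDpihalf; ring.
  rewrite /e CD DD; ring.
rewrite -natr1 levy_cos_add// -/(C b) -/(C (b + pi / 2)) -/p -/q.
have -> : rho ^+ n.+1 * cos (b + (n%:R + 1) * phi) =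
    D b * (rho * cos phi) + D (b + pi / 2) * (rho * sin phi).
  rewrite /D exprSr mulrDl mul1r addrA cosD [b + _ + n%:R * phi]addrAC cosDpihalf; ring.
have -> : C b * p + C (b + pi / 2) * q -
    (D b * (rho * cos phi) + D (b + pi / 2) * (rho * sin phi)) =
    (e b * p + e (b + pi / 2) * q) +
    (D b * (p - rho * cos phi) + D (b + pi / 2) * (q - rho * sin phi)).
  by rewrite /e; ring.
have D1 c : `|D c| <= 1.
  by rewrite normrM -[leRHS]mul1r ler_pM// ?norm_cos_le1// normrX exprn_ile1.
have icos : integ P (fun w => cos (eta * S 1 w)).
  have := integ_cos eta 0 (mS 1); apply: eq_integ; apply: aeW => w; by rewrite addr0.
have isin : integ P (fun w => sin (eta * S 1 w)).
  have := integ_cos eta (- (pi / 2)) (mS 1); apply: eq_integ; apply: aeW => w.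
  by rewrite cosB cos_pihalf sin_pihalf; ring.
rewrite [leRHS]mulrDl mul1r; apply: (le_trans (ler_normD _ _)); apply: lerD.
  (* By [eD] the sum is the mean of [e (b + eta * S 1 w)], so the induction hypothesis bounds it
     with constant 1; bounding the two summands separately would let the error grow
     geometrically. *)
  rewrite /p /q -!meanZ// -meanD; [|exact: integZ..].
  apply: mean_le_bound => [|w]; last by rewrite -eD IHe.
  by apply: integ_aemeas; apply: integD; exact: integZ.
apply: (le_trans (ler_normD _ _)); apply: lerD; rewrite normrM ler_piMl//; exact: D1.
Qed.

(* Between two integer times the paths are bounded, hence negligible after
   scaling; [a] is the scaling factor. *)
Lemma levy_cos_trunc (u a : nat -> R) (b : R) : (forall k, 0 <= u k) ->
  a k @[k --> \oo] --> (0 : R) ->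
  mean P (fun w => cos (a k * S (u k) w + b)) -
  mean P (fun w => cos (a k * S (Num.truncn (u k))%:R w + b)) @[k --> \oo] --> (0 : R).
Proof.
move=> u0 a0; have [_ _ _ cS] := hS.
pose n k : R := (Num.truncn (u k))%:R.
have n0 k : 0 <= n k by [].
have nu k : 0 <= u k - n k <= 1.
  have /andP[] := truncn_itv (u0 k); rewrite -natr1 /n.
  by move: (_%:R) => z *; apply/andP; split; lra.
(* The increment since the last integer time has the law of the process at a time in [0, 1], where
   the path is bounded. The cutoff at 2, the largest distance of two cosines, allows bounded
   convergence. *)
pose g k w : R := Num.min 2 `|a k * S (u k - n k) w|.
have mg k : measurable_fun setT (g k).
  apply: measurable_minr => //; apply: measurableT_comp => //.
  by apply: measurable_funM => //; exact: measurable_funPT.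
have g2 k w : `|g k w| <= 2.
  by rewrite ger0_norm ?ge_min ?lexx// le_min normr_ge0 andbT.
have cg : mean P (g k) @[k --> \oo] --> (0 : R).
  rewrite -[X in _ --> X](mean_cst P 0); apply: (@mean_cvg _ _ _ _ 2) => //.
    by move=> k; exact: measurable_aemeas.
  apply: filterS cS => w /cadlag_bounded[K SK].
  have K0 : 0 <= K by apply: (le_trans (normr_ge0 _) (SK 0 _)); rewrite lexx ler01.
  apply: (@squeeze_cvgr _ _ _ _ (fun=> 0) (fun k => `|a k| * K)).
  - apply: nearW => k; rewrite /g le_min normr_ge0 !andbT ler0n /=.
    apply: (@le_trans _ _ `|a k * S (u k - n k) w|); first by rewrite ge_min lexx orbT.
    by rewrite normrM ler_wpM2l// SK.
  - exact: cvg_cst.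
  - rewrite -[X in _ --> X](mul0r K) -(normr0 R).
    by apply: cvgM; [exact: cvg_norm|exact: cvg_cst].
apply: norm_cvg0; apply: (@squeeze_cvgr _ _ _ _ (fun=> 0) (fun k => mean P (g k))) => //.
- apply: nearW => k; rewrite normr_ge0 /=.
  pose G w : R := Num.min 2 `|a k * (S (u k) w - S (n k) w)|.
  have mG : measurable_fun setT G.
    apply: measurable_minr => //; apply: measurableT_comp => //.
    by apply: measurable_funM => //; apply: measurable_funB; exact: measurable_funPT.
  have <- : mean P G = mean P (g k).
    have [_ _ stat _] := hS; have /andP[d0 _] := nu k.
    apply: (@eq_law_mean _ _ _ P (S (u k) \- S (n k)) (S (u k - n k))
       (fun x => Num.min 2 `|a k * x|)).
    + by apply: measurable_funB; exact: measurable_funPT.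
    + exact: measurable_funPT.
    + by apply: measurable_minr => //; apply: measurableT_comp => //.
    + by exists 2 => x; rewrite ger0_norm ?ge_min ?lexx// le_min normr_ge0 andbT.
    by move=> B mB; rewrite stat// -subr_ge0.
  apply: mean_dist_le; try by apply: integ_cos; exact: measurable_funPT.
    apply: (@bounded_integ _ _ _ _ 2) => [|w]; first exact: measurable_aemeas.
    by rewrite ger0_norm ?ge_min ?lexx// le_min normr_ge0 andbT.
  apply: aeW => w; rewrite /G le_min; apply/andP; split.
    apply: le_trans (ler_normB _ _) _.
    by have := lerD (norm_cos_le1 (a k * S (u k) w + b)) (norm_cos_le1 (a k * S (n k) w + b)); lra.
  by apply: le_trans (dist_cos_le _ _) _; rewrite opprD addrACA subrr addr0 mulrBr.
exact: cvg_cst.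
Qed.

End levy_process_cos.

Section cvg_helpers.
Context (R : realType).
Implicit Types f g t : nat -> R.

Lemma cvg0_le f g : (forall k, `|f k| <= g k) -> g k @[k --> \oo] --> (0 : R) ->
  f k @[k --> \oo] --> (0 : R).
Proof.
move=> fg g0; apply: norm_cvg0; apply: (@squeeze_cvgr _ _ _ _ (fun=> 0) g) => //.
  by apply: nearW => k; rewrite normr_ge0 fg.
exact: cvg_cst.
Qed.

Lemma cvgy_inv t : t k @[k --> \oo] --> +oo%R -> (t k)^-1 @[k --> \oo] --> (0 : R).
Proof.
move=> ty; have t0 : \forall k \near \oo, 0 < t k.
  by move/cvgryPgt : ty; apply.
exact: ((gtr0_cvgV0 t0).2 ty).
Qed.

End cvg_helpers.

Section mean_cos_sin.
Context d (T : measurableType d) (R : realType) (P : probability T R).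
Context (X : T -> R) (a : R).

(** Both cosines are compared with 1 and both sines with a times the mean; every error is of second
    order in [a]. *)
Lemma mean_cos_sin_lln : integ P (fun w => X w) -> integ P (fun w => X w ^+ 2) ->
  `|mean P (fun w => cos (a * X w)) - cos (a * mean P (fun w => X w))| +
  `|mean P (fun w => sin (a * X w)) - sin (a * mean P (fun w => X w))| <=
  2 * (a ^+ 2 * (mean P (fun w => X w ^+ 2) + mean P (fun w => X w) ^+ 2)).
Proof.
move=> iX iX2; set m := mean P (fun w => X w); set M2 := mean P (fun w => X w ^+ 2).
have icos : integ P (fun w => cos (a * X w)).
  apply: (@bounded_integ _ _ _ _ 1) => [|w]; last exact: norm_cos_le1.
  have := aemeas_cos (a) 0 (integ_aemeas iX).
  by apply: eq_aemeas; apply: aeW => w; rewrite addr0.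
have isin : integ P (fun w => sin (a * X w)).
  apply: (@bounded_integ _ _ _ _ 1) => [|w]; last by rewrite ler_norml sin_geN1 sin_le1.
  have := aemeas_cos (a) (- (pi / 2)) (integ_aemeas iX).
  apply: eq_aemeas; apply: aeW => w; rewrite cosB cos_pihalf sin_pihalf; ring.
have iaX2 : integ P (fun w => a ^+ 2 * X w ^+ 2) by exact: integZ.
have iaX : integ P (fun w => a * X w) by exact: integZ.
have EaX2 : mean P (fun w => a ^+ 2 * X w ^+ 2) = a ^+ 2 * M2 by rewrite meanZ.
have EaX : mean P (fun w => a * X w) = a * m by rewrite meanZ.
have h1 : `|mean P (fun w => cos (a * X w)) - 1| <= a ^+ 2 * M2.
  rewrite -EaX2 -[X in _ - X](mean_cst P 1); apply: mean_dist_le => //; first exact: integ_cst.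
  by apply: aeW => w; rewrite -exprMn norm_cosB1_le.
have h2 : `|mean P (fun w => sin (a * X w)) - a * m| <= a ^+ 2 * M2.
  rewrite -EaX2 -EaX; apply: mean_dist_le => //.
  by apply: aeW => w; rewrite -exprMn norm_sinB_le2.
have h3 := norm_cosB1_le (a * m); have h4 := norm_sinB_le2 (a * m).
rewrite exprMn in h3 h4.
rewrite (_ : 2 * _ = 2 * (a ^+ 2 * M2) + 2 * (a ^+ 2 * m ^+ 2)); last by rewrite /M2 /m; ring.
move: h1 h2 h3 h4; rewrite -/m.
move: (a * m) (mean P (fun w => sin (a * X w))) (mean P (fun w => cos (a * X w)))
  (a ^+ 2 * M2) (a ^+ 2 * m ^+ 2) => am q p x y.
move: (cos am) (sin am) => c s h1 h2 h3 h4.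
have e1 : `|p - c| <= x + y.
  by rewrite (_ : p - c = (p - 1) - (c - 1)); [rewrite (le_trans (ler_normB _ _))// lerD|ring].
have e2 : `|q - s| <= x + y.
  by rewrite (_ : q - s = (q - am) - (s - am)); [rewrite (le_trans (ler_normB _ _))// lerD|ring].
by rewrite (le_trans (lerD e1 e2))//; lra.
Qed.

(** The upper half follows from exp (-x) <= 1/(1 + x) and (1 - x + x^2)(1 + x) = 1 + x^3. *)
Let expRN_approx (x : R) : 0 <= x -> `|expR (- x) - (1 - x)| <= x ^+ 2.
Proof.
move=> x0; have h1 := expR_ge1Dx (- x).
have h2 : expR (- x) <= 1 - x + x ^+ 2.
  have h3 := expR_ge1Dx x.
  have x1 : 0 < 1 + x by lra.
  rewrite expRN; apply: (@le_trans _ _ (1 + x)^-1).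
    by rewrite lef_pV2 ?posrE ?expR_gt0.
  rewrite -[X in X <= _]mul1r ler_pdivrMr//.
  have : 0 <= x ^+ 3 by exact: exprn_ge0.
  by rewrite (_ : _ * (1 + x) = 1 + x ^+ 3); [lra|ring].
by rewrite ler_norml; apply/andP; split; have := sqr_ge0 x; move: (x ^+ 2) h2 => z *; lra.
Qed.

(** Comparison with an exponential, whose n-th power is explicit; the squared term is the price of
    replacing 1 - y by exp (-y), the cubic ones are Taylor remainders. *)
Lemma mean_cos_sin_clt : integ P (fun w => X w) -> integ P (fun w => X w ^+ 2) ->
  integ P (fun w => `|X w| ^+ 3) -> mean P (fun w => X w) = 0 ->
  `|mean P (fun w => cos (a * X w)) - expR (- (a ^+ 2 * mean P (fun w => X w ^+ 2) / 2))| +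
  `|mean P (fun w => sin (a * X w))| <=
  2 * (`|a| ^+ 3 * mean P (fun w => `|X w| ^+ 3)) +
  (a ^+ 2 * mean P (fun w => X w ^+ 2) / 2) ^+ 2.
Proof.
move=> iX iX2 iX3 m0.
set M2 := mean P (fun w => X w ^+ 2); set M3 := mean P (fun w => `|X w| ^+ 3).
have M20 : 0 <= M2 by apply: mean_ge0; apply: aeW => w; exact: sqr_ge0.
have icos : integ P (fun w => cos (a * X w)).
  apply: (@bounded_integ _ _ _ _ 1) => [|w]; last exact: norm_cos_le1.
  have := aemeas_cos (a) 0 (integ_aemeas iX).
  by apply: eq_aemeas; apply: aeW => w; rewrite addr0.
have isin : integ P (fun w => sin (a * X w)).
  apply: (@bounded_integ _ _ _ _ 1) => [|w]; last by rewrite ler_norml sin_geN1 sin_le1.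
  have := aemeas_cos (a) (- (pi / 2)) (integ_aemeas iX).
  apply: eq_aemeas; apply: aeW => w; rewrite cosB cos_pihalf sin_pihalf; ring.
have iaX2 : integ P (fun w => 2^-1 * a ^+ 2 * X w ^+ 2) by exact: integZ.
have iaX3 : integ P (fun w => `|a| ^+ 3 * `|X w| ^+ 3) by exact: integZ.
have iaX : integ P (fun w => a * X w) by exact: integZ.
have EaX3 : mean P (fun w => `|a| ^+ 3 * `|X w| ^+ 3) = `|a| ^+ 3 * M3 by rewrite meanZ.
have h1 : `|mean P (fun w => cos (a * X w)) - (1 - a ^+ 2 * M2 / 2)| <= `|a| ^+ 3 * M3.
  rewrite -EaX3 (_ : 1 - _ = mean P (fun w => 1 - 2^-1 * a ^+ 2 * X w ^+ 2)).
    apply: mean_dist_le => //; first by apply: integB => //; exact: integ_cst.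
    apply: aeW => w; rewrite -exprMn -normrM (_ : _ * _ * _ = (a * X w) ^+ 2 / 2).
      exact: norm_cosB_le3.
    by rewrite exprMn; ring.
  by rewrite meanB ?mean_cst ?meanZ//; [rewrite /M2; ring|exact: integ_cst].
have h2 : `|mean P (fun w => sin (a * X w))| <= `|a| ^+ 3 * M3.
  rewrite -[X in `|X|]subr0 -(mulr0 (a)) -m0 -meanZ// -EaX3.
  apply: mean_dist_le => //.
  by apply: aeW => w; rewrite -exprMn -normrM norm_sinB_le3.
have x0 : 0 <= a ^+ 2 * M2 / 2 by rewrite divr_ge0// mulr_ge0// sqr_ge0.
have h3 := expRN_approx x0.
move: h1 h2 h3.
move: (a ^+ 2 * M2 / 2) (`|a| ^+ 3 * M3) (mean P (fun w => sin (a * X w)))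
  (mean P (fun w => cos (a * X w))) => y x q p.
move: (expR _) => c h1 h2 h3.
have e1 : `|p - c| <= x + y ^+ 2.
  by rewrite (_ : p - c = (p - (1 - y)) - (c - (1 - y)));
    [rewrite (le_trans (ler_normB _ _))// lerD|ring].
by rewrite (le_trans (lerD e1 h2))//; lra.
Qed.

End mean_cos_sin.

Section levy_limits.
Context d (T : measurableType d) (R : realType) (P : probability T R).
Context (S : R -> {RV P >-> R}) (hS : levy_process S).

(** The common core of both limit theorems: [rho] and [phi] are modulus and angle of an approximate
    characteristic function of [S 1] at [a k], whose one-step error times the number of unit steps
    must vanish. *)
Lemma levy_cos_cvg (u a rho phi : nat -> R) (b l : R) : (forall k, 0 <= u k) ->
  a k @[k --> \oo] --> (0 : R) -> (forall k, `|rho k| <= 1) ->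
  (Num.truncn (u k))%:R *
    (`|mean P (fun w => cos (a k * S 1 w)) - rho k * cos (phi k)| +
     `|mean P (fun w => sin (a k * S 1 w)) - rho k * sin (phi k)|) @[k --> \oo] --> (0 : R) ->
  rho k ^+ Num.truncn (u k) * cos (b + (Num.truncn (u k))%:R * phi k) @[k --> \oo] --> l ->
  mean P (fun w => cos (a k * S (u k) w + b)) @[k --> \oo] --> l.
Proof.
move=> u0 a0 rho1 err0 cl.
have c1 := levy_cos_trunc hS b u0 a0.
pose n k := Num.truncn (u k).
have c2 : mean P (fun w => cos (a k * S (n k)%:R w + b)) -
    rho k ^+ n k * cos (b + (n k)%:R * phi k) @[k --> \oo] --> (0 : R).
  by apply: cvg0_le err0 => k; exact: levy_cos_approx.
rewrite -[l]add0r -[X in _ + X]add0r.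
apply: eq_cvg_to (cvgD c1 (cvgD c2 cl)) => k; rewrite !fctE /n; ring.
Qed.

Lemma truncn_ratio_cvg (u t : nat -> R) (l : R) : (forall k, 0 <= u k) ->
  t k @[k --> \oo] --> +oo%R -> u k / t k @[k --> \oo] --> l ->
  (Num.truncn (u k))%:R / t k @[k --> \oo] --> l.
Proof.
move=> u0 ty ul.
have tV := cvgy_inv ty.
pose r k := u k - (Num.truncn (u k))%:R.
have r01 k : 0 <= r k <= 1.
  have /andP[] := truncn_itv (u0 k); rewrite -natr1 /r.
  by move: (_%:R) => z *; apply/andP; split; lra.
have c0 : r k / t k @[k --> \oo] --> (0 : R).
  apply: (@cvg0_le _ _ (fun k => `|(t k)^-1|)); last first.
    by rewrite -(normr0 R); exact: cvg_norm.
  move=> k; rewrite normrM ler_piMl//.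
  by have /andP[r0 r1] := r01 k; rewrite ger0_norm.
rewrite -[l]subr0.
apply: eq_cvg_to (cvgB ul c0) => k; rewrite !fctE /r; ring.
Qed.

Lemma levy_lln (u t : nat -> R) (l th b : R) :
  integ P (fun w => S 1 w) -> integ P (fun w => S 1 w ^+ 2) ->
  (forall k, 0 <= u k) -> t k @[k --> \oo] --> +oo%R ->
  u k / t k @[k --> \oo] --> l ->
  mean P (fun w => cos (th / t k * S (u k) w + b)) @[k --> \oo] -->
  cos (b + l * (th * mean P (fun w => S 1 w))).
Proof.
move=> iX iX2 u0 ty ul; pose m := mean P (fun w => S 1 w).
pose M2 := mean P (fun w => S 1 w ^+ 2).
have tV := cvgy_inv ty.
pose a k := th / t k.
have a0 : a k @[k --> \oo] --> (0 : R).
  by rewrite -[X in _ --> X](mulr0 th); apply: cvgM => //; exact: cvg_cst.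
have nl := truncn_ratio_cvg u0 ty ul.
have na : (Num.truncn (u k))%:R * a k @[k --> \oo] --> l * th.
  apply: (@eq_cvg_to _ R _ _ (fun k => (Num.truncn (u k))%:R / t k * th)).
    by move=> k; rewrite /a; ring.
  by apply: cvgM => //; exact: cvg_cst.
(* Comparison with the deterministic drift: modulus 1 and angle [a k * m]. The number of steps times
   [a k] converges, so an error of order a^2 per step vanishes in total. *)
apply: (@levy_cos_cvg u a (fun=> 1) (fun k => a k * m)) => //.
- by move=> k; rewrite normr1.
- apply: (@cvg0_le _ _ (fun k => `|(Num.truncn (u k))%:R * a k| * `|a k| *
    (2 * (M2 + m ^+ 2)))); last first.
    rewrite -[X in _ --> X](mul0r (2 * (M2 + m ^+ 2))) -(mulr0 `|l * th|) -(normr0 R).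
    by apply: cvgM; [apply: cvgM; exact: cvg_norm|exact: cvg_cst].
  move=> k; rewrite normrM ger0_norm// normrM (ger0_norm (_ : 0 <= (Num.truncn (u k))%:R))//.
  rewrite -[leRHS]mulrA -[leRHS]mulrA ler_wpM2l// ger0_norm ?addr_ge0// !mul1r.
  rewrite (le_trans (mean_cos_sin_lln (a k) iX iX2))// -/M2 -/m.
  by rewrite -(real_normK (num_real (a k))) le_eqVlt; apply/orP; left; apply/eqP; ring.
apply: (@eq_cvg_to _ R _ _ (fun k => cos (b + (Num.truncn (u k))%:R * a k * m))).
  by move=> k; rewrite expr1n mul1r mulrA.
apply: (cvg_comp _ cos); last exact: continuous_cos.
apply: cvgD; first exact: cvg_cst.
by rewrite mulrA; apply: cvgM => //; exact: cvg_cst.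
Qed.

Lemma levy_clt (u t : nat -> R) (l th b : R) :
  integ P (fun w => S 1 w) -> integ P (fun w => S 1 w ^+ 2) ->
  integ P (fun w => `|S 1 w| ^+ 3) -> mean P (fun w => S 1 w) = 0 ->
  (forall k, 0 <= u k) -> (forall k, 0 <= t k) -> t k @[k --> \oo] --> +oo%R ->
  u k / t k @[k --> \oo] --> l ->
  mean P (fun w => cos (th / Num.sqrt (t k) * S (u k) w + b)) @[k --> \oo] -->
  expR (- (th ^+ 2 * (mean P (fun w => S 1 w ^+ 2) * l)) / 2) * cos b.
Proof.
move=> iX iX2 iX3 m0 u0 t0 ty ul.
pose M2 := mean P (fun w => S 1 w ^+ 2); pose M3 := mean P (fun w => `|S 1 w| ^+ 3).
have M20 : 0 <= M2 by apply: mean_ge0; apply: aeW => w; exact: sqr_ge0.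
have M30 : 0 <= M3 by apply: mean_ge0; apply: aeW => w; exact: exprn_ge0.
have tV := cvgy_inv ty.
pose a k := th / Num.sqrt (t k).
have a2 k : a k ^+ 2 = th ^+ 2 / t k by rewrite exprMn exprVn sqr_sqrtr.
have a20 : a k ^+ 2 @[k --> \oo] --> (0 : R).
  apply: (@eq_cvg_to _ R _ _ _ _ a2).
  by rewrite -[X in _ --> X](mulr0 (th ^+ 2)); apply: cvgM => //; exact: cvg_cst.
have a0 : a k @[k --> \oo] --> (0 : R).
  apply: (@cvg0_le _ _ (fun k => Num.sqrt (a k ^+ 2))).
    by move=> k; rewrite sqrtr_sqr.
  by rewrite -(sqrtr0 R); apply: (cvg_comp _ Num.sqrt); [exact: a20|exact: sqrt_continuous].
have nl := truncn_ratio_cvg u0 ty ul.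
pose n k := Num.truncn (u k).
have na : (n k)%:R * a k ^+ 2 @[k --> \oo] --> l * th ^+ 2.
  apply: (@eq_cvg_to _ R _ _ (fun k => (n k)%:R / t k * th ^+ 2)).
    by move=> k; rewrite a2; ring.
  by apply: cvgM => //; exact: cvg_cst.
(* Comparison with a centred Gaussian: angle 0. Now the number of steps times a^2 converges, so
   errors of order |a|^3 and a^4 vanish in total. *)
apply: (@levy_cos_cvg u a (fun k => expR (- (a k ^+ 2 * M2 / 2))) (fun=> 0)) => //.
- move=> k; rewrite ger0_norm ?expR_ge0// -expR0 ler_expR oppr_le0.
  by rewrite divr_ge0// mulr_ge0// sqr_ge0.
- rewrite cos0 sin0.
  apply: (@cvg0_le _ _ (fun k => `|(n k)%:R * a k ^+ 2| *
    (2 * (`|a k| * M3) + a k ^+ 2 * (M2 ^+ 2 / 4)))); last first.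
    have E0 : 0 = `|l * th ^+ 2| * (2 * (`|0 : R| * M3) + 0 * (M2 ^+ 2 / 4)).
      by rewrite normr0; ring.
    rewrite [X in _ --> X]E0.
    apply: cvgM; first exact: cvg_norm.
    apply: cvgD; last by apply: cvgM => //; exact: cvg_cst.
    by apply: cvgM; [exact: cvg_cst|apply: cvgM; [exact: cvg_norm|exact: cvg_cst]].
  move=> k; rewrite normrM normrM (ger0_norm (sqr_ge0 _)) ger0_norm//.
  rewrite -[leRHS]mulrA ler_wpM2l// ger0_norm ?addr_ge0// mulr1 mulr0 subr0.
  apply: le_trans (mean_cos_sin_clt (a k) iX iX2 iX3 m0) _; rewrite -/M2 -/M3.
  rewrite le_eqVlt; apply/orP; left; apply/eqP.
  by rewrite -(real_normK (num_real (a k))); move: `|a k| => z; field.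
apply: (@eq_cvg_to _ R _ _ (fun k => expR (- ((n k)%:R * a k ^+ 2 * (M2 / 2))) * cos b)).
  move=> k; rewrite mulr0 addr0 -expRM_natl; congr (expR _ * _); rewrite /n; ring.
apply: cvgM; last exact: cvg_cst.
rewrite (_ : - _ / 2 = - (l * th ^+ 2 * (M2 / 2))); last by rewrite /M2; ring.
apply: (cvg_comp _ expR); last exact: continuous_expR.
by apply: cvgN; apply: cvgM => //; exact: cvg_cst.
Qed.

End levy_limits.

(** * Moments from the cumulant generating function *)

Section moments.
Context d (T : measurableType d) (R : realType) (P : probability T R).
Context (X : T -> R) (mX : measurable_fun setT X).

Definition exp_moment (k : nat) (th : R) : R := mean P (fun w => X w ^+ k * expR (th * X w)).

(** One term of the exponential series absorbs |x|^k into exp (c |x|), and exp (2c |x|) is at most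
    the sum of the two exponentials. This gives one dominating function for all |th| <= c. *)
Let pow_exp_le (c x th : R) k : 0 < c -> `|th| <= c ->
  `|x ^+ k * expR (th * x)| <=
  (k`!%:R / c ^+ k) * (expR (2 * c * x) + expR (- (2 * c) * x)).
Proof.
move=> c0 thc.
have cx0 : 0 <= c * `|x| by rewrite mulr_ge0// ltW.
have h1 : `|x| ^+ k <= k`!%:R / c ^+ k * expR (c * `|x|).
  rewrite mulrAC ler_pdivlMr ?exprn_gt0// -exprMn [`|x| * c]mulrC.
  case: k => [|k]; first by rewrite expr0 fact0 mul1r -expR0 ler_expR.
  have := expR_ge1Dxn k cx0; move: (c * `|x|) => y ky.
  have yk : y ^+ k.+1 / (k.+1)`!%:R <= expR y by apply: le_trans ky; rewrite lerDr.
  by move: yk; rewrite ler_pdivrMr ?ltr0n ?fact_gt0// mulrC.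
have h2 : expR (th * x) <= expR (c * `|x|).
  rewrite ler_expR (le_trans (ler_norm _))// normrM ler_wpM2r//.
have h3 : expR (c * `|x|) * expR (c * `|x|) <= expR (2 * c * x) + expR (- (2 * c) * x).
  rewrite -expRD; have [x0|x0] := ler0P x.
    rewrite -[leLHS]add0r lerD ?expR_ge0// ler_expR; lra.
  rewrite -[leLHS]addr0 lerD ?expR_ge0// ler_expR; lra.
rewrite normrM normrX (ger0_norm (expR_ge0 _)).
have C0 : 0 <= k`!%:R / c ^+ k :> R by rewrite divr_ge0 ?exprn_ge0// ltW.
apply: le_trans (_ : (k`!%:R / c ^+ k * expR (c * `|x|)) * expR (c * `|x|) <= _).
  by apply: ler_pM => //; rewrite ?exprn_ge0 ?expR_ge0.
by rewrite -mulrA ler_wpM2l.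
Qed.

Let mpow k (th : R) : measurable_fun setT (fun w => X w ^+ k * expR (th * X w)).
Proof.
apply: measurable_funM; first exact: measurable_funX.
by apply: measurableT_comp => //; exact: measurable_funM.
Qed.

Variable c : R.
Hypothesis c0 : 0 < c.
Hypothesis mgf1 : P.-integrable setT (EFin \o (fun w => expR (2 * c * X w))).
Hypothesis mgf2 : P.-integrable setT (EFin \o (fun w => expR (- (2 * c) * X w))).

Let G k w : R := (k`!%:R / c ^+ k) * (expR (2 * c * X w) + expR (- (2 * c) * X w)).

Let integrableG k : P.-integrable setT (EFin \o G k).
Proof.
apply: integrable_EFinZ => //.
rewrite [X in _.-integrable _ X](_ : _ = (EFin \o (fun w => expR (2 * c * X w))) \+
  (EFin \o (fun w => expR (- (2 * c) * X w))))%E//.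
exact: integrableD.
Qed.

Lemma integrable_exp_moment k th : `|th| <= c ->
  P.-integrable setT (EFin \o (fun w => X w ^+ k * expR (th * X w))).
Proof.
move=> thc; apply: le_integrable (integrableG k) => //.
  exact/measurable_EFinP.
move=> w _ /=; rewrite lee_fin.
by apply: le_trans (pow_exp_le _ _ c0 thc) _; exact: ler_norm.
Qed.

Lemma is_derive_exp_moment k (th : R) : `|th| < c ->
  is_derive th 1 (exp_moment k) (exp_moment k.+1 th).
Proof.
move=> thc; pose f (t : R) w := X w ^+ k * expR (t * X w).
have df w (u : R) : is_derive u 1 (f ^~ w) (X w ^+ k.+1 * expR (u * X w)).
  have D1 : is_derive u 1 (fun u : R => u * X w) (X w).
    by apply: is_derive_eq; rewrite /GRing.scale/=; ring.
  by apply: is_derive_eq; rewrite /GRing.scale/= exprS; ring.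
have d1 w u : partial1of2 f u w = X w ^+ k.+1 * expR (u * X w).
  by rewrite /partial1of2 derive1E; have [_ ->] := df w u.
have It : `]- c, c[%classic th by rewrite /= in_itv /= -ltr_norml.
have if_ u : `]- c, c[%classic u -> P.-integrable setT (EFin \o f u).
  by rewrite /= in_itv /= -ltr_norml => /ltW uc; exact: integrable_exp_moment.
have dff u w : `]- c, c[%classic u -> setT w -> derivable (f ^~ w) u 1.
  by move=> _ _; have [] := df w u.
have G0 w : 0 <= G k.+1 w.
  by rewrite mulr_ge0 ?addr_ge0 ?expR_ge0// divr_ge0// exprn_ge0// ltW.
have Gub u w : `]- c, c[%classic u -> setT w -> `|partial1of2 f u w| <= G k.+1 w.
  by rewrite /= in_itv /= -ltr_norml => /ltW uc _; rewrite d1 pow_exp_le.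
have E := differentiation_under_integral measurableT It if_ dff G0 (integrableG k.+1) Gub.
have D := derivable_under_integral measurableT It if_ dff G0 (integrableG k.+1) Gub.
apply: DeriveDef => //.
rewrite -derive1E E; apply: eq_Rintegral => w _; exact: d1.
Qed.

End moments.

Section cumulants.
Context d (T : measurableType d) (R : realType) (P : probability T R).
Context (X : {RV P >-> R}).
Hypothesis cgf_fin : \forall th \near (0 : R), cumulant_gen_fun P X th \is a fin_num.

Let mgfE (th : R) : ('M_P X th = \int[P]_w (expR (th * X w))%:E)%E.
Proof.
rewrite /mmt_gen_fun unlock; apply: eq_integral => w _ /=.
by rewrite mulrC.
Qed.

Let mX : measurable_fun setT X. Proof. exact: measurable_funPT. Qed.

Let mexp (th : R) : measurable_fun setT (fun w => expR (th * X w)).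
Proof. by apply: measurableT_comp => //; exact: measurable_funM. Qed.

(** A finite logarithm forces the moment generating function to be finite and positive. *)
Let cgf_integrable (th : R) : cumulant_gen_fun P X th \is a fin_num ->
  P.-integrable setT (EFin \o (fun w => expR (th * X w))) /\ 0 < exp_moment P X 0 th.
Proof.
move=> Kfin; have M0 : (0 <= 'M_P X th)%E.
  by rewrite mgfE integral_ge0// => w _; rewrite lee_fin expR_ge0.
have [Mlt Mgt] : ('M_P X th < +oo)%E /\ (0 < 'M_P X th)%E.
  move: Kfin M0; rewrite /cumulant_gen_fun; case: ('M_P X th)%E => [r| |]//=.
  by case: ifPn => //; rewrite -ltNge => r0 _ _; rewrite ltry lte_fin.
have i1 : P.-integrable setT (EFin \o (fun w => expR (th * X w))).
  apply/integrableP; split; first by apply/measurable_EFinP.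
  rewrite (eq_integral (EFin \o (fun w => expR (th * X w)))) => [|w _].
    by rewrite -mgfE.
  by rewrite /= ger0_norm// expR_ge0.
split => //; rewrite /exp_moment.
under eq_mean do rewrite expr0 mul1r.
by rewrite -lte_fin /mean fineK -?mgfE// mgfE; exact: integrable_fin_num.
Qed.

(** Near 0 the cumulant generating function is ln M_0, with derivative M_1/M_0, where M_k is
    [exp_moment] of order k; M_0(0) = 1 then yields mean and variance. *)
Lemma cumulant_moments :
  [/\ integ P (fun w => X w), integ P (fun w => X w ^+ 2),
      integ P (fun w => `|X w| ^+ 3),
      (fine \o cumulant_gen_fun P X)^`()%classic 0 = mean P (fun w => X w) &
      (fine \o cumulant_gen_fun P X)^`(2)%classic 0 =
        mean P (fun w => X w ^+ 2) - mean P (fun w => X w) ^+ 2].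
Proof.
have [e /= e0 Kfin] := cgf_fin.
have {}Kfin th : `|th| < e -> cumulant_gen_fun P X th \is a fin_num.
  by move=> the; apply: Kfin; rewrite /= sub0r normrN.
(* The domination uses the exponents 2c and -2c, which must stay inside the neighbourhood of radius
   [e]. *)
pose c := e / 3; have c0 : 0 < c by rewrite divr_gt0.
have [mgf1 _] : P.-integrable setT (EFin \o (fun w => expR (2 * c * X w))) /\
    0 < exp_moment P X 0 (2 * c).
  by apply/cgf_integrable/Kfin; rewrite ger0_norm /c; lra.
have [mgf2 _] : P.-integrable setT (EFin \o (fun w => expR (- (2 * c) * X w))) /\
    0 < exp_moment P X 0 (- (2 * c)).
  by apply/cgf_integrable/Kfin; rewrite normrN ger0_norm /c; lra.
have Mgt0 th : `|th| < c -> 0 < exp_moment P X 0 th.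
  by move=> thc; have [] := cgf_integrable (Kfin th _); rewrite // (lt_trans thc)// /c; lra.
have i0 k : P.-integrable setT (EFin \o (fun w => X w ^+ k)).
  have := integrable_exp_moment mX c0 mgf1 mgf2 k (_ : `|0| <= c).
  rewrite normr0 => /(_ (ltW c0)); congr (_.-integrable _ _).
  by apply/funext => w /=; rewrite mul0r expR0 mulr1.
have EM k : exp_moment P X k 0 = mean P (fun w => X w ^+ k).
  by apply: eq_mean => w; rewrite mul0r expR0 mulr1.
have dM k (th : R) : `|th| < c -> is_derive th 1 (exp_moment P X k) (exp_moment P X k.+1 th).
  exact: is_derive_exp_moment.
have cnear (th : R) : `|th| < c -> \forall t \near th, `|t| < c.
  move=> thc; have thc' : 0 < c - `|th| by rewrite subr_gt0.
  exists (c - `|th|) => //= t; rewrite /= distrC => tth.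
  rewrite -[t](subrK th) (le_lt_trans (ler_normD _ _))//; lra.
have KE (th : R) : `|th| < c -> (fine \o cumulant_gen_fun P X) th = ln (exp_moment P X 0 th).
  move=> thc; rewrite /= /cumulant_gen_fun.
  have the : `|th| < e by rewrite (lt_trans thc)// /c; lra.
  have [thi _] := cgf_integrable (Kfin th the).
  have -> : ('M_P X th = (exp_moment P X 0 th)%:E)%E.
    rewrite mgfE /exp_moment; under eq_mean do rewrite expr0 mul1r.
    rewrite /mean fineK//; exact: (integrable_fin_num measurableT thi).
  by rewrite lne_EFin// Mgt0.
have dK (th : R) : `|th| < c ->
    (fine \o cumulant_gen_fun P X)^`()%classic th = exp_moment P X 1 th / exp_moment P X 0 th.
  move=> thc; rewrite derive1E.
  have -> : 'D_1 (fine \o cumulant_gen_fun P X) th = 'D_1 (@ln R \o exp_moment P X 0) th.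
    apply: near_eq_derive; apply: filterS (cnear th thc) => t; exact: KE.
  have [D1 D1E] := dM 0%N th thc; have [D2 D2E] := is_derive1_ln (Mgt0 th thc).
  by rewrite -derive1E derive1_comp// !derive1E D1E D2E mulrC.
have M00 : exp_moment P X 0 0 = 1.
  by rewrite EM; under eq_mean do rewrite expr0; rewrite mean_cst.
have n0 : `|0 : R| < c by rewrite normr0.
split.
- by apply: integrable_integ; have := i0 1%N;
    congr (_.-integrable _ _); apply/funext => w /=; rewrite expr1.
- exact: integrable_integ.
- have := integ_norm (integrable_integ (i0 3%N)); apply: eq_integ; apply: aeW => w.
  by rewrite normrX.
- rewrite dK// M00 divr1 EM; apply: eq_mean => w; by rewrite expr1.
rewrite [LHS]derive1E.
have -> : 'D_1 (fine \o cumulant_gen_fun P X)^`()%classic 0 =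
    'D_1 (fun t => exp_moment P X 1 t * (exp_moment P X 0 t)^-1) 0.
  by apply: near_eq_derive; apply: filterS (cnear 0 n0) => t; exact: dK.
have M0n0 : exp_moment P X 0 0 != 0 by rewrite M00 oner_eq0.
have dV := is_deriveV M0n0 (dM 0%N 0 n0).
have [_ ->] := is_deriveM (dM 1%N 0 n0) dV.
rewrite /GRing.scale /= M00 !EM.
have -> : mean P (fun w => X w ^+ 1) = mean P (fun w => X w).
  by apply: eq_mean => w; rewrite expr1.
by rewrite !expr1n invr1; ring.
Qed.

End cumulants.

(** * Self-similarity of inverse stable subordinators *)

Section laplace.
Context d (T : measurableType d) (R : realType) (P : probability T R).
Context (A B : T -> R).
Hypotheses (mA : measurable_fun setT A) (mB : measurable_fun setT B).
Hypotheses (A0 : {ae P, forall w, 0 <= A w}) (B0 : {ae P, forall w, 0 <= B w}).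
Hypothesis lapAB : forall l : R, 0 <= l ->
  mean P (fun w => expR (- (l * A w))) = mean P (fun w => expR (- (l * B w))).

(** Partial sums of exp (- c y); at y = exp (- n x) the powers of y are the Laplace kernels exp (- n
    j x). *)
Let psum (c y : R) (J : nat) : R := \sum_(j < J) (- c) ^+ j / j`!%:R * y ^+ j.

Let psum_cvg (c y : R) : psum c y J @[J --> \oo] --> expR (- (c * y)).
Proof.
have := is_cvg_series_exp_coeff (- (c * y)).
rewrite /expR => /cvg_ex[l cl]; rewrite (cvg_lim _ cl)//.
apply: eq_cvg_to cl => J; rewrite /series /= big_mkord; apply: eq_bigr => j _.
by rewrite /exp_coeff /= -mulNr exprMn mulrAC.
Qed.

Let psum_le (c y : R) J : 0 <= c -> 0 <= y <= 1 -> `|psum c y J| <= expR c.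
Proof.
move=> c0 /andP[y0 y1]; apply: (@le_trans _ _ (\sum_(j < J) c ^+ j / j`!%:R)).
  apply: (le_trans (ler_norm_sum _ _ _)); apply: ler_sum => j _.
  rewrite normrM (ger0_norm (exprn_ge0 j y0)) normrM normrX normrN (ger0_norm c0).
  rewrite (ger0_norm (_ : 0 <= j`!%:R^-1)) ?invr_ge0//.
  by rewrite ler_piMr ?divr_ge0 ?exprn_ge0// exprn_ile1.
have -> : \sum_(j < J) c ^+ j / j`!%:R = series (exp_coeff c) J.
  by rewrite /series /= big_mkord.
apply: nondecreasing_cvgn_le; last exact: is_cvg_series_exp_coeff.
move=> m n mn; rewrite /series /= !big_mkord -!(big_mkord xpredT (exp_coeff c)).
rewrite (big_cat_nat (leq0n m) mn)/= lerDl; apply: sumr_ge0 => j _.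
exact: exp_coeff_ge0.
Qed.

Let y01 (n : nat) (x : R) : 0 <= x -> 0 <= expR (- (n%:R * x)) <= 1.
Proof. by move=> x0; rewrite expR_ge0 -expR0 ler_expR oppr_le0 mulr_ge0. Qed.

Let mean_dexp (Z : T -> R) (c : R) (n : nat) : measurable_fun setT Z ->
  {ae P, forall w, 0 <= Z w} -> 0 <= c ->
  \sum_(j < J) (- c) ^+ j / j`!%:R * mean P (fun w => expR (- ((n * j)%:R * Z w)))
    @[J --> \oo] --> mean P (fun w => expR (- (c * expR (- (n%:R * Z w))))).
Proof.
move=> mZ Z0 c0; pose Z' w := Num.max 0 (Z w).
have mZ' : measurable_fun setT Z' by exact: measurable_maxr.
have Z'0 w : 0 <= Z' w by rewrite le_max lexx.
have ZZ' : {ae P, forall w, Z w = Z' w} by apply: filterS Z0 => w ?; rewrite /Z' max_r.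
have mexp k : measurable_fun setT (fun w => expR (- (k * Z' w))).
  by apply: measurableT_comp => //; apply: measurable_funN; exact: measurable_funM.
rewrite (@eq_mean_ae _ _ _ _ _ (fun w => expR (- (c * expR (- (n%:R * Z' w)))))); last first.
  by apply: filterS ZZ' => w ->.
apply: (@eq_cvg_to _ R _ _ (fun J => mean P (fun w => psum c (expR (- (n%:R * Z' w))) J))).
  move=> J; rewrite /psum mean_sum => [|j].
    apply: eq_bigr => j _; rewrite meanZ.
      congr (_ * _); apply: eq_mean_ae; apply: filterS ZZ' => w ->.
      by rewrite -expRM_natl natrM; congr expR; ring.
    apply: (@bounded_integ _ _ _ _ 1).
      by apply: measurable_aemeas; apply: measurable_funX.
    by move=> w; have /andP[? ?] := y01 n (Z'0 w); rewrite normrX ger0_norm// exprn_ile1.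
  apply: integZ; apply: (@bounded_integ _ _ _ _ 1).
    by apply: measurable_aemeas; apply: measurable_funX.
  by move=> w; have /andP[? ?] := y01 n (Z'0 w); rewrite normrX ger0_norm// exprn_ile1.
apply: (@mean_cvg _ _ _ _ (expR c)) => [J|J w|].
- apply: measurable_aemeas; apply: measurable_sum => j; apply: measurable_funM => //.
  exact: measurable_funX.
- by apply: psum_le => //; exact: y01.
by apply: aeW => w; exact: psum_cvg.
Qed.

Let mean_dexpAB (c : R) n : 0 <= c ->
  mean P (fun w => expR (- (c * expR (- (n%:R * A w))))) =
  mean P (fun w => expR (- (c * expR (- (n%:R * B w))))).
Proof.
move=> c0; have cA := @mean_dexp A c n mA A0 c0; have cB := @mean_dexp B c n mB B0 c0.
apply: (cvg_unique _ cA (@eq_cvg_to _ R _ _ _ _ _ cB)) => // J.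
by apply: eq_bigr => j _; rewrite lapAB.
Qed.

(* [exp (- exp (n (a - x)))] tends to the indicator of [a < x], up to a jump of
   height [exp (-1)] at [a]; it is a power series in [exp (- n x)]. *)
Let gumbel (a x : R) : R := if a < x then 1 else if x == a then expR (-1) else 0.

Let gumbel_cvg (a x : R) :
  expR (- (expR (n%:R * a) * expR (- (n%:R * x)))) @[n --> \oo] --> gumbel a x.
Proof.
apply: (@eq_cvg_to _ R _ _ (fun n => expR (- expR (n%:R * (a - x))))).
  by move=> n; rewrite -expRD mulrBr.
have ny (c : R) : 0 < c -> n%:R * c @[n --> \oo] --> +oo%R.
  move=> c0; apply/cvgryPge => K; near=> n; rewrite -ler_pdivrMr//.
  by near: n; exact: nbhs_infty_ger.
rewrite /gumbel; have [ax|xa|->] := ltgtP a x.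
- have xa0 : 0 < x - a by rewrite subr_gt0.
  rewrite -[X in _ --> X]expR0; apply: (cvg_comp _ expR); last exact: continuous_expR.
  rewrite -oppr0; apply: cvgN.
  apply: (@eq_cvg_to _ R _ _ (fun n => expR (- (n%:R * (x - a))))).
    by move=> n; rewrite -mulrN opprB.
  exact: (cvg_comp _ _ (ny _ xa0) (@cvgr_expR R)).
- have ax0 : 0 < a - x by rewrite subr_gt0.
  have ey : expR (n%:R * (a - x)) @[n --> \oo] --> +oo%R.
    apply: (ger_cvgy _ (ny _ ax0)); apply: nearW => n.
    by apply: le_trans (expR_ge1Dx _); rewrite lerDr.
  exact: (cvg_comp _ _ ey (@cvgr_expR R)).
apply: (@eq_cvg_to _ R _ _ (fun=> expR (-1))); last exact: cvg_cst.
by move=> n; rewrite subrr mulr0 expR0.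
Unshelve. all: by end_near. Qed.

Let gumbel_le1 (a x : R) : `|gumbel a x| <= 1.
Proof.
rewrite /gumbel; case: ifP => _; first by rewrite normr1.
case: ifP => _; last by rewrite normr0.
by rewrite ger0_norm ?expR_ge0// -expR0 ler_expR lerN10.
Qed.

Let dexp_le1 (c y : R) : 0 <= c -> 0 <= y -> `|expR (- (c * y))| <= 1.
Proof.
by move=> c0 y0; rewrite ger0_norm ?expR_ge0// -expR0 ler_expR oppr_le0 mulr_ge0.
Qed.

Let aemeas_dexp (Z : T -> R) c n : measurable_fun setT Z ->
  aemeas P (fun w => expR (- (c * expR (- (n%:R * Z w))))).
Proof.
move=> mZ; apply: measurable_aemeas.
apply: measurableT_comp => //; apply: measurable_funN; apply: measurable_funM => //.
by apply: measurableT_comp => //; apply: measurable_funN; exact: measurable_funM.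
Qed.

Let mean_gumbel_cvg (Z : T -> R) (a : R) : measurable_fun setT Z ->
  mean P (fun w => expR (- (expR (n%:R * a) * expR (- (n%:R * Z w))))) @[n --> \oo]
    --> mean P (fun w => gumbel a (Z w)).
Proof.
move=> mZ; apply: (@mean_cvg _ _ _ _ 1) => [n|n w|].
- exact: aemeas_dexp.
- by apply: dexp_le1; rewrite expR_ge0.
by apply: aeW => w; exact: gumbel_cvg.
Qed.

Let aemeas_gumbel (Z : T -> R) a : measurable_fun setT Z -> aemeas P (fun w => gumbel a (Z w)).
Proof.
move=> mZ; apply: (@aemeas_lim _ _ _ _
  (fun n w => expR (- (expR (n%:R * a) * expR (- (n%:R * Z w)))))) => [n|].
  exact: aemeas_dexp.
by apply: aeW => w; exact: gumbel_cvg.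
Qed.

Let mean_gumbelAB a : mean P (fun w => gumbel a (A w)) = mean P (fun w => gumbel a (B w)).
Proof.
have cA := @mean_gumbel_cvg A a mA; have cB := @mean_gumbel_cvg B a mB.
have E n : mean P (fun w => expR (- (expR (n%:R * a) * expR (- (n%:R * A w))))) =
    mean P (fun w => expR (- (expR (n%:R * a) * expR (- (n%:R * B w))))).
  by apply: mean_dexpAB; exact: expR_ge0.
have cA' := @eq_cvg_to _ R _ _ _ _ E cB.
exact: (cvg_unique _ cA cA').
Qed.

(** Moving the threshold slightly to the right removes the spurious value exp (-1) at x = a. *)
Let gumbel_right (a x : R) : gumbel (a + n.+1%:R^-1) x @[n --> \oo] --> ((a < x)%R%:R : R).
Proof.
have [ax|xa] := ltP a x.
  apply: cvg_near_cst; near=> n.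
  rewrite /gumbel ifT// -ltrBrDl.
  near: n; have xa0 : 0 < x - a by rewrite subr_gt0.
  exact: (near_infty_natSinv_lt (PosNum xa0)).
apply: (@eq_cvg_to _ R _ _ (fun=> 0)); last exact: cvg_cst.
move=> n; have xn : x < a + n.+1%:R^-1 by rewrite (le_lt_trans xa)// ltrDl invr_gt0.
by rewrite /gumbel ltNge (ltW xn) /= lt_eqF.
Unshelve. all: by end_near. Qed.

Lemma laplace_tail (a : R) :
  mean P (fun w => (a < A w)%R%:R) = mean P (fun w => (a < B w)%R%:R).
Proof.
have cv Z : measurable_fun setT Z ->
    mean P (fun w => gumbel (a + n.+1%:R^-1) (Z w)) @[n --> \oo] -->
    mean P (fun w => (a < Z w)%R%:R).
  move=> mZ; apply: (@mean_cvg _ _ _ _ 1) => [n|n w|].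
  - exact: aemeas_gumbel.
  - exact: gumbel_le1.
  by apply: aeW => w; exact: gumbel_right.
have cA := cv _ mA; have cB := cv _ mB.
have cA' := @eq_cvg_to _ R _ _ _ _ (fun n => mean_gumbelAB (a + n.+1%:R^-1)) cB.
exact: (cvg_unique _ cA cA').
Qed.

End laplace.

(** * First passage of a stable subordinator *)

Section stable.
Context d (T : measurableType d) (R : realType) (P : probability T R).
Context (nu : R) (X : R -> {RV P >-> R}) (hX : stable_subordinator nu X).

Lemma stable_ge0 (s : R) : 0 <= s -> {ae P, forall w, 0 <= X s w}.
Proof.
move=> s0; have [_ [X0 _ _ _] mX _] := hX.
apply: filterS2 X0 mX => w X0w mXw.
by rewrite -[leLHS]X0w; exact: mXw.
Qed.

Lemma stable_laplace (s l : R) : 0 <= s -> 0 <= l ->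
  mean P (fun w => expR (- (l * X s w))) = expR (- (s * l `^ nu)).
Proof.
move=> s0 l0; have [_ _ _ /(_ s l s0 l0)] := hX.
rewrite /mmt_gen_fun unlock => e; rewrite /mean -[RHS]/(fine (expR _)%:E) -e.
by congr fine; apply: eq_integral => w _ /=; rewrite mulrN mulrC.
Qed.

(** The Laplace exponent is homogeneous of degree [nu]: X(a^nu s) and a X(s) both have the transform
    exp (- s (a l)^nu). *)
Lemma stable_scaling (a s t : R) : 0 < a -> 0 <= s ->
  mean P (fun w => (t * a < X (a `^ nu * s) w)%R%:R) =
  mean P (fun w => (t < X s w)%R%:R).
Proof.
move=> a0 s0; have as0 : 0 <= a `^ nu * s by rewrite mulr_ge0 ?powR_ge0.
rewrite (@laplace_tail _ _ _ P _ (fun w => a * X s w)).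
- by apply: eq_mean => w; rewrite mulrC ltr_pM2l.
- exact: measurable_funPT.
- by apply: measurable_funM => //; exact: measurable_funPT.
- exact: stable_ge0.
- by apply: filterS (stable_ge0 s0) => w ?; rewrite mulr_ge0// ltW.
move=> l l0; rewrite stable_laplace//.
transitivity (mean P (fun w => expR (- (l * a * X s w)))); last first.
  by apply: eq_mean => w; rewrite mulrA.
rewrite stable_laplace ?mulr_ge0 ?(ltW a0)// powRM ?(ltW a0)//.
by congr expR; ring.
Qed.

(** Markov's inequality at Laplace parameter 1 gives P(X(n) <= t) <= exp (t - n). It guarantees that
    the set of passage times is nonempty, so that its infimum is not the default value of [inf]. *)
Lemma stable_unbounded (t : R) : {ae P, forall w, exists n : nat, t < X n%:R w}.
Proof.
pose N := \bigcap_n (X n%:R @^-1` `]-oo, t]).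
have mXn n : measurable (X n%:R @^-1` `]-oo, t]%classic).
  by rewrite -[_ @^-1` _]setTI; exact: (measurable_funPT (X n%:R)).
have mN : measurable N by exact: bigcapT_measurable.
exists N; split => //; last first.
  move=> w /= nw n _; rewrite /= in_itv /= leNgt; apply/negP => tX.
  by apply: nw; exists n.
have PN n : fine (P N) <= expR (t - n%:R).
  rewrite -mean_indic// expRD -[X in _ * expR (- X)]mulr1.
  rewrite -[X in _ * X](_ : mean P (fun w => expR (- (1 * X n%:R w))) = _); last first.
    by rewrite stable_laplace// powR1.
  have iX : integ P (fun w => expR (- (1 * X n%:R w))).
    have e : integ P (fun w => expR (- (Num.max 0 (X n%:R w)))).
      apply: (@bounded_integ _ _ _ _ 1).
        apply: measurable_aemeas; apply: measurableT_comp => //.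
        by apply: measurable_funN; exact: measurable_maxr.
      by move=> w; rewrite ger0_norm ?expR_ge0// -expR0 ler_expR oppr_le0 le_max lexx.
    apply: eq_integ e; apply: filterS (stable_ge0 (ler0n R n)) => w Xw.
    by rewrite mul1r max_r.
  rewrite -meanZ//; apply: le_mean; last 1 first.
  - move=> w; rewrite -expRD mul1r indicE; have [/set_mem Nw|_] := boolP (w \in N).
      apply: le_trans (expR_ge1Dx _); rewrite lerDl subr_ge0.
      by have := Nw n Logic.I; rewrite /= in_itv.
    exact: expR_ge0.
  - apply: (@bounded_integ _ _ _ _ 1).
      by apply: measurable_aemeas; exact: measurable_indic.
    by move=> w; rewrite indicE; case: (_ \in _); rewrite ?normr1 ?normr0.
  - exact: integZ.
have PN0 : 0 <= fine (P N) by rewrite fine_ge0.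
rewrite -(@fineK _ (P N)) ?fin_num_measure//; congr EFin.
apply/eqP; rewrite eq_le PN0 andbT leNgt; apply/negP => p0.
(* Beyond t - ln P(N) the bound exp (t - n) drops below P(N), a contradiction. *)
pose n := (Num.truncn (t - ln (fine (P N)))).+1.
have := PN n; rewrite -[leLHS]lnK ?posrE// ler_expR lerBrDl -lerBrDr leNgt.
by move=> /negP; apply; exact: truncnS_gt.
Qed.

Context (L : R -> {RV P >-> R}).
Hypothesis hL : {ae P, forall w, forall t : R, 0 <= t ->
  L t w = inf [set s : R | 0 <= s /\ t < X s w]}.

Let has_inf_passage (t : R) :
  {ae P, forall w, has_inf [set s : R | 0 <= s /\ t < X s w]}.
Proof.
apply: filterS (stable_unbounded t) => w [n tX]; split; first by exists n%:R.
by exists 0 => s [].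
Qed.

Lemma inverse_stable_ge0 (t : R) : 0 <= t -> {ae P, forall w, 0 <= L t w}.
Proof.
move=> t0; apply: filterS2 hL (has_inf_passage t) => w /(_ t t0) -> [ne _].
by apply: lb_le_inf => // s [].
Qed.

(** The points x n/(n+1) stay strictly below x. If L(t) < x, some passage time lies below x and by
    monotonicity the process exceeds t at all later such points; if L(t) >= x, it exceeds t at none
    of them. *)
Lemma inverse_stable_lt_cvg (t x : R) : 0 <= t -> 0 < x ->
  mean P (fun w => (t < X (x * (n%:R / n.+1%:R)) w)%R%:R) @[n --> \oo] -->
  mean P (fun w => (L t w < x)%R%:R).
Proof.
move=> t0 x0; apply: (@mean_cvg _ _ _ _ 1) => [n|n w|].
- apply: (@aemeas_comp _ _ _ _ (fun y => (t < y)%R%:R)).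
    rewrite (_ : (fun y : R => _) = \1_(`]t, +oo[)).
      exact: measurable_indic.
    by apply/funext => y; rewrite indicE mem_setE in_itv /= andbT.
  exact/measurable_aemeas/measurable_funPT.
- by case: (_ < _)%R; rewrite ?normr1 ?normr0.
have [_ _ mX _] := hX.
apply: filterS3 hL (has_inf_passage t) mX => w /(_ t t0) Lw hi mXw.
have xn0 n : 0 <= x * (n%:R / n.+1%:R) by rewrite mulr_ge0 ?(ltW x0)// divr_ge0.
have [Lx|xL] := ltP (L t w) x.
  have [s [s0 tX] sx] : exists2 s : R, 0 <= s /\ t < X s w & s < x.
    by move: Lx; rewrite Lw => /(inf_lt hi.1)[s ? ?]; exists s.
  apply: cvg_near_cst; near=> n; rewrite (lt_le_trans tX)// mXw//.
  apply: ltW; near: n.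
  have cx : x * (n%:R / n.+1%:R) @[n --> \oo] --> x.
    rewrite -[X in _ --> X]mulr1; apply: cvgMr.
    rewrite -[X in _ --> X]subr0.
    apply: (@eq_cvg_to _ R _ _ (fun n => 1 - n.+1%:R^-1)).
      by move=> n; rewrite -natr1; field; rewrite natr1.
    by apply: cvgB; [exact: cvg_cst|exact: cvg_harmonic].
  by move/cvgrPdist_lt: cx => /(_ (x - s)); rewrite subr_gt0 => /(_ sx);
    apply: filterS => n; rewrite ltr_distlC => /andP[+ _]; rewrite subKr.
apply: (@eq_cvg_to _ R _ _ (fun=> 0)); last exact: cvg_cst.
move=> n; case: ltP => // tX.
have : L t w <= x * (n%:R / n.+1%:R).
  by rewrite Lw; apply: ge_inf => //; exact: hi.2.
rewrite leNgt => /negP[]; apply: lt_le_trans xL.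
by rewrite gtr_pMr// ltr_pdivrMr// mul1r ltr_nat.
Unshelve. all: by end_near. Qed.

Lemma inverse_stable_lt (t x : R) : 0 < t ->
  mean P (fun w => (L t w < x)%R%:R) = mean P (fun w => (t `^ nu * L 1 w < x)%R%:R).
Proof.
move=> t0; have tn0 : 0 < t `^ nu by exact: powR_gt0.
have [x0|x0] := leP x 0.
  transitivity (mean P (fun=> 0)); [|symmetry]; apply: eq_mean_ae.
    apply: filterS (inverse_stable_ge0 (ltW t0)) => w L0.
    by rewrite ltNge (le_trans x0).
  apply: filterS (inverse_stable_ge0 ler01) => w L0.
  by rewrite ltNge (le_trans x0)// mulr_ge0// ltW.
have cA := inverse_stable_lt_cvg (ltW t0) x0.
have cB := inverse_stable_lt_cvg ler01 (divr_gt0 x0 tn0).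
have E n : mean P (fun w => (t < X (x * (n%:R / n.+1%:R)) w)%R%:R) =
    mean P (fun w => (1 < X (x / t `^ nu * (n%:R / n.+1%:R)) w)%R%:R).
  have s0 : 0 <= x / t `^ nu * (n%:R / n.+1%:R).
    by rewrite mulr_ge0 ?divr_ge0// ltW.
  rewrite -(stable_scaling 1 t0 s0) mul1r; congr (mean P _); apply/funext => w.
  congr ((_ < X _ w)%R%:R).
  by rewrite mulrA (mulrC (t `^ nu)) divfK ?gt_eqF.
have cA' := @eq_cvg_to _ R _ _ _ _ E cB.
rewrite (cvg_unique _ cA cA')//; apply: eq_mean => w.
by rewrite ltr_pdivlMr// mulrC.
Qed.

Let integ_lt (Z : T -> R) (x : R) : measurable_fun setT Z ->
  integ P (fun w => (Z w < x)%R%:R).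
Proof.
move=> mZ; apply: (@bounded_integ _ _ _ _ 1).
  apply: (@aemeas_comp _ _ _ _ (fun y => (y < x)%R%:R)).
    rewrite (_ : (fun y : R => _) = \1_(`]-oo, x[%classic)).
      exact: measurable_indic.
    by apply/funext => y; rewrite indicE mem_setE in_itv.
  exact/measurable_aemeas.
by move=> w; case: (_ < _)%R; rewrite ?normr1 ?normr0.
Qed.

(** The form of self-similarity that [mean_freeze] consumes: a cell is the difference of two
    half-lines. *)
Lemma inverse_stable_cell (t : R) n k : 0 < t ->
  mean P (fun w => \1_(cell n k) (L t w)) =
  mean P (fun w => \1_(cell n k) (t `^ nu * L 1 w)).
Proof.
move=> t0.
have E (Z : T -> R) : measurable_fun setT Z -> mean P (fun w => \1_(cell n k) (Z w)) =
    mean P (fun w => (Z w < k.+1%:R / n.+1%:R)%R%:R) -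
    mean P (fun w => (Z w < k%:R / n.+1%:R)%R%:R).
  move=> mZ; rewrite -meanB.
  - apply: eq_mean => w; rewrite indicE mem_setE in_itv /= leNgt.
    have [Zk|kZ] := ltP (Z w) (k%:R / n.+1%:R).
      by rewrite (lt_trans Zk) ?subrr// ltr_pM2r ?invr_gt0// ltr_nat.
    by rewrite subr0.
  - exact: integ_lt.
  - exact: integ_lt.
rewrite !E; first by rewrite !inverse_stable_lt.
- by apply: measurable_funM => //; exact: measurable_funPT.
- exact: measurable_funPT.
Qed.

End stable.

(** * Levy processes at mixed random times *)

Section power_limits.
Context (R : realType).

Lemma powR_cvgy (t : nat -> R) (s : R) : 0 < s -> t n @[n --> \oo] --> +oo%R ->
  t n `^ s @[n --> \oo] --> +oo%R.
Proof.
move=> s0 ty; apply/cvgryPge => K.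
move/cvgryPge : (ty) => /(_ (Num.max 0 K `^ s^-1)); apply: filterS => n tK.
have K0 : 0 <= Num.max 0 K by rewrite le_max lexx.
rewrite (@le_trans _ _ (Num.max 0 K))//; first by rewrite le_max lexx orbT.
rewrite -[leLHS]powRr1// -(mulVf (lt0r_neq0 s0)) powRrM.
by rewrite ge0_ler_powR ?nnegrE ?powR_ge0 ?(le_trans _ tK) ?powR_ge0// ltW.
Qed.

(** The origin of the indicators in the limits: with [M] the larger exponent, the ratio is 1 if [a]
    attains it and tends to 0 otherwise. *)
Lemma powR_ratio_cvg (t : nat -> R) (a M : R) : a <= M ->
  (forall n, 0 < t n) -> t n @[n --> \oo] --> +oo%R ->
  t n `^ a / t n `^ M @[n --> \oo] --> ((M <= a)%R%:R : R).
Proof.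
move=> aM t0 ty.
have E n : t n `^ a / t n `^ M = (t n `^ (M - a))^-1.
  rewrite -!powRN -powRD; last by rewrite (lt0r_neq0 (t0 n)) implybT.
  by rewrite opprB.
apply: (@eq_cvg_to _ R _ _ _ _ E).
have [Ma|{}aM] := leP M a.
  apply: (@eq_cvg_to _ R _ _ (fun=> 1)); last exact: cvg_cst.
  by move=> n; rewrite (le_anti (introT andP (conj aM Ma))) subrr powRr0 invr1.
by apply: cvgy_inv; apply: powR_cvgy; rewrite ?subr_gt0.
Qed.

End power_limits.

Section independence_tools.
Context d (T : measurableType d) (R : realType) (P : probability T R).

(** Restriction to a subfamily; it discards the Levy processes once only the limit variable is
    studied. *)
Lemma mutual_indep_inj (I J : finType) (F : I -> set (set T)) (f : J -> I) :
  injective f -> mutual_independence P F -> mutual_independence P (F \o f).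
Proof.
move=> injf indF K A FA.
pose A' i := if [pick j | f j == i] is Some j then A j else setT.
have A'f j : A' (f j) = A j.
  rewrite /A'; case: pickP => [j' /eqP/injf -> //|/(_ j)]; by rewrite eqxx.
have FA' i : i \in (f @: K)%SET -> F i (A' i).
  by move=> /imsetP[j jK ->]; rewrite A'f; exact: FA.
have := indF _ _ FA'; rewrite big_imset /=; last by move=> ? ? _ _; exact: injf.
under eq_bigr do rewrite A'f.
move=> <-; congr (P _); apply/seteqP; split => w /= Aw i iK.
  by move: iK => /= /imsetP[j jK ->]; rewrite A'f; exact: Aw.
by rewrite -A'f; apply: Aw => /=; exact: imset_f.
Qed.

Lemma process_sigma_comp (X : R -> {RV P >-> R}) (t : R) (g : R -> R) B :
  0 <= t -> measurable_fun setT g -> measurable B ->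
  process_sigma_algebra X ((g \o X t) @^-1` B).
Proof.
move=> t0 mg mB; apply: sub_sigma_algebra; exists t => //.
exists (g @^-1` B); last by rewrite setTI.
by rewrite -[X in measurable X]setTI; exact: mg.
Qed.

Lemma g_sigma_preimage_comp (Z : T -> R) (g : R -> R) B :
  measurable_fun setT g -> measurable B ->
  g_sigma_algebra_preimage Z ((g \o Z) @^-1` B).
Proof.
move=> mg mB; exists (g @^-1` B); last by rewrite setTI.
by rewrite -[X in measurable X]setTI; exact: mg.
Qed.

End independence_tools.

Section weak_convergence.
Context d (T : measurableType d) (R : realType) (P : probability T R) (h : nat).

Lemma weakly_cvg_of_cos (V : R -> T -> 'rV[R]_h) (Y : T -> 'rV[R]_h) :
  (forall t, 0 < t -> aemeas_row P (V t)) -> aemeas_row P Y ->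
  (forall (th b : 'I_h -> R) (t : nat -> R), (forall n, 0 < t n) ->
    t n @[n --> \oo] --> +oo%R ->
    mean P (cos_prod th b \o V (t n)) @[n --> \oo] --> mean P (cos_prod th b \o Y)) ->
  weakly_cvg P V Y.
Proof.
move=> mV mY cV f cf [M fM].
have iV Z : aemeas_row P Z -> integ P (f \o Z).
  move=> mZ; apply: (@bounded_integ _ _ _ _ M) => [|w]; last exact: fM.
  exact: continuous_aemeas fM mZ.
rewrite (expectation_mean (iV _ mY)).
apply: cvg_EFin.
  near=> t; have t0 : 0 < t by near: t; exact: nbhs_pinfty_gt.
  by rewrite (expectation_mean (iV _ (mV _ t0))).
rewrite /= unlock; apply/cvg_pinftyP => u uy.
(* The cosine hypothesis asks for times that are positive at every index; the maximum only alters
   finitely many terms. *)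
pose t n := Num.max 1 (u n).
have t0 n : 0 < t n by rewrite lt_max ltr01.
have tu : \forall n \near \oo, t n = u n.
  move/cvgryPge : uy => /(_ 1); apply: filterS => n u1.
  by rewrite /t max_r.
have ty : t n @[n --> \oo] --> +oo%R.
  apply/cvgryPge => K; move/cvgryPge : uy => /(_ K); apply: filterS => n uK.
  by rewrite le_max uK orbT.
have cvt := @mean_cvg_of_cos _ _ _ P h (fun n => V (t n)) Y
  (fun n => mV _ (t0 n)) mY (fun th b => cV th b t t0 ty) f M cf fM.
apply: cvg_trans cvt; apply: near_eq_cvg; apply: filterS tu => n tun.
by rewrite tun.
Unshelve. all: by end_near. Qed.

End weak_convergence.

Section time_change.
Context d (T : measurableType d) (R : realType) (P : probability T R) (h : nat).
Context (c nu : 'I_h.+1 -> R).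
Context (S : 'I_h -> R -> {RV P >-> R}) (L : 'I_h.+1 -> R -> {RV P >-> R}).
Hypothesis c0 : forall j, 0 < c j.
Hypothesis hS : forall i, levy_process (S i).
Hypothesis hL : forall j, inverse_stable_subordinator (nu j) (L j).
Hypothesis indSL : mutual_independence P (fun k : 'I_h + 'I_h.+1 =>
  match k with
  | inl i => process_sigma_algebra (S i)
  | inr j => process_sigma_algebra (L j)
  end).

Definition mixed_time (i : 'I_h) (l : 'I_h.+1 -> R) : R :=
  c (lift ord0 i) * l (lift ord0 i) + c ord0 * l ord0.

(** The coefficient of the dominant power of t in the mixed time; both terms survive when the two
    exponents coincide. *)
Definition limit_time (i : 'I_h) (l : 'I_h.+1 -> R) : R :=
  c (lift ord0 i) * l (lift ord0 i) * (nu ord0 <= nu (lift ord0 i))%R%:R +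
  c ord0 * l ord0 * (nu (lift ord0 i) <= nu ord0)%R%:R.

Lemma mixed_time_ge0 i l : (forall j, 0 <= l j) -> 0 <= mixed_time i l.
Proof. by move=> l0; rewrite addr_ge0// mulr_ge0// ltW. Qed.

Lemma inverse_stable_process_ge0 (t : R) j : 0 <= t -> {ae P, forall w, 0 <= L j t w}.
Proof. by have [X hX LX] := hL j; exact: inverse_stable_ge0 hX _ LX _. Qed.

Let nonneg_L : {ae P, forall w, forall j, 0 <= L j 1 w}.
Proof. by apply: ae_forall_fin => j; exact: inverse_stable_process_ge0. Qed.

(** As the coefficients [c] are positive, coordinates approached strictly from the right give a time
    approached strictly from the right. *)
Lemma right_continuous_mixed :
  {ae P, forall w, forall i, right_continuous_path (fun l => S i (mixed_time i l) w)}.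
Proof.
apply: ae_forall_fin => i; have [_ _ _] := hS i; apply: filterS => w cw l l0 u lu ul.
have [rc _] := cw _ (mixed_time_ge0 i l0).
have um n : mixed_time i l < mixed_time i (u n).
  by rewrite /mixed_time ltrD// ltr_pM2l.
have uml : mixed_time i (u n) @[n --> \oo] --> mixed_time i l.
  by apply: cvgD; apply: cvgM; [exact: cvg_cst|exact: ul|exact: cvg_cst|exact: ul].
apply: (cvg_comp _ (fun x => S i x w)) rc.
move=> A [e /= e0 Ae]; move/cvgrPdist_lt: uml => /(_ _ e0).
by apply: filterS => n /Ae; apply; exact: um.
Qed.

Lemma aemeas_time_change (t : R) i : 0 <= t ->
  aemeas P (fun w => S i (mixed_time i (fun j => L j t w)) w).
Proof.
move=> t0.
apply: (@aemeas_freeze _ _ _ P _ (fun j => L j t) (fun l w => S i (mixed_time i l) w)).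
- by move=> j; exact: measurable_funPT.
- by move=> j; exact: inverse_stable_process_ge0.
- by move=> l _; exact/measurable_aemeas/measurable_funPT.
by apply: filterS right_continuous_mixed => w; exact.
Qed.

Lemma mean_indep_SL (t : R) (s b u : 'I_h -> R) (Q : 'I_h.+1 -> R -> R) : 0 <= t ->
  (forall i, 0 <= u i) -> (forall j, measurable_fun setT (Q j)) ->
  (forall j x, `|Q j x| <= 1) ->
  mean P (fun w => (\prod_j Q j (L j t w)) *
    \prod_i cos (s i * S i (u i) w + b i)) =
  (\prod_j mean P (fun w => Q j (L j t w))) *
    \prod_i mean P (fun w => cos (s i * S i (u i) w + b i)).
Proof.
move=> t0 u0 mQ Q1.
pose Y (k : 'I_h + 'I_h.+1) : T -> R := match k with
  | inl i => (fun x => cos (s i * x + b i)) \o S i (u i)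
  | inr j => Q j \o L j t end.
have E w : (\prod_j Q j (L j t w)) * (\prod_i cos (s i * S i (u i) w + b i)) =
    \prod_k Y k w by rewrite big_sumType mulrC.
rewrite (eq_mean _ E) (@mutual_indep_mean _ _ _ P _ _ Y 1 indSL).
- by rewrite big_sumType mulrC.
- move=> [i|j]; last exact: measurableT_comp (mQ j) (measurable_funPT _).
  exact: measurableT_comp (measurable_cosD _ _) (measurable_funPT _).
- by move=> [i|j] w; [exact: norm_cos_le1|exact: Q1].
- by move=> [i|j] B mB; apply: process_sigma_comp => //; exact: measurable_cosD.
Qed.

(** Freezing with L_j(t) replaced in law by t^(nu_j) L_j(1): on the right the random times are built
    from the same variables for every t, so that limits can be taken pointwise. *)
Lemma mean_time_change (t : R) (s b : 'I_h -> R) : 0 < t ->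
  let G w := \prod_i mean P (fun w' =>
    cos (s i * S i (mixed_time i (fun j => t `^ nu j * L j 1 w)) w' + b i)) in
  aemeas P G /\
  mean P (fun w => \prod_i cos (s i * S i (mixed_time i (fun j => L j t w)) w + b i)) =
  mean P G.
Proof.
move=> t0 G.
pose H (l : 'I_h.+1 -> R) w := \prod_i cos (s i * S i (mixed_time i l) w + b i).
pose L' j w := t `^ nu j * L j 1 w.
have HE l : (forall j, 0 <= l j) -> mean P (H l) =
    \prod_i mean P (fun w => cos (s i * S i (mixed_time i l) w + b i)).
  move=> l0; have u0 i := mixed_time_ge0 i l0.
  have m1 (j : 'I_h.+1) : measurable_fun setT (fun _ : R => 1 : R) by exact: measurable_cst.
  have le1 (j : 'I_h.+1) (x : R) : `|1 : R| <= 1 by rewrite normr1.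
  (* With constant factors 1 in place of the functions of [L], only the independence of the [S i]
     remains; any time would do. *)
  have := @mean_indep_SL 0 s b _ (fun _ _ => 1) (lexx _) u0 m1 le1.
  rewrite [X in _ = X * _]big1 ?mul1r; last by move=> j _; rewrite mean_cst.
  by move=> <-; apply: eq_mean => w; rewrite big1 ?mul1r.
have L'0 j : {ae P, forall w, 0 <= L' j w}.
  by apply: filterS (inverse_stable_process_ge0 j ler01) => w ?; rewrite mulr_ge0// powR_ge0.
have GE : {ae P, forall w, G w = mean P (H (L' ^~ w))}.
  by apply: filterS (ae_forall_fin L'0) => w l0; rewrite HE.
have HL : [/\ aemeas P (fun w => H (fun j => L j t w) w),
    aemeas P (fun w => mean P (H (L' ^~ w))) &
    mean P (fun w => H (fun j => L j t w) w) = mean P (fun w => mean P (H (L' ^~ w)))].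
  apply: (@mean_freeze _ _ _ P _ (fun j => L j t) L' H 1).
  - by move=> j; exact: measurable_funPT.
  - by move=> j; apply: measurable_funM => //; exact: measurable_funPT.
  - by move=> j; exact: inverse_stable_process_ge0 (ltW t0).
  - exact: L'0.
  - by move=> l w; apply: norm_prod_le1 => i; exact: norm_cos_le1.
  - move=> l _; apply: aemeas_prod => i.
    exact/aemeas_cos/measurable_aemeas/measurable_funPT.
  - apply: filterS right_continuous_mixed => w rc l l0 u lu ul.
    apply: cvg_prodr => i; apply: (cvg_comp _ cos); last exact: continuous_cos.
    apply: cvgD; last exact: cvg_cst.
    by apply: cvgM; [exact: cvg_cst|exact: rc].
  - move=> n k l l0; rewrite HE//.
    exact: (mean_indep_SL s b (ltW t0) (fun i => mixed_time_ge0 i l0)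
      (fun j => measurable_indic_cell n (k j)) (fun j => norm_cell_le1 n (k j))).
  - move=> n k.
    have mQ j : measurable_fun setT (fun x : R => \1_(cell n (k j)) (t `^ nu j * x) : R).
      by apply: measurableT_comp (@measurable_indic_cell R n (k j)) _; exact: measurable_funM.
    (* Zero coefficients turn every cosine into 1, which leaves the factorization over [L] alone. *)
    have := @mean_indep_SL 1 (fun=> 0) (fun=> 0) (fun=> 0) _ ler01 (fun=> lexx _) mQ
      (fun j x => norm_cell_le1 n (k j) _).
    rewrite [X in _ = _ * X]big1 ?mulr1; last first.
      move=> i _; rewrite -[RHS](mean_cst P); apply: eq_mean => w.
      by rewrite mul0r add0r cos0.
    move=> <-; apply: eq_mean => w; rewrite [X in _ = _ * X]big1 ?mulr1// => i _.
    by rewrite mul0r add0r cos0.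
  - move=> n k j; have [X hX LX] := hL j; exact: inverse_stable_cell hX _ LX _ _ _ t0.
have [_ mG eG] := HL; split; first exact: eq_aemeas GE mG.
by rewrite eG; apply: eq_mean_ae; apply: filterS GE => w ->.
Qed.

Lemma mixed_time_ratio_cvg (t : nat -> R) i l :
  (forall n, 0 < t n) -> t n @[n --> \oo] --> +oo%R ->
  mixed_time i (fun j => t n `^ nu j * l j) /
    t n `^ Num.max (nu ord0) (nu (lift ord0 i)) @[n --> \oo] --> limit_time i l.
Proof.
move=> t0 ty; set M := Num.max _ _.
apply: (@eq_cvg_to _ R _ _ (fun n =>
  c (lift ord0 i) * l (lift ord0 i) * (t n `^ nu (lift ord0 i) / t n `^ M) +
  c ord0 * l ord0 * (t n `^ nu ord0 / t n `^ M))).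
  by move=> n; rewrite /mixed_time; ring.
have -> : limit_time i l = c (lift ord0 i) * l (lift ord0 i) * (M <= nu (lift ord0 i))%R%:R +
    c ord0 * l ord0 * (M <= nu ord0)%R%:R.
  by rewrite /limit_time !ge_max !lexx andbT.
by apply: cvgD; apply: cvgM; try exact: cvg_cst; apply: powR_ratio_cvg => //;
  rewrite le_max lexx ?orbT.
Qed.

(** The transfer from deterministic times to random ones: [gP] is the limit theorem for a nonrandom
    time sequence, applied at each frozen sample point before bounded convergence. *)
Lemma time_change_cvg (t : nat -> R) (s : nat -> 'I_h -> R) (b : 'I_h -> R)
    (g : 'I_h -> R -> R) :
  (forall n, 0 < t n) -> t n @[n --> \oo] --> +oo%R ->
  (forall i (u : nat -> R) (l : R), (forall n, 0 <= u n) ->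
    u n / t n `^ Num.max (nu ord0) (nu (lift ord0 i)) @[n --> \oo] --> l ->
    mean P (fun w => cos (s n i * S i (u n) w + b i)) @[n --> \oo] --> g i l) ->
  mean P (fun w => \prod_i cos (s n i * S i (mixed_time i (fun j => L j (t n) w)) w + b i))
    @[n --> \oo] -->
  mean P (fun w => \prod_i g i (limit_time i (fun j => L j 1 w))).
Proof.
move=> t0 ty gP.
pose G n w := \prod_i mean P (fun w' =>
    cos (s n i * S i (mixed_time i (fun j => t n `^ nu j * L j 1 w)) w' + b i)).
apply: (@eq_cvg_to _ R _ _ _ _ (fun n => (mean_time_change (s n) b (t0 n)).2)).
apply: (@mean_cvg _ _ _ P 1 G) => [n|n w|].
- exact: (mean_time_change (s n) b (t0 n)).1.
- apply: norm_prod_le1 => i; apply: mean_le_bound => [|w']; last exact: norm_cos_le1.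
  exact/aemeas_cos/measurable_aemeas/measurable_funPT.
apply: filterS nonneg_L => w l0; apply: cvg_prodr => i; apply: gP => [n|].
  by apply: mixed_time_ge0 => j; rewrite mulr_ge0// powR_ge0.
exact: (@mixed_time_ratio_cvg t i (fun j => L j 1 w) t0 ty).
Qed.

End time_change.

(** * The Gaussian limit, conditionally on the inverse subordinators *)

Section gaussian_limit.
Context d (T : measurableType d) (R : realType) (P : probability T R) (h : nat).
Context (c nu : 'I_h.+1 -> R) (L : 'I_h.+1 -> R -> {RV P >-> R}).
Context (Z Zhat : 'I_h -> {RV P >-> R}).
Hypothesis c0 : forall j, 0 < c j.
Hypothesis hL : forall j, inverse_stable_subordinator (nu j) (L j).
Hypotheses (hZ : forall i, standard_normal (Z i)) (hZh : forall i, standard_normal (Zhat i)).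
Hypothesis indLZ : mutual_independence P (fun k : 'I_h.+1 + ('I_h + 'I_h) =>
  match k with
  | inl j => process_sigma_algebra (L j)
  | inr (inl i) => g_sigma_algebra_preimage (Z i)
  | inr (inr i) => g_sigma_algebra_preimage (Zhat i)
  end).

Lemma standard_normal_cos (N : {RV P >-> R}) (s b : R) : standard_normal N ->
  mean P (fun w => cos (s * N w + b)) = expR (- s ^+ 2 / 2) * cos b.
Proof.
move=> hN; rewrite -normal_prob_cos /mean; congr fine.
have mN : @measurable_fun _ _ T (measurableTypeR R) setT N.
  by move=> mD B mB; exact: (measurable_funPT N).
pose N' : {RV P >-> measurableTypeR R} :=
  @mfun_Sub _ _ T (measurableTypeR R) _ (mem_set mN).
have mc : @measurable_fun _ _ (measurableTypeR R) R setT (fun x : R => cos (s * x + b)).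
  by move=> mD B mB; exact: (@measurable_cosD R s b).
transitivity (\int[distribution P N']_x (EFin \o (fun x => cos (s * x + b))) x)%E.
  rewrite integral_distribution//; first exact/measurable_EFinP.
  apply: (@bounded_integrable _ _ _ _ 1 ((fun x => cos (s * x + b)) \o N)) => [|w].
    exact: measurableT_comp.
  exact: norm_cos_le1.
by apply: eq_measure_integral => B mB _; exact: hN.
Qed.

(* [cos_add_split] turns the product of cosines of sums into a signed sum of
   products of cosines in the single variables, to which independence applies. *)
Lemma mean_gaussian_mix (th b A B : 'I_h -> R) (Q : 'I_h.+1 -> R -> R) :
  (forall j, measurable_fun setT (Q j)) -> (forall j x, `|Q j x| <= 1) ->
  mean P (fun w => (\prod_j Q j (L j 1 w)) *
    \prod_i cos (th i * (A i * Z i w + B i * Zhat i w) + b i)) =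
  (\prod_j mean P (fun w => Q j (L j 1 w))) *
    \prod_i (expR (- (th i ^+ 2 * (A i ^+ 2 + B i ^+ 2)) / 2) * cos (b i)).
Proof.
move=> mQ Q1.
pose ph (s : bool) : R := s%:R * (pi / 2).
pose X i (s : bool) w := cos (th i * A i * Z i w + (b i - ph s)).
pose X' i (s : bool) w := cos (th i * B i * Zhat i w + (0 - ph s)).
have splitE w : \prod_i cos (th i * (A i * Z i w + B i * Zhat i w) + b i) =
    \sum_(f : {ffun 'I_h -> bool}) \prod_i ((-1) ^+ f i * (X i (f i) w * X' i (f i) w)).
  rewrite -(bigA_distr_bigA (fun i s => (-1) ^+ nat_of_bool s * (X i s w * X' i s w))).
  apply: eq_bigr => i _.
  rewrite (_ : _ + b i = (th i * A i * Z i w + b i) + th i * B i * Zhat i w); last by ring.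
  rewrite cos_add_split; apply: eq_bigr => s _; rewrite /X /X' sub0r -/(ph s).
  by rewrite -addrA.
pose Y (f : {ffun 'I_h -> bool}) (k : 'I_h.+1 + ('I_h + 'I_h)) : T -> R := match k with
  | inl j => Q j \o L j 1
  | inr (inl i) => (fun x => cos (th i * A i * x + (b i - ph (f i)))) \o Z i
  | inr (inr i) => (fun x => cos (th i * B i * x + (0 - ph (f i)))) \o Zhat i end.
have mY f k : measurable_fun setT (Y f k).
  case: k => [j|[i|i]]; first exact: measurableT_comp (mQ j) (measurable_funPT _).
    exact: measurableT_comp (measurable_cosD _ _) (measurable_funPT _).
  exact: measurableT_comp (measurable_cosD _ _) (measurable_funPT _).
have Y1 f k w : `|Y f k w| <= 1.
  by case: k => [j|[i|i]]; [exact: Q1|exact: norm_cos_le1|exact: norm_cos_le1].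
have mean_Y f := @mutual_indep_mean _ _ _ P _ _ (Y f) 1 indLZ (mY f) (Y1 f).
have FY f k C : measurable C -> (match k with
    | inl j => process_sigma_algebra (L j)
    | inr (inl i) => g_sigma_algebra_preimage (Z i)
    | inr (inr i) => g_sigma_algebra_preimage (Zhat i)
    end) (Y f k @^-1` C).
  move=> mC; case: k => [j|[i|i]]; first exact: process_sigma_comp.
    exact: g_sigma_preimage_comp (measurable_cosD _ _) mC.
  exact: g_sigma_preimage_comp (measurable_cosD _ _) mC.
have iprod f : integ P (fun w => \prod_k Y f k w).
  apply: (@bounded_integ _ _ _ _ 1) => [|w]; last by apply: norm_prod_le1 => k.
  by apply: aemeas_prod => k; exact: measurable_aemeas.
have E w : (\prod_j Q j (L j 1 w)) *
      \prod_i cos (th i * (A i * Z i w + B i * Zhat i w) + b i) =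
    \sum_(f : {ffun 'I_h -> bool}) (\prod_i (-1) ^+ f i) * \prod_k Y f k w.
  rewrite splitE big_distrr; apply: eq_bigr => f _ /=.
  by rewrite big_sumType /= big_sumType /= big_split /= mulrCA big_split.
rewrite (eq_mean _ E) mean_sum => [|f]; last exact: integZ.
transitivity (\sum_(f : {ffun 'I_h -> bool}) (\prod_j mean P (fun w => Q j (L j 1 w))) *
    \prod_i ((-1) ^+ f i * (mean P (X i (f i)) * mean P (X' i (f i))))).
  apply: eq_bigr => f _; rewrite meanZ// mean_Y; last exact: FY.
  by rewrite big_sumType /= big_sumType /= big_split /= mulrCA big_split.
rewrite -big_distrr; congr (_ * _).
rewrite -(bigA_distr_bigA (fun i (s : bool) => (-1) ^+ s * (mean P (X i s) * mean P (X' i s)))).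
apply: eq_bigr => i _.
(* The splitting formula read backwards with second argument 0: the Gaussian factors do not depend
   on the phase, so the signed sum of cosines collapses to cos (b i). *)
have -> : cos (b i) = cos (b i + 0) by rewrite addr0.
rewrite cos_add_split big_distrr; apply: eq_bigr => s _ /=.
rewrite !standard_normal_cos// -!/(ph s).
rewrite (_ : expR (- (th i ^+ 2 * _) / 2) = expR (- (th i * A i) ^+ 2 / 2) *
  expR (- (th i * B i) ^+ 2 / 2)); first by ring.
by rewrite -expRD; congr expR; ring.
Qed.

(** Given L(1), coordinate i is a centred normal variable of variance k_i times its limit time: the
    two squared roots add up, and their indicators are those of [limit_time]. Freezing is applied
    with the same [L 1] on both sides. *)
Lemma mean_gaussian_limit (th b k : 'I_h -> R) : (forall i, 0 <= k i) ->
  mean P (fun w => \prod_i cos (th i *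
    (Num.sqrt (c (lift ord0 i) * L (lift ord0 i) 1 w * k i *
               (nu ord0 <= nu (lift ord0 i))%R%:R) * Z i w +
     Num.sqrt (c ord0 * L ord0 1 w * k i *
               (nu (lift ord0 i) <= nu ord0)%R%:R) * Zhat i w) + b i)) =
  mean P (fun w => \prod_i (expR (- (th i ^+ 2 *
    (k i * limit_time c nu i (fun j => L j 1 w))) / 2) * cos (b i))).
Proof.
move=> k0.
pose A i (l : 'I_h.+1 -> R) := Num.sqrt (c (lift ord0 i) * l (lift ord0 i) * k i *
  (nu ord0 <= nu (lift ord0 i))%R%:R).
pose B i (l : 'I_h.+1 -> R) := Num.sqrt (c ord0 * l ord0 * k i *
  (nu (lift ord0 i) <= nu ord0)%R%:R).
pose H (l : 'I_h.+1 -> R) w := \prod_i cos (th i * (A i l * Z i w + B i l * Zhat i w) + b i).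
have mZ (l : 'I_h.+1 -> R) i : measurable_fun setT (fun w => A i l * Z i w + B i l * Zhat i w).
  by apply: measurable_funD; apply: measurable_funM => //; exact: measurable_funPT.
have L0 := inverse_stable_process_ge0 hL.
have L1 j : {ae P, forall w, 0 <= L j 1 w} by exact: L0.
have meanH l : mean P (H l) =
    \prod_i (expR (- (th i ^+ 2 * (A i l ^+ 2 + B i l ^+ 2)) / 2) * cos (b i)).
  have m1 (j : 'I_h.+1) : measurable_fun setT (fun _ : R => 1 : R) by exact: measurable_cst.
  have le1 (j : 'I_h.+1) (x : R) : `|1 : R| <= 1 by rewrite normr1.
  have := mean_gaussian_mix th b (A ^~ l) (B ^~ l) m1 le1.
  rewrite [X in _ = X * _]big1 ?mul1r; last by move=> j _; rewrite mean_cst.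
  by move=> <-; apply: eq_mean => w; rewrite big1 ?mul1r.
have cellH n (kk : 'I_h.+1 -> nat) l :
    mean P (fun w => (\prod_j \1_(cell n (kk j)) (L j 1 w)) * H l w) =
    (\prod_j mean P (fun w => \1_(cell n (kk j)) (L j 1 w))) * mean P (H l).
  by rewrite meanH; exact: (mean_gaussian_mix th b (A ^~ l) (B ^~ l)
    (fun j => measurable_indic_cell n (kk j)) (fun j => norm_cell_le1 n (kk j))).
have HL : [/\ aemeas P (fun w => H (fun j => L j 1 w) w),
    aemeas P (fun w => mean P (H (fun j => L j 1 w))) &
    mean P (fun w => H (fun j => L j 1 w) w) =
    mean P (fun w => mean P (H (fun j => L j 1 w)))].
  apply: (@mean_freeze _ _ _ P _ (fun j => L j 1) (fun j => L j 1) H 1) => //.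
  - by move=> l w; apply: norm_prod_le1 => i; exact: norm_cos_le1.
  - by move=> l _; apply: aemeas_prod => i; exact/aemeas_cos/measurable_aemeas.
  - apply: aeW => w l l0 u lu ul.
    apply: cvg_prodr => i; apply: (cvg_comp _ cos); last exact: continuous_cos.
    apply: cvgD; last exact: cvg_cst.
    apply: cvgM; first exact: cvg_cst.
    have sq (a e : R) j : Num.sqrt (a * u n j * k i * e) @[n --> \oo] -->
        Num.sqrt (a * l j * k i * e).
      apply: (cvg_comp _ Num.sqrt); last exact: sqrt_continuous.
      by apply: cvgM; [apply: cvgM; [apply: cvgM; [exact: cvg_cst|exact: ul]|]|]; exact: cvg_cst.
    by apply: cvgD; apply: cvgM; (exact: cvg_cst || exact: sq).
  - move=> n kk.
    have := mean_gaussian_mix (fun=> 0) (fun=> 0) (fun=> 0) (fun=> 0)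
      (fun j => measurable_indic_cell n (kk j)) (fun j => norm_cell_le1 n (kk j)).
    rewrite [X in _ = _ * X]big1 ?mulr1; last first.
      by move=> i _; rewrite expr0n /= mul0r oppr0 mul0r expR0 cos0 mulr1.
    move=> <-; apply: eq_mean => w; rewrite [X in _ = _ * X]big1 ?mulr1// => i _.
    by rewrite mul0r add0r cos0.
have [_ _ eHL] := HL; rewrite [LHS]eHL; apply: eq_mean_ae.
have := ae_forall_fin L1; apply: filterS => w l0; rewrite meanH.
apply: eq_bigr => i _; congr (expR (- (_ * _) / 2) * _).
rewrite /A /B /limit_time sqr_sqrtr ?mulr_ge0 ?(ltW (c0 _))//.
rewrite sqr_sqrtr ?mulr_ge0 ?(ltW (c0 _))//.
move: (_ <= _)%R%:R (_ <= _)%R%:R => e1 e2; ring.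
Qed.

End gaussian_limit.

Section scaling_factor.
Context (R : realType).

Lemma powR_scale (t x : R) : 0 < t -> t `^ (1 - x) / t = (t `^ x)^-1.
Proof.
move=> t0; rewrite powRD; last by rewrite (lt0r_neq0 t0) implybT.
by rewrite powRr1 ?(ltW t0)// powRN mulrAC mulfV ?mul1r// lt0r_neq0.
Qed.

Lemma powR_scale_half (t x : R) : 0 < t -> t `^ (1 - x / 2) / t = (Num.sqrt (t `^ x))^-1.
Proof. by move=> t0; rewrite powR_scale// powRrM powR12_sqrt// powR_ge0. Qed.

End scaling_factor.

(* Index 0 of c, nu, L is [ord0]; index i in {1, ..., h} is [lift ord0 i] for
   i : 'I_h. *)
Theorem proposition3p2 (R : realType) (d : measure_display)
  (T : measurableType d) (P : probability T R)
  (h : nat) (c nu : 'I_h.+1 -> R)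
  (S : 'I_h -> R -> {RV P >-> R}) (L : 'I_h.+1 -> R -> {RV P >-> R})
  (m kappa2 : 'rV[R]_h) :
  (1 <= h)%N ->
  (forall j, 0 < c j) ->
  (forall j, 0 < nu j < 1) ->
  (forall i, levy_process (S i)) ->
  (forall i, \forall theta \near (0 : R),
     cumulant_gen_fun P (S i 1) theta \is a fin_num) ->
  m = \row_i (fine \o cumulant_gen_fun P (S i 1))^`()%classic 0 ->
  kappa2 = \row_i (fine \o cumulant_gen_fun P (S i 1))^`(2)%classic 0 ->
  (forall j, inverse_stable_subordinator (nu j) (L j)) ->
  mutual_independence P (fun k : 'I_h + 'I_h.+1 =>
    match k with
    | inl i => process_sigma_algebra (S i)
    | inr j => process_sigma_algebra (L j)
    end) ->
  let V (t : R) (w : T) : 'rV[R]_h :=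
    \row_i (t `^ alpha m (Num.max (nu ord0) (nu (lift ord0 i))) *
      (S i (c (lift ord0 i) * L (lift ord0 i) t w + c ord0 * L ord0 t w) w
         / t)) in
  (m = 0 ->
   forall Z Zhat : 'I_h -> {RV P >-> R},
     (forall i, standard_normal (Z i)) ->
     (forall i, standard_normal (Zhat i)) ->
     mutual_independence P
       (fun k : ('I_h + 'I_h.+1) + ('I_h + 'I_h) =>
        match k with
        | inl (inl i) => process_sigma_algebra (S i)
        | inl (inr j) => process_sigma_algebra (L j)
        | inr (inl i) => g_sigma_algebra_preimage (Z i)
        | inr (inr i) => g_sigma_algebra_preimage (Zhat i)
        end) ->
     weakly_cvg P V (fun w => \row_i
       (Num.sqrt (c (lift ord0 i) * L (lift ord0 i) 1 w * kappa2 0 i *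
                  (nu ord0 <= nu (lift ord0 i))%R%:R) * Z i w +
        Num.sqrt (c ord0 * L ord0 1 w * kappa2 0 i *
                  (nu (lift ord0 i) <= nu ord0)%R%:R) * Zhat i w)))
  /\
  (m <> 0 ->
   weakly_cvg P V (fun w => \row_i
     (c (lift ord0 i) * m 0 i * (nu ord0 <= nu (lift ord0 i))%R%:R *
        L (lift ord0 i) 1 w +
      c ord0 * m 0 i * (nu (lift ord0 i) <= nu ord0)%R%:R * L ord0 1 w))).
Proof.
move=> _ c0 nu01 hS hK mE kE hL indSL V.
have mom i := cumulant_moments (hK i).
have mi i : m 0 i = mean P (fun w => S i 1 w) by rewrite mE mxE; have [_ _ _ ->] := mom i.
have mV t : 0 < t -> aemeas_row P (V t).
  move=> t0 i.
  apply: (@eq_aemeas _ _ _ _ _ ((fun x => t `^ alpha m (Num.max (nu ord0) (nu (lift ord0 i))) *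
      (x / t)) \o (fun w => S i (mixed_time c i (fun j => L j t w)) w))).
    by apply: aeW => w; rewrite mxE.
  apply: aemeas_comp; last exact: (aemeas_time_change c0 hS hL i (ltW t0)).
  by apply: measurable_funM => //; exact: measurable_funM.
have ty_scale (t : nat -> R) i : t n @[n --> \oo] --> +oo%R ->
    t n `^ Num.max (nu ord0) (nu (lift ord0 i)) @[n --> \oo] --> +oo%R.
  by apply: powR_cvgy; rewrite lt_max; case/andP: (nu01 ord0) => ->.
have VE th b t : mean P (cos_prod th b \o V t) = mean P (fun w => \prod_i cos (th i *
    (t `^ alpha m (Num.max (nu ord0) (nu (lift ord0 i))) / t) *
    S i (mixed_time c i (fun j => L j t w)) w + b i)).
  apply: eq_mean => w; apply: eq_bigr => i _; rewrite mxE; congr (cos (_ + _)).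
  by rewrite -!mulrA; congr (_ * (_ * _)); rewrite mulrC.
split => [m0 Z Zhat hZ hZh indSLZ|m0].
- apply: weakly_cvg_of_cos => // [i|th b t t0 ty].
    apply: (@eq_aemeas _ _ _ _ _ (fun w =>
      Num.sqrt (c (lift ord0 i) * L (lift ord0 i) 1 w * kappa2 0 i *
                (nu ord0 <= nu (lift ord0 i))%R%:R) * Z i w +
      Num.sqrt (c ord0 * L ord0 1 w * kappa2 0 i *
                (nu (lift ord0 i) <= nu ord0)%R%:R) * Zhat i w)).
      by apply: aeW => w; rewrite mxE.
    have msqrt j (k e : R) : measurable_fun setT (fun w => Num.sqrt (c j * L j 1 w * k * e)).
      apply: measurableT_comp; first exact: continuous_measurable_fun (@sqrt_continuous R).
      by do 3?apply: measurable_funM => //.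
    by apply: measurable_aemeas; apply: measurable_funD; apply: measurable_funM.
  (* The second cumulant is the variance, which is the second moment since the mean is 0. *)
  have k2 i : kappa2 0 i = mean P (fun w => S i 1 w ^+ 2).
    rewrite kE mxE; have [_ _ _ _ ->] := mom i.
    by rewrite -mi m0 mxE expr0n subr0.
  pose f (k : 'I_h.+1 + ('I_h + 'I_h)) : ('I_h + 'I_h.+1) + ('I_h + 'I_h) :=
    match k with inl j => inl (inr j) | inr z => inr z end.
  have injf : injective f by move=> [j|z] [j'|z'] //= [->].
  have indLZ := mutual_indep_inj injf indSLZ.
  have -> : mean P (cos_prod th b \o (fun w => \row_i
       (Num.sqrt (c (lift ord0 i) * L (lift ord0 i) 1 w * kappa2 0 i *
                  (nu ord0 <= nu (lift ord0 i))%R%:R) * Z i w +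
        Num.sqrt (c ord0 * L ord0 1 w * kappa2 0 i *
                  (nu (lift ord0 i) <= nu ord0)%R%:R) * Zhat i w))) =
      mean P (fun w => \prod_i (expR (- (th i ^+ 2 *
        (kappa2 0 i * limit_time c nu i (fun j => L j 1 w))) / 2) * cos (b i))).
    rewrite -(@mean_gaussian_limit _ _ _ _ _ c nu L Z Zhat)//.
    + by apply: eq_mean => w; apply: eq_bigr => i _; rewrite mxE.
    + move: indLZ; congr (mutual_independence P _); apply/funext.
      by case=> [j|[i|i]].
    + by move=> i; rewrite k2; apply: mean_ge0; apply: aeW => w; exact: sqr_ge0.
  apply: (@eq_cvg_to _ R _ _ _ _ (fun n => VE th b (t n))).
  apply: (@time_change_cvg _ _ _ _ _ c nu S L c0 hS hL indSL t _ b
    (fun i l => expR (- (th i ^+ 2 * (kappa2 0 i * l)) / 2) * cos (b i)) t0 ty).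
  move=> i u l u0 ul; have [iX iX2 iX3 _ _] := mom i.
  have mX0 : mean P (fun w => S i 1 w) = 0 by rewrite -mi m0 mxE.
  have := @levy_clt _ _ _ _ _ (hS i) u _ l (th i) (b i) iX iX2 iX3 mX0 u0
    (fun n => powR_ge0 _ _) (ty_scale t i ty) ul.
  rewrite -k2; apply: eq_cvg_to => n.
  by rewrite /alpha m0 eqxx powR_scale_half.
- apply: weakly_cvg_of_cos => // [i|th b t t0 ty].
    apply: (@eq_aemeas _ _ _ _ _ (fun w =>
      c (lift ord0 i) * m 0 i * (nu ord0 <= nu (lift ord0 i))%R%:R * L (lift ord0 i) 1 w +
      c ord0 * m 0 i * (nu (lift ord0 i) <= nu ord0)%R%:R * L ord0 1 w)).
      by apply: aeW => w; rewrite mxE.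
    by apply: measurable_aemeas; apply: measurable_funD; apply: measurable_funM.
  apply: (@eq_cvg_to _ R _ _ _ _ (fun n => VE th b (t n))).
  pose g i (l : R) := cos (b i + l * (th i * m 0 i)).
  have -> : mean P (cos_prod th b \o (fun w => \row_i
     (c (lift ord0 i) * m 0 i * (nu ord0 <= nu (lift ord0 i))%R%:R *
        L (lift ord0 i) 1 w +
      c ord0 * m 0 i * (nu (lift ord0 i) <= nu ord0)%R%:R * L ord0 1 w))) =
      mean P (fun w => \prod_i g i (limit_time c nu i (fun j => L j 1 w))).
    apply: eq_mean => w; apply: eq_bigr => i _; rewrite mxE /g /limit_time.
    move: (_ <= _)%R%:R (_ <= _)%R%:R => e1 e2; congr cos; ring.
  (* A coordinate with vanishing drift needs no separate case: [g] is then the constant cos (b i),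
     the transform of a limit equal to 0. *)
  apply: (@time_change_cvg _ _ _ _ _ c nu S L c0 hS hL indSL t _ b g t0 ty).
  move=> i u l u0 ul; have [iX iX2 _ _ _] := mom i.
  have := @levy_lln _ _ _ _ _ (hS i) u _ l (th i) (b i) iX iX2 u0 (ty_scale t i ty) ul.
  rewrite -mi; apply: eq_cvg_to => n.
  by rewrite /alpha (introF eqP m0) powR_scale.
Qed.
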